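(* Let $\Omega\subset\mathbb{R}^N$ be a bounded, open and connected set with boundary $\Gamma$ of class $C^2$. Let $k:[0,\infty)\to[0,\infty)$ be a locally absolutely continuous function such that $k(0)>0$, $\int_0^\infty k(t)\,dt=1$, and, for some constant $\eta>0$, $k'(t)\le-\eta\,k(t)$ for a.e. $t\ge0$ (so in particular $k'(t)\le 0$ for a.e. $t\ge 0$). Then there exists a positive number $\alpha$ such that for every weak solution $u$ of $$u_{tt}-\triangle u+\int_0^t k(t-s)\,\triangle u(s)\,ds=0\quad\text{in }(0,\infty)\times\Omega,\qquad u=0\ \text{ on }(0,\infty)\times\Gamma,$$ the energy $$E(t)=\frac12\int_\Omega|u_t(t,x)|^2\,dx+\frac12\Big(1-\int_0^t k(s)\,ds\Big)\int_\Omega|\nabla u(t,x)|^2\,dx+\frac12\int_\Omega\int_0^t k(t-s)\,|\nabla u(s,x)-\nabla u(t,x)|^2\,ds\,dx$$ satisfies $$E(t)\le E(0)\,e^{1-\alpha t}\qquad\forall t\ge0.$$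
   Context: A weak solution of the equation is a function $u\in C([0,\infty);H^1_0(\Omega))\cap C^1([0,\infty);L^2(\Omega))$ such that for every $v\in H^1_0(\Omega)$ the function $t\mapsto\int_\Omega u_t(t,x)\,v(x)\,dx$ belongs to $C^1([0,\infty))$ and $$\frac{d}{dt}\int_\Omega u_t\,v\,dx+\int_\Omega\nabla u\cdot\nabla v\,dx-\int_\Omega\int_0^t k(t-s)\nabla u(s)\,ds\cdot\nabla v\,dx=0\qquad\forall t\ge0.$$ All spaces are real. *)

(* Defs.v *)
From HB Require Import structures.
From mathcomp Require Import all_boot all_order all_algebra.
From mathcomp Require Import all_classical all_reals all_analysis.

Set Implicit Arguments.
Unset Strict Implicit.
Unset Printing Implicit Defensive.
Import Order.TTheory GRing.Theory Num.Theory.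
Import numFieldNormedType.Exports.
Local Open Scope classical_set_scope.
Local Open Scope ring_scope.

(* The sigma-algebra of R^n: generated by the coordinates, as the library does
   for n.-tuple R. *)
Section measurable_rV.
Context {R : realType} (n : nat).

Definition coord_rV (i : 'I_n) (x : 'rV[R]_n) : measurableTypeR R := x 0 i.

Let rV_set0 : g_sigma_preimage coord_rV set0.
Proof. exact: sigma_algebra0. Qed.

Let rV_setC A : g_sigma_preimage coord_rV A -> g_sigma_preimage coord_rV (~` A).
Proof. exact: sigma_algebraC. Qed.

Let rV_bigcup (F : _^nat) : (forall i, g_sigma_preimage coord_rV (F i)) ->
  g_sigma_preimage coord_rV (\bigcup_i (F i)).
Proof. exact: sigma_algebra_bigcup. Qed.

HB.instance Definition _ := @isMeasurable.Build default_measure_display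
  'rV[R]_n (g_sigma_preimage coord_rV) rV_set0 rV_setC rV_bigcup.

Lemma measurable_coord_rV (i : 'I_n) :
  measurable_fun [set: 'rV[R]_n] (coord_rV i).
Proof.
move=> _ Y mY; rewrite setTI; apply: sub_sigma_algebra => /=.
rewrite -bigcup_seq/=; exists i => /=; first by rewrite mem_index_enum.
by exists Y => //; rewrite setTI.
Qed.

Lemma measurable_fun_rV d (T : measurableType d) (f : T -> 'rV[R]_n) :
  (forall i, measurable_fun [set: T] (coord_rV i \o f)) ->
  measurable_fun [set: T] f.
Proof.
move=> mf.
apply: (@measurability _ _ _ _ _ _ (\big[setU/set0]_(i < n)
  preimage_set_system [set: 'rV[R]_n] (coord_rV i) measurable)) => //.
move=> _ [B + <-]; rewrite -bigcup_seq/= => -[i _ [A mA <-]].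
by have := mf i measurableT A mA; rewrite !setTI.
Qed.

End measurable_rV.

Section lebesgue_rV_step.
Context {R : realType} (n : nat).

Definition cons_rV (p : measurableTypeR R * 'rV[R]_n) : 'rV[R]_n.+1 :=
  row_mx (const_mx p.1 : 'rV[R]_1) p.2.

Definition uncons_rV (x : 'rV[R]_n.+1) : measurableTypeR R * 'rV[R]_n :=
  (x 0 0, \row_j x 0 (lift ord0 j)).

Lemma cons_rV0 p : cons_rV p 0 0 = p.1.
Proof.
have -> : (0 : 'I_n.+1) = lshift n (0 : 'I_1) by apply/val_inj.
by rewrite [LHS](row_mxEl (const_mx p.1 : 'rV[R]_1) p.2) mxE.
Qed.

Lemma cons_rVS p j : cons_rV p 0 (lift ord0 j) = p.2 0 j.
Proof.
have -> : lift ord0 j = rshift 1 j :> 'I_n.+1 by apply/val_inj.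
by rewrite [LHS](row_mxEr (const_mx p.1 : 'rV[R]_1) p.2).
Qed.

Lemma cons_rVK : cancel cons_rV uncons_rV.
Proof.
move=> [a y]; rewrite /uncons_rV cons_rV0; congr pair.
by apply/rowP => j; rewrite mxE cons_rVS.
Qed.

Lemma uncons_rVK : cancel uncons_rV cons_rV.
Proof.
move=> x; apply/rowP => j; case: (unliftP ord0 j) => [k ->|->].
  by rewrite cons_rVS mxE.
by rewrite cons_rV0.
Qed.

Lemma measurable_cons_rV : measurable_fun setT cons_rV.
Proof.
apply: measurable_fun_rV => i; case: (unliftP ord0 i) => [k ->|->].
  rewrite (_ : _ \o _ = coord_rV k \o snd).
    by apply: measurableT_comp; [exact: measurable_coord_rV|].
  by apply/funext => p /=; rewrite /coord_rV cons_rVS.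
rewrite (_ : _ \o _ = fst)//.
by apply/funext => p /=; rewrite /coord_rV cons_rV0.
Qed.

Lemma measurable_uncons_rV : measurable_fun setT uncons_rV.
Proof.
apply/measurable_fun_pairP; split; first exact: (measurable_coord_rV ord0).
apply: measurable_fun_rV => i.
rewrite (_ : _ \o _ = coord_rV (lift ord0 i)); first exact: measurable_coord_rV.
by apply/funext => x; rewrite /coord_rV /= mxE.
Qed.

Variable mu : {sigma_finite_measure set 'rV[R]_n -> \bar R}.

Definition lebesgue_rVS : set 'rV[R]_n.+1 -> \bar R :=
  pushforward (lebesgue_measure \x mu)%E cons_rV.

Let lebesgue_rVS0 : lebesgue_rVS set0 = 0%E.
Proof. by rewrite /lebesgue_rVS /pushforward preimage_set0 measure0. Qed.

Let lebesgue_rVS_ge0 A : (0 <= lebesgue_rVS A)%E.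
Proof. by rewrite /lebesgue_rVS /pushforward; exact: measure_ge0. Qed.

Let lebesgue_rVS_sigma_additive : semi_sigma_additive lebesgue_rVS.
Proof.
move=> F mF tF mUF; rewrite /lebesgue_rVS /pushforward preimage_bigcup.
apply: measure_semi_sigma_additive.
- by move=> k; rewrite -[X in measurable X]setTI; exact: measurable_cons_rV.
- apply/trivIsetP => /= i j _ _ ij; rewrite -preimage_setI.
  by move/trivIsetP : tF => /(_ _ _ _ _ ij) ->//; rewrite preimage_set0.
- rewrite -preimage_bigcup -[X in measurable X]setTI.
  exact: measurable_cons_rV.
Qed.

HB.instance Definition _ := @isMeasure.Build _ _ _ lebesgue_rVS
  lebesgue_rVS0 lebesgue_rVS_ge0 lebesgue_rVS_sigma_additive.

Let lebesgue_rVS_sigma_finite : sigma_finite setT lebesgue_rVS.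
Proof.
have /sigma_finiteP[F [TF ndF Foo]] := sigma_finiteT (@lebesgue_measure R).
have /sigma_finiteP[G [TG ndG Goo]] := sigma_finiteT mu.
exists (fun k => uncons_rV @^-1` (F k `*` G k)).
  rewrite -preimage_bigcup (_ : \bigcup_k _ = setT) ?preimage_setT//.
  rewrite -subTset => -[x y] _.
  have [i _ Fix] : (\bigcup_i F i) x by rewrite -TF.
  have [j _ Gjy] : (\bigcup_j G j) y by rewrite -TG.
  exists (maxn i j) => //; split => /=.
    by move: x Fix; exact/subsetPset/ndF/leq_maxl.
  by move: y Gjy; exact/subsetPset/ndG/leq_maxr.
move=> k; have [mF Fk] := Foo k; have [mG Gk] := Goo k; split.
  rewrite -[X in measurable X]setTI.
  by apply: measurable_uncons_rV => //; exact: measurableX.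
rewrite /lebesgue_rVS /pushforward -comp_preimage.
rewrite (_ : uncons_rV \o cons_rV = id); last exact/funext/cons_rVK.
by rewrite product_measure1E// lte_mul_pinfty// ge0_fin_numE.
Qed.

HB.instance Definition _ := @Measure_isSigmaFinite.Build _ _ _
  lebesgue_rVS lebesgue_rVS_sigma_finite.

End lebesgue_rV_step.

Fixpoint lebesgue_rV (R : realType) (n : nat) :
    {sigma_finite_measure set 'rV[R]_n -> \bar R} :=
  match n with
  | 0 => \d_ (0 : 'rV[R]_0)
  | m.+1 => lebesgue_rVS (lebesgue_rV R m)
  end.

Lemma lebesgue_rV_box (R : realType) (n : nat) (A : 'I_n -> set R) :
  (forall i, measurable (A i)) ->
  lebesgue_rV R n [set x | forall i, A i (x 0 i)] =
    (\prod_(i < n) @lebesgue_measure R (A i))%E.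
Proof.
elim: n A => [|n IHn] A mA.
  by rewrite big_ord0 /= diracE mem_set// => -[].
have mB : measurable
    [set y : 'rV[R]_n | forall i : 'I_n, A (lift ord0 i) (y 0 i)].
  rewrite [X in measurable X](_ : _ = \bigcap_(i in [set: 'I_n])
      (coord_rV i @^-1` A (lift ord0 i))).
    apply: fin_bigcap_measurable => // i _; rewrite -[X in measurable X]setTI.
    by apply: measurable_coord_rV => //; exact: mA.
  apply/funext => x; apply/propext; split=> Ax i; last exact: (Ax i I).
  by move=> _; exact: (Ax i).
rewrite big_ord_recl -IHn// /= /lebesgue_rVS /pushforward -product_measure1E//;
  last exact: mA.
congr ((_ \x _)%E _); apply/seteqP; split=> -[a y] /=.
  move=> Ay; split; first by have := Ay ord0; rewrite cons_rV0.
  by move=> i; have := Ay (lift ord0 i); rewrite cons_rVS.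
move=> [Aa Ay] i; case: (unliftP ord0 i) => [k ->|->].
  by rewrite cons_rVS; exact: Ay.
by rewrite cons_rV0.
Qed.

Section domains.
Context {R : realType} {N : nat}.
Implicit Types (Omega : set 'rV[R]_N) (f : 'rV[R]_N -> R).

Definition partial (i : 'I_N) f : 'rV[R]_N -> R :=
  fun x => 'D_(delta_mx 0 i) f x.

Definition grad f : 'rV[R]_N -> 'rV[R]_N := fun x => \row_i partial i f x.

Fixpoint Ck (k : nat) f : Prop :=
  match k with
  | 0 => continuous f
  | m.+1 => continuous f /\
      forall i, (forall x, derivable f x (delta_mx 0 i)) /\ Ck m (partial i f)
  end.

Definition boundary Omega : set 'rV[R]_N := closure Omega `\` interior Omega.

(* Near each boundary point and up to the choice and orientation of one axis i,
   Omega is the strict supergraph of a C^2 function gamma of the other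
   coordinates. *)
Definition C2_boundary Omega : Prop :=
  forall x0, boundary Omega x0 ->
  exists (r : R) (i : 'I_N) (b : bool) (gamma : 'rV[R]_N -> R),
    [/\ 0 < r, Ck 2 gamma,
        forall x y : 'rV[R]_N, (forall j, j != i -> x 0 j = y 0 j) -> gamma x = gamma y &
        forall x, ball x0 r x -> (Omega x <-> gamma x < (-1) ^+ b * x 0 i)].

End domains.

Section sobolev.
Context {R : realType} {N : nat}.
Implicit Types (Omega : set 'rV[R]_N) (v f : 'rV[R]_N -> R).
Implicit Types (Dv : 'rV[R]_N -> 'rV[R]_N).

Local Notation mu := (lebesgue_rV R N).

Definition dotv (x y : 'rV[R]_N) : R := \sum_i x 0 i * y 0 i.

Definition L2 Omega f : Prop := (f \_ Omega) \in Lfun mu 2%:E.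

Definition L2norm Omega f : \bar R := Lnorm mu 2%:E (EFin \o (f \_ Omega)).

Definition test_function Omega (phi : 'rV[R]_N -> R) : Prop :=
  [/\ forall k, Ck k phi,
      compact (closure [set x | phi x != 0]) &
      closure [set x | phi x != 0] `<=` Omega].

Definition weak_gradient Omega v Dv : Prop :=
  forall phi, test_function Omega phi -> forall i,
    \int[mu]_(x in Omega) (v x * partial i phi x) =
    - \int[mu]_(x in Omega) (Dv x 0 i * phi x).

(* Elements of H^1 are handled as pairs (v, Dv) of a representative of the
   class and a representative of its (almost everywhere unique) weak gradient. *)
Definition H1 Omega v Dv : Prop :=
  [/\ L2 Omega v, forall i, L2 Omega (fun x => Dv x 0 i) &
      weak_gradient Omega v Dv].

Definition H1norm Omega v Dv : \bar R :=
  ((\int[mu]_(x in Omega) (v x ^+ 2 + dotv (Dv x) (Dv x))%:E) `^ 2^-1)%E.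

Definition H10 Omega v Dv : Prop :=
  H1 Omega v Dv /\
  exists phi : nat -> 'rV[R]_N -> R,
    (forall n, test_function Omega (phi n)) /\
    H1norm Omega (phi n \- v) (fun x => grad (phi n) x - Dv x)
      @[n --> \oo] --> 0%E.

End sobolev.

Section evolution.
Context {R : realType} {N : nat}.
Implicit Types (Omega : set 'rV[R]_N) (k : R -> R).
Implicit Types (u ut : R -> 'rV[R]_N -> R) (Du : R -> 'rV[R]_N -> 'rV[R]_N).

Local Notation mu := (lebesgue_rV R N).
Local Notation leb := (@lebesgue_measure R).
Local Notation halfline := (`[0, +oo[%classic : set R).

Definition locally_abs_continuous (f : R -> R) : Prop :=
  forall T : R, 0 < T -> forall e : R, 0 < e -> exists2 d : R, 0 < d &
  forall (n : nat) (a b : nat -> R),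
    (forall i, (i < n)%N -> 0 <= a i /\ a i <= b i /\ b i <= T) ->
    trivIset `I_n (fun i => `]a i, b i[%classic) ->
    \sum_(i < n) (b i - a i) < d ->
    \sum_(i < n) `|f (b i) - f (a i)| < e.

Definition C1_halfline (f f' : R -> R) : Prop :=
  {within halfline, continuous f'} /\
  forall t : R, 0 <= t ->
    (s - t)^-1 * (f s - f t) @[s --> within halfline t^'] --> f' t.

Definition C0_H10 Omega u Du : Prop :=
  forall t : R, 0 <= t -> H10 Omega (u t) (Du t) /\
    H1norm Omega (u s \- u t) (fun x => Du s x - Du t x)
      @[s --> within halfline (nbhs t)] --> 0%E.

Definition C1_L2 Omega u ut : Prop :=
  forall t : R, 0 <= t ->
  [/\ L2 Omega (u t), L2 Omega (ut t),
      L2norm Omega (ut s \- ut t) @[s --> within halfline (nbhs t)] --> 0%E &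
      L2norm Omega (fun x => (s - t)^-1 * (u s x - u t x) - ut t x)
        @[s --> within halfline t^'] --> 0%E].

(* Du t represents the weak gradient of u t for every t >= 0. Every element of
   C([0, oo); L^2) has representatives that are measurable in (t, x); asking it
   of Du makes the integrals over s below meaningful pointwise in x. *)
Definition weak_solution Omega k u ut Du : Prop :=
  [/\ C0_H10 Omega u Du, C1_L2 Omega u ut,
      forall i, measurable_fun (halfline `*` Omega)
        (fun p : measurableTypeR R * 'rV[R]_N => Du p.1 p.2 0 i) &
      forall v Dv, H10 Omega v Dv ->
        exists2 F' : R -> R,
          C1_halfline (fun t => \int[mu]_(x in Omega) (ut t x * v x)) F' &
          forall t, 0 <= t ->
            F' t + \int[mu]_(x in Omega) dotv (Du t x) (Dv x)
            - \int[mu]_(x in Omega) dotv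
                (\row_i \int[leb]_(s in `[0, t]) (k (t - s) * Du s x 0 i))
                (Dv x) = 0].

Definition energy Omega k ut Du (t : R) : \bar R :=
  ((2^-1)%:E * (\int[mu]_(x in Omega) (ut t x ^+ 2)%:E)
  + (2^-1 * (1 - \int[leb]_(s in `[0, t]) k s)%R)%:E
    * (\int[mu]_(x in Omega) (dotv (Du t x) (Du t x))%:E)
  + (2^-1)%:E * (\int[mu]_(x in Omega) \int[leb]_(s in `[0%R, t])
      (k (t - s)%R * dotv (Du s x - Du t x)%R (Du s x - Du t x)%R)%:E))%E.

End evolution.

(* Main.v *)
(* Write rho t = max(t, 0), G(t,s) = <grad u(t), grad u(s)>, Q(t,s) = <u_t(t), u_t(s)> and
   P(t,s) = <u_t(t), u(s)>. A weak solution lacks the regularity to be tested against u_t, but it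
   can be tested against u(s) for a fixed s. This gives
     dP/ds = Q,   dP/dt = int_0^t k(t-r) G(r,s) dr - G(t,s),
   and everything afterwards concerns these three scalar kernels.

   Dissipation. The derivative of P(t,t+h) - P(t+h,t) is a difference of memory terms, which the
   polarisation identity rewrites with N(r,t) = |grad u(r) - grad u(t)|^2. Since
   k(t+h) <= e^(-eta h) k(t), dividing by h and letting h -> 0 gives E(T) + eta int_S^T E_pot <= E(S), where E_pot is E without
   its kinetic part.

   Equipartition. For Y(t) = int_0^t1 (t1-tau) (P(t,t) - P(t,t-tau)) dtau, with t1 such that
   k >= k(0)/2 on [0,t1], one has Y' >= (t1^2/4) |u_t|^2 - C E_pot, and |Y| <= C E by the Poincare
   inequality. Together with the dissipation this gives T E(s+T) <= C E(s) for s > t1, and the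
   monotonicity of E turns this averaged bound into exponential decay. *)
Require Import Defs.
From HB Require Import structures.
From mathcomp Require Import all_boot all_order all_algebra.
From mathcomp Require Import all_classical all_reals all_analysis.
From mathcomp Require Import measurable_realfun ring lra.

Set Implicit Arguments.
Unset Strict Implicit.
Unset Printing Implicit Defensive.
Import Order.TTheory GRing.Theory Num.Theory.
Import numFieldNormedType.Exports.
Local Open Scope classical_set_scope.
Local Open Scope ring_scope.

(** * Integrals over intervals depending on a parameter *)

Set Implicit Arguments.
Unset Strict Implicit.
Unset Printing Implicit Defensive.

Section real_integrals.
Context {R : realType}.
Local Notation leb := (@lebesgue_measure R).
Implicit Types (f F : R -> R) (a b c e t : R).

(** The coefficient 1 - int_0^t k of |grad u|^2 in E tends to 0, since k has mass 1. Hence E does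
    not bound |grad u(t)|^2 uniformly in t, and <u_t, u> cannot be compared with E by the Poincare
    inequality. What the memory part does control is u(t) - u(t - tau) for lags tau at which k is
    bounded below; this is why Y is made of differences and why the lags stop at t1. The weight t1 -
    tau vanishes at tau = t1 and the difference vanishes at tau = 0, so the products Q(t, t - tau),
    which E_pot does not control, are integrated by parts in tau without boundary terms. The
    dissipation of the gradient part of E_pot comes from k(t) itself: integrating the decay of k
    over [t, oo) gives eta (1 - int_0^t k) <= k(t). E is not known to be differentiable, so no
    derivative of E is taken. A function of t depending on h is shown to decrease at a controlled
    rate on [S, T], and only its quotients by h at the two ends pass to the limit, which is 4 E. The
    antiderivative of [w] is added to reach exactly this limit. *)

Lemma continuous_integrable_itv f a b : continuous f ->
  leb.-integrable `[a, b] (EFin \o f).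
Proof.
move=> cf; apply: continuous_compact_integrable; first exact: segment_compact.
by apply: continuous_subspaceT.
Qed.

(** The derivative is two-sided only to the right of the base point. Callers therefore place [a]
    strictly to the left of their interval, or keep to positive times with [a] equal to 0. *)
Lemma continuous_antiderivative f a : continuous f ->
  exists F, forall x, a < x -> is_derive x (1 : R) F (f x).
Proof.
move=> cf; exists (fun x => \int[leb]_(t in `[a, x]) f t) => x ax.
have xx1 : x < x + 1 by rewrite ltrDl.
have [dF F'] := continuous_FTC1_closed xx1 (continuous_integrable_itv _ _ cf) ax (cf x).
apply: DeriveDef; first exact: dF.
by rewrite -derive1E F'.
Qed.

Lemma Rintegral_derive f F a b : a <= b -> continuous f ->
  (forall x, a <= x <= b -> is_derive x (1 : R) F (f x)) ->
  \int[leb]_(x in `[a, b]) f x = F b - F a.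
Proof.
rewrite le_eqVlt => /predU1P[<- _ _|ab cf dF].
  by rewrite set_itv1 Rintegral_set1 subrr.
rewrite /Rintegral (continuous_FTC2 ab (F := F)) //.
- exact: continuous_subspaceT.
- have cF x : a <= x <= b -> {for x, continuous F}.
    move=> /dF dFx; apply/differentiable_continuous/derivable1_diffP.
    exact: ex_derive.
  split.
  + by move=> x /[!in_itv]/= /andP[/ltW ? /ltW ?]; have [] := dF x; rewrite ?H //; exact/andP.
  + by apply: cvg_at_right_filter; apply: cF; rewrite lexx ltW.
  + by apply: cvg_at_left_filter; apply: cF; rewrite lexx ltW.
- move=> x /[!in_itv]/= /andP[/ltW ? /ltW ?].
  by rewrite derive1E; apply: derive_val; apply: dF; exact/andP.
Qed.

Lemma derive_le0_nincr f F a b : a <= b ->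
  (forall x, a <= x <= b -> is_derive x (1 : R) F (f x)) ->
  (forall x, a <= x <= b -> f x <= 0) -> F b <= F a.
Proof.
rewrite le_eqVlt => /predU1P[-> //|ab] dF f0.
have [||c cab E] := @MVT _ F f a b ab.
- by move=> x /[!in_itv]/= /andP[/ltW ? /ltW ?]; apply: dF; exact/andP.
- apply: derivable_within_continuous => x /[!in_itv]/= xab.
  by apply: ex_derive; exact: dF.
move: cab; rewrite in_itv/= => /andP[/ltW ? /ltW ?].
rewrite -subr_le0 E mulr_le0_ge0 ?subr_ge0 ?(ltW ab) //; apply: f0; exact/andP.
Qed.

Lemma Rintegral_flip f a : 0 <= a -> continuous f ->
  \int[leb]_(r in `[0, a]) f (a - r) = \int[leb]_(r in `[0, a]) f r.
Proof.
move=> a0 cf.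
have [F dF] := continuous_antiderivative (-1) cf.
have dF1 x : 0 <= x <= a -> is_derive x (1 : R) F (f x).
  by move=> /andP[x0 _]; apply: dF; rewrite (lt_le_trans _ x0)// ltrN10.
have cf2 : continuous (fun r => f (a - r)).
  move=> x; apply: continuous_comp; last exact: cf.
  by apply: cvgB; [exact: cvg_cst|exact: cvg_id].
rewrite (Rintegral_derive a0 cf dF1).
have dF2 x : 0 <= x <= a -> is_derive x (1 : R) (fun r => - F (a - r)) (f (a - x)); last first.
  by rewrite (Rintegral_derive a0 cf2 dF2) subr0 subrr; ring.
- move=> /andP[x0 xa].
  have dFx : is_derive (a - x) (1 : R) F (f (a - x)).
    by apply: dF; rewrite (lt_le_trans (ltrN10 R))// subr_ge0.
  have dar : is_derive x (1 : R) (fun r => a - r) (-1).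
    by apply: is_derive_eq (is_deriveB (is_derive_cst a x 1) (is_derive_id x 1)) _; rewrite sub0r.
  have := is_deriveN (@is_derive1_comp _ F (fun r => a - r) x _ _ dFx dar).
  by rewrite mulrN mulr1 opprK.
Qed.

(** Tube lemma: joint continuity gives a neighbourhood of x0 for each r, and compactness of [a, b]
    makes one neighbourhood serve all r. *)
Lemma param_unif (X : topologicalType) (phi : X -> R -> R) a b :
  continuous (fun p : X * R => phi p.1 p.2) ->
  forall x0 (e : R), 0 < e ->
  \forall x \near x0, forall r, a <= r <= b -> `|phi x0 r - phi x r| < e.
Proof.
move=> cphi x0 e e0.
have /compact_near_coveringP cp : compact `[a, b] by exact: segment_compact.
have := @cp _ (nbhs x0) (fun x r => `|phi x0 r - phi x r| < e) _.
move=> H; near=> x => r rab; move: r rab; near: x.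
have : \forall x \near x0, `[a, b] `<=` (fun r => `|phi x0 r - phi x r| < e).
  apply: H => r _.
  have e2 : 0 < e / 2 by rewrite divr_gt0.
  have /cvgrPdist_lt/(_ _ e2) c1 := cphi (x0, r).
  have c2 : \forall s \near r, `|phi x0 r - phi x0 s| < e / 2.
    have : (phi x0 s) @[s --> r] --> phi x0 r.
      by apply: (continuous2_cvg _ (cphi (x0, r))); [exact: cvg_cst|exact: cvg_id].
    by move/cvgrPdist_lt/(_ _ e2).
  case: c1 => -[/= U V] [xU rV] UV.
  near=> s x => /=.
  rewrite (splitr e) (le_lt_trans (ler_distD (phi x0 r) _ _))//.
  rewrite ltrD//; first by rewrite distrC; near: s.
  by apply: (UV (x, s)); split=> /=; [near: x|near: s].
apply: filterS => x Hx r rab; apply: Hx; rewrite /= in_itv/=; exact: rab.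
Unshelve. all: by end_near. Qed.

Lemma continuous_fst_fix (X : topologicalType) (phi : X -> R -> R) x :
  continuous (fun p : X * R => phi p.1 p.2) -> continuous (phi x).
Proof.
move=> cphi r.
by apply: (continuous2_cvg _ (cphi (x, r))); [exact: cvg_cst|exact: cvg_id].
Qed.

Lemma le_norm_Rintegral_itv f a b c : a <= b -> continuous f ->
  (forall r, a <= r <= b -> `|f r| <= c) ->
  `|\int[leb]_(r in `[a, b]) f r| <= c * (b - a).
Proof.
move=> ab cf fc.
apply: (le_trans (le_normr_Rintegral _ _)) => //.
  exact: continuous_integrable_itv.
have -> : c * (b - a) = \int[leb]_(r in `[a, b]) c.
  rewrite Rintegral_cst //= lebesgue_measure_itv/= lte_fin.
  by move: ab; rewrite le_eqVlt => /predU1P[->|->//]; rewrite ltxx subrr.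
apply: le_Rintegral => //.
- apply: (@continuous_integrable_itv (fun r => `|f r|)) => r.
  by apply: cvg_norm; exact: cf.
- by apply: (@continuous_integrable_itv (fun=> c)) => r; exact: cvg_cst.
Qed.

Lemma param_continuous (X : topologicalType) (phi : X -> R -> R) a b :
  continuous (fun p : X * R => phi p.1 p.2) ->
  continuous (fun x => \int[leb]_(r in `[a, b]) phi x r).
Proof.
move=> cphi x0.
have [ba|ab] := ltP b a.
  have -> : (fun x => \int[leb]_(r in `[a, b]) phi x r) = cst 0; last exact: cvg_cst.
  by apply/funext => x; rewrite set_itv_ge ?Rintegral_set0// -leNgt bnd_simp.
apply/cvgrPdist_le => e e0.
have d0 : 0 < e / (b - a + 1) by rewrite divr_gt0// ltr_wpDl// subr_ge0.
have := param_unif a b cphi x0 d0.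
apply: filterS => x Hx.
have c0 := continuous_fst_fix (x := x0) cphi; have cx := continuous_fst_fix (x := x) cphi.
rewrite -RintegralB//; [|exact: continuous_integrable_itv..].
apply: (le_trans (@le_norm_Rintegral_itv _ _ _ (e / (b - a + 1)) ab _ _)).
- by move=> r; apply: cvgB; [exact: c0|exact: cx].
- by move=> r rab; exact/ltW/Hx.
- rewrite -mulrA ler_piMr ?(ltW e0)// mulrC ler_pdivrMr ?mul1r ?lerDl//.
  by rewrite ltr_wpDl// subr_ge0.
Qed.

(** For each r the mean value theorem turns the difference quotient into [dphi] at an intermediate
    point depending on r; [param_unif] makes the error uniform in r. *)
Lemma param_derive (phi dphi : R -> R -> R) a b t0 : a <= b ->
  continuous (fun p : R * R => dphi p.1 p.2) ->
  (forall x, continuous (phi x)) ->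
  (\forall x \near t0, forall r, a <= r <= b ->
    is_derive x (1 : R) (phi^~ r) (dphi x r)) ->
  is_derive t0 (1 : R) (fun x => \int[leb]_(r in `[a, b]) phi x r)
    (\int[leb]_(r in `[a, b]) dphi t0 r).
Proof.
move=> ab cd cphi dphiP.
suff H : h^-1 * (\int[leb]_(r in `[a, b]) phi (h + t0) r - \int[leb]_(r in `[a, b]) phi t0 r)
   @[h --> 0^'] --> \int[leb]_(r in `[a, b]) dphi t0 r.
  apply: DeriveDef.
    apply/cvg_ex; exists (\int[leb]_(r in `[a, b]) dphi t0 r).
    by under eq_fun do rewrite [_ *: 1]mulr1.
  rewrite -derive1E derive1E.
  by apply: cvg_lim => //; under eq_fun do rewrite [_ *: 1]mulr1.
have cdt := continuous_fst_fix (x := t0) cd.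
apply/cvgrPdist_le => e e0.
have d0 : 0 < e / (b - a + 1) by rewrite divr_gt0// ltr_wpDl// subr_ge0.
have nU := param_unif a b cd t0 d0.
have [d /= dgt0 Hd] := (nbhs_ballP _ _).1 (filterI dphiP nU).
have : \forall h \near (0 : R)^', `|h| < d /\ h != 0.
  near=> h; split; last by near: h; exact: nbhs_dnbhs_neq.
  near: h; apply: dnbhs0_lt; exact: dgt0.
apply: filterS => h [hd h0].
rewrite -RintegralB//; [|exact: continuous_integrable_itv..].
rewrite -RintegralZl//; last first.
  apply: (@continuous_integrable_itv (fun r => phi (h + t0) r - phi t0 r)) => r.
  by apply: cvgB; exact: cphi.
have cq : continuous (fun r => h^-1 * (phi (h + t0) r - phi t0 r)).
  by move=> r; apply: cvgM; [exact: cvg_cst|apply: cvgB; exact: cphi].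
rewrite -RintegralB//; [|exact: continuous_integrable_itv..].
apply: (le_trans (@le_norm_Rintegral_itv _ _ _ (e / (b - a + 1)) ab _ _)).
- by move=> r; apply: cvgB; [exact: cdt|exact: cq].
- move=> r rab.
  have inb x : Num.min t0 (h + t0) <= x <= Num.max t0 (h + t0) -> ball t0 d x.
    rewrite /ball/= => /andP[]; rewrite ge_min le_max => l u.
    by move: hd l u; rewrite !ltr_norml => /andP[? ?] /orP[] ? /orP[] ?; apply/andP; split; lra.
  have [c cin ->] : exists2 c, ball t0 d c &
      h^-1 * (phi (h + t0) r - phi t0 r) = dphi c r.
    have dd x : ball t0 d x -> is_derive x (1 : R) (phi^~ r) (dphi x r).
      by move=> /Hd[+ _]; exact.
    have cc u v : (forall x, u <= x <= v -> ball t0 d x) ->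
        {within `[u, v], continuous (phi^~ r)}.
      move=> uv; apply: derivable_within_continuous => x; rewrite in_itv/= => xuv.
      by apply: ex_derive; apply: dd; exact: uv.
    have [hlt|hgt|h00] := ltgtP h 0; last by rewrite h00 eqxx in h0.
    + have sub x : h + t0 <= x <= t0 -> ball t0 d x.
        move=> /andP[? ?]; apply: inb; rewrite ge_min le_max; apply/andP; split.
          by apply/orP; right.
        by apply/orP; left.
      have [|||c cab E] := @MVT _ (phi^~ r) (dphi^~ r) (h + t0) t0.
      * by rewrite gtrDr.
      * move=> x; rewrite in_itv/= => /andP[/ltW ? /ltW ?]; apply: dd; apply: sub; exact/andP.
      * exact: cc.
      exists c; first by apply: sub; move: cab; rewrite in_itv/= => /andP[/ltW-> /ltW->].
      by rewrite -opprB E; field.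
    + have sub x : t0 <= x <= h + t0 -> ball t0 d x.
        move=> /andP[? ?]; apply: inb; rewrite ge_min le_max; apply/andP; split.
          by apply/orP; left.
        by apply/orP; right.
      have [|||c cab E] := @MVT _ (phi^~ r) (dphi^~ r) t0 (h + t0).
      * by rewrite ltrDr.
      * move=> x; rewrite in_itv/= => /andP[/ltW ? /ltW ?]; apply: dd; apply: sub; exact/andP.
      * exact: cc.
      exists c; first by apply: sub; move: cab; rewrite in_itv/= => /andP[/ltW-> /ltW->].
      by rewrite E; field.
  by apply/ltW; have [_] := Hd c cin; apply.
- rewrite -mulrA ler_piMr ?(ltW e0)// mulrC ler_pdivrMr ?mul1r ?lerDl//.
  by rewrite ltr_wpDl// subr_ge0.
Unshelve. all: by end_near. Qed.

Lemma Rintegral_split f a b c : a <= b -> b <= c -> continuous f ->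
  \int[leb]_(r in `[a, c]) f r =
  \int[leb]_(r in `[a, b]) f r + \int[leb]_(r in `[b, c]) f r.
Proof.
move=> ab bc cf.
have [F dF] := continuous_antiderivative (a - 1) cf.
have d u v x : a <= u -> u <= x <= v -> is_derive x (1 : R) F (f x).
  by move=> au /andP[ux _]; apply: dF; rewrite ltrBlDr (le_lt_trans (le_trans au ux))// ltrDl.
rewrite (Rintegral_derive (le_trans ab bc) cf (fun x => d a c x (lexx a))).
rewrite (Rintegral_derive ab cf (fun x => d a b x (lexx a))).
rewrite (Rintegral_derive bc cf (fun x => d b c x ab)).
ring.
Qed.

(** The moving endpoint is removed by freezing the integrand beyond it: over a fixed interval
    [0, M], [psi] integrates to the wanted value plus a rectangle of width M - T x, and both are
    continuous in x. The general parameter space covers kernels of one and of two times. *)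
Lemma volterra_continuous (X : topologicalType) (phi : X -> R -> R) (T : X -> R) :
  continuous (fun p : X * R => phi p.1 p.2) ->
  continuous T -> (forall x, 0 <= T x) ->
  continuous (fun x => \int[leb]_(r in `[0, T x]) phi x r).
Proof.
move=> cphi cT T0 x0.
pose M := T x0 + 1.
have /cvgrPdist_lt/(_ 1 ltr01) T1 := cT x0.
pose psi x r := phi x (Num.min r (T x)).
have cpsi : continuous (fun p : X * R => psi p.1 p.2).
  move=> [x r].
  apply: (continuous2_cvg _ (cphi (x, Num.min r (T x)))); first exact: cvg_fst.
  apply: (continuous2_cvg _ (@min_continuous _ R (r, T x))); first exact: cvg_snd.
  by apply: cvg_comp; [exact: cvg_fst|exact: cT].
have E : \forall x \near x0, \int[leb]_(r in `[0, M]) psi x r - (M - T x) * phi x (T x)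
    = \int[leb]_(r in `[0, T x]) phi x r.
  near=> x.
  have TM : T x <= M.
    have : `|T x0 - T x| < 1 by near: x; exact: T1.
    by rewrite /M ltr_norml => /andP[? ?]; lra.
  have cx := continuous_fst_fix (x := x) cpsi.
  rewrite (@Rintegral_split _ 0 (T x))//.
  have -> : \int[leb]_(r in `[0, T x]) psi x r = \int[leb]_(r in `[0, T x]) phi x r.
    apply: eq_Rintegral => r; rewrite inE/= in_itv/= => /andP[_ rT].
    by rewrite /psi min_l.
  have -> : \int[leb]_(r in `[T x, M]) psi x r = \int[leb]_(r in `[T x, M]) phi x (T x).
    apply: eq_Rintegral => r; rewrite inE/= in_itv/= => /andP[rT _].
    by rewrite /psi min_r.
  rewrite Rintegral_cst//= lebesgue_measure_itv/= lte_fin.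
  by move: TM; rewrite le_eqVlt => /predU1P[->|->/=]; rewrite ?ltxx/=; ring.
rewrite /continuous_at -(nbhs_singleton E); apply: (cvg_trans (near_eq_cvg E)).
apply: cvgB; first exact: param_continuous.
apply: cvgM; first by apply: cvgB; [exact: cvg_cst|exact: cT].
by apply: (continuous2_cvg _ (cphi (x0, T x0))); [exact: cvg_id|exact: cT].
Unshelve. all: by end_near. Qed.

End real_integrals.

(** * Decay of the energy for scalar kernels *)

Section derivative_tools.
Context {R : realType}.
Implicit Types (f g df : R -> R) (a b x d : R).

Lemma is_derive_quotient f x d :
  (h^-1 * (f (h + x) - f x)) @[h --> 0^'] --> d -> is_derive x (1 : R) f d.
Proof.
move=> H; apply: DeriveDef.
  apply/cvg_ex; exists d.
  by under eq_fun do rewrite [_ *: 1]mulr1.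
by apply: cvg_lim => //; under eq_fun do rewrite [_ *: 1]mulr1.
Qed.

Lemma is_derive_quotientP f x d : is_derive x (1 : R) f d ->
  (h^-1 * (f (h + x) - f x)) @[h --> 0^'] --> d.
Proof.
case=> /cvg_ex[l H] E.
have -> : d = l by rewrite -E; exact: cvg_lim.
by move: H; under eq_fun do rewrite [_ *: 1]mulr1.
Qed.

Lemma MVT_ball f df x d h : (forall y, `|y - x| < d -> is_derive y (1 : R) f (df y)) ->
  `|h| < d -> exists2 c, `|c - x| <= `|h| & f (h + x) - f x = df c * h.
Proof.
move=> dd hd.
have cc u v : (forall y, u <= y <= v -> `|y - x| < d) ->
    {within `[u, v], continuous f}.
  move=> uv; apply: derivable_within_continuous => y; rewrite in_itv/= => yuv.
  by apply: ex_derive; apply: dd; exact: uv.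
have [hlt|hgt|->] := ltgtP h 0.
- have hx y : h + x <= y <= x -> `|y - x| <= `|h|.
    by rewrite (ltr0_norm hlt) => ?; rewrite ler_norml; apply/andP; split; lra.
  have hxd y : h + x <= y <= x -> `|y - x| < d by move=> /hx/le_lt_trans; apply.
  have [|||c cab E] := @MVT _ f df (h + x) x.
  + by rewrite gtrDr.
  + move=> y; rewrite in_itv/= => /andP[/ltW ? /ltW ?]; apply: dd; apply: hxd; exact/andP.
  + exact: cc.
  exists c; first by apply: hx; move: cab; rewrite in_itv/= => /andP[/ltW-> /ltW->].
  by rewrite -opprB E; ring.
- have hx y : x <= y <= h + x -> `|y - x| <= `|h|.
    by rewrite (gtr0_norm hgt) => ?; rewrite ler_norml; apply/andP; split; lra.
  have hxd y : x <= y <= h + x -> `|y - x| < d by move=> /hx/le_lt_trans; apply.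
  have [|||c cab E] := @MVT _ f df x (h + x).
  + by rewrite ltrDr.
  + move=> y; rewrite in_itv/= => /andP[/ltW ? /ltW ?]; apply: dd; apply: hxd; exact/andP.
  + exact: cc.
  exists c; first by apply: hx; move: cab; rewrite in_itv/= => /andP[/ltW-> /ltW->].
  by rewrite E; ring.
- by exists x; [rewrite subrr !normr0|rewrite add0r subrr mulr0].
Qed.

(** The increment is split at the point (h + t + a, t + b). The first partial derivative is then
    used at a single point only; the second is used nearby, through the mean value theorem and the
    joint continuity of Q. *)
Lemma is_derive_diag (P Q : R -> R -> R) (d1 t a b : R) :
  0 < t + a -> 0 < t + b ->
  (forall x y : R, 0 < x -> 0 < y -> is_derive y (1 : R) (P x) (Q x y)) ->
  continuous (fun p : R * R => Q p.1 p.2) ->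
  is_derive (t + a) (1 : R) (P^~ (t + b)) d1 ->
  is_derive t (1 : R) (fun t => P (t + a) (t + b)) (d1 + Q (t + a) (t + b)).
Proof.
move=> ta tb dQ cQ /is_derive_quotientP d1P; apply: is_derive_quotient.
have -> : (fun h => h^-1 * (P (h + t + a) (h + t + b) - P (t + a) (t + b))) =
   (fun h => h^-1 * (P (h + (t + a)) (t + b) - P (t + a) (t + b)) +
             h^-1 * (P (h + (t + a)) (h + (t + b)) - P (h + (t + a)) (t + b))).
  by apply/funext => h; rewrite !addrA; ring.
apply: cvgD; first exact: d1P.
apply/cvgrPdist_lt => e e0.
have /cvgrPdist_lt/(_ _ e0)/nbhs_ballP[r /= r0 Hr] := cQ (t + a, t + b).
have : \forall h \near (0 : R)^', [/\ h != 0, `|h| < t + a, `|h| < t + b & `|h| < r].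
  near=> h; split.
  - by near: h; exact: nbhs_dnbhs_neq.
  - by near: h; exact: dnbhs0_lt.
  - by near: h; exact: dnbhs0_lt.
  - by near: h; exact: dnbhs0_lt.
apply: filterS => h [h0 hta htb hr].
have [||c cb ->] := @MVT_ball (P (h + (t + a))) (Q (h + (t + a))) (t + b) (t + b) h.
- move=> y yb; apply: dQ; first by move: hta; rewrite ltr_norml; lra.
  by move: yb; rewrite ltr_norml; lra.
- by [].
rewrite mulrCA mulVf// mulr1.
apply: (Hr (h + (t + a), c)); split; rewrite /ball/=.
  by rewrite opprD addrCA subrr addr0 normrN.
by rewrite distrC (le_lt_trans cb).
Unshelve. all: by end_near. Qed.

Lemma is_derive_shift f x a d : is_derive (x + a) (1 : R) f d ->
  is_derive x (1 : R) (fun x => f (x + a)) d.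
Proof.
move=> /is_derive_quotientP H; apply: is_derive_quotient.
by under eq_fun do rewrite -addrA.
Qed.

Lemma is_derive_lin f g x a b d1 d2 : is_derive x (1 : R) f d1 -> is_derive x (1 : R) g d2 ->
  is_derive x (1 : R) (fun x => a * f x + b * g x) (a * d1 + b * d2).
Proof.
move=> /is_derive_quotientP F /is_derive_quotientP H; apply: is_derive_quotient.
rewrite (_ : (fun _ => _) = (fun h => a * (h^-1 * (f (h + x) - f x)) +
  b * (h^-1 * (g (h + x) - g x)))); last by apply/funext => h; ring.
by apply: cvgD; apply: cvgM; [exact: cvg_cst|exact: F|exact: cvg_cst|exact: H].
Qed.

Lemma is_derive_flip f x a d : is_derive (a - x) (1 : R) f d ->
  is_derive x (1 : R) (fun x => f (a - x)) (- d).
Proof.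
move=> df.
have dar : is_derive x (1 : R) (fun r => a - r) (-1).
  by apply: is_derive_eq (is_deriveB (is_derive_cst a x 1) (is_derive_id x 1)) _; rewrite sub0r.
have := @is_derive1_comp _ f (fun r => a - r) x _ _ df dar.
by rewrite mulrN1.
Qed.

Lemma is_derive_mul f g x a b : is_derive x (1 : R) f a -> is_derive x (1 : R) g b ->
  is_derive x (1 : R) (fun x => f x * g x) (f x * b + g x * a).
Proof. by move=> df dg; have := is_deriveM df dg. Qed.

End derivative_tools.

(** * The memory functional of abstract kernels G, Q, P: continuity, positivity, polarisation *)

Section memory_kernel.
Context {R : realType}.
Local Notation leb := (@lebesgue_measure R).
Variables (k : R -> R) (eta : R) (G Q P : R -> R -> R).
Implicit Types t s h r sigma : R.

(** Precomposition with [rho] extends data on [0, oo) continuously to the whole line, so that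
    continuity need not be stated relative to the half-line. *)
Definition rho (t : R) : R := Num.max t 0.

Lemma rho_ge0 t : 0 <= rho t.
Proof. by rewrite le_max lexx orbT. Qed.

Lemma rho_id t : 0 <= t -> rho t = t.
Proof. by move=> t0; apply/max_l. Qed.

Lemma rho_continuous : continuous rho.
Proof.
move=> t; apply: (continuous2_cvg _ (@max_continuous _ R (t, 0))).
  exact: cvg_id.
exact: cvg_cst.
Qed.

(** This is N of the overview, the squared distance attached to the Gram kernel G. For an abstract G
    its positivity is the separate hypothesis [dist2_ge0]. *)
Definition dist2 t s := G t t - 2 * G t s + G s s.
Definition kmass t := \int[leb]_(r in `[0, rho t]) k r.
Definition kconv (f : R -> R) t := \int[leb]_(r in `[0, rho t]) (k (t - r) * f r).
Definition pot t := 2^-1 * ((1 - kmass t) * G t t + kconv (dist2^~ t) t).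
Definition menergy t := 2^-1 * Q t t + pot t.

Hypothesis k_cont : continuous k.
Hypothesis k_ge0 : forall t, 0 <= k t.
Hypothesis eta_gt0 : 0 < eta.
Hypothesis k_decay : forall t h, 0 <= t -> 0 <= h -> k (t + h) <= expR (- (eta * h)) * k t.
Hypothesis kmass_le : forall t, 0 <= t -> kmass t <= 1.
Hypothesis k_tail : forall t, 0 <= t -> eta * (1 - kmass t) <= k t.
Hypothesis G_cont : continuous (fun p : R * R => G p.1 p.2).
Hypothesis Q_cont : continuous (fun p : R * R => Q p.1 p.2).
Hypothesis G_sym : forall t s, G t s = G s t.
Hypothesis Q_sym : forall t s, Q t s = Q s t.
Hypothesis Q_ge0 : forall t, 0 <= Q t t.
Hypothesis G_ge0 : forall t, 0 <= G t t.
Hypothesis dist2_ge0 : forall t s, 0 <= dist2 t s.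
Hypothesis dP1 : forall t s, 0 < t -> 0 < s ->
  is_derive t (1 : R) (P^~ s) (kconv (G^~ s) t - G t s).
Hypothesis dP2 : forall t s, 0 < t -> 0 < s -> is_derive s (1 : R) (P t) (Q t s).

Lemma comp2_continuous (X : topologicalType) (f : R -> R -> R) (a b : X -> R) :
  continuous (fun p : R * R => f p.1 p.2) -> continuous a -> continuous b ->
  continuous (fun x => f (a x) (b x)).
Proof. by move=> cf ca cb x; apply: (continuous2_cvg _ (cf (a x, b x))); [exact: ca|exact: cb]. Qed.

Lemma dist2_continuous : continuous (fun p : R * R => dist2 p.1 p.2).
Proof.
have c1 : continuous (fun p : R * R => p.1) by move=> p; exact: cvg_fst.
have c2 : continuous (fun p : R * R => p.2) by move=> p; exact: cvg_snd.
move=> p; apply: cvgD; last exact: (comp2_continuous G_cont c2 c2).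
apply: cvgB; first exact: (comp2_continuous G_cont c1 c1).
apply: cvgM; first exact: cvg_cst.
exact: G_cont.
Qed.

Lemma kconv_continuous2 (f : R -> R -> R) : continuous (fun p : R * R => f p.1 p.2) ->
  continuous (fun p : R * R => kconv (f^~ p.2) p.1).
Proof.
move=> cf.
apply: (@volterra_continuous R (R * R)%type (fun p r => k (p.1 - r) * f r p.2)
  (fun p => rho p.1)).
- have c1 : continuous (fun p : R * R * R => p.2) by move=> p; exact: cvg_snd.
  have c2 : continuous (fun p : R * R * R => p.1.2).
    by move=> p; apply: (cvg_comp fst snd); [exact: cvg_fst|exact: cvg_snd].
  move=> p; apply: cvgM; last exact: (comp2_continuous cf c1 c2).
  apply: (cvg_comp (fun p : R * R * R => p.1.1 - p.2) k); last exact: k_cont.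
  apply: cvgB; last exact: c1.
  by apply: (cvg_comp fst fst); [exact: cvg_fst|exact: cvg_fst].
- by move=> p; apply: (cvg_comp fst rho); [exact: cvg_fst|exact: rho_continuous].
- by move=> p; exact: rho_ge0.
Qed.

Lemma id_continuous : continuous (fun x : R => x).
Proof. by move=> x; exact: cvg_id. Qed.

Lemma diag_continuous (f : R -> R -> R) : continuous (fun p : R * R => f p.1 p.2) ->
  continuous (fun t => f t t).
Proof. by move=> cf; exact: (comp2_continuous cf id_continuous id_continuous). Qed.

Lemma kconv_continuous (f : R -> R) : continuous f -> continuous (kconv f).
Proof.
move=> cf.
have H : continuous (fun p : R * R => (fun r _ : R => f r) p.1 p.2).
  by move=> p; apply: (cvg_comp fst f); [exact: cvg_fst|exact: cf].
exact: (diag_continuous (f := fun t s => kconv ((fun r _ : R => f r)^~ s) t) (kconv_continuous2 H)).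
Qed.

Lemma kmass_continuous : continuous kmass.
Proof.
apply: (@volterra_continuous R R (fun _ r => k r) rho).
- by move=> p; apply: (cvg_comp snd k); [exact: cvg_snd|exact: k_cont].
- exact: rho_continuous.
- exact: rho_ge0.
Qed.

Lemma nu_continuous : continuous (fun t => kconv (dist2^~ t) t).
Proof.
exact: (diag_continuous (f := fun t s => kconv (dist2^~ s) t) (kconv_continuous2 dist2_continuous)).
Qed.

Lemma pot_continuous : continuous pot.
Proof.
move=> t; apply: cvgM; first exact: cvg_cst.
apply: cvgD; last exact: nu_continuous.
apply: cvgM; last exact: (diag_continuous G_cont).
by apply: cvgB; [exact: cvg_cst|exact: kmass_continuous].
Qed.

Lemma menergy_continuous : continuous menergy.
Proof.
move=> t; apply: cvgD; last exact: pot_continuous.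
by apply: cvgM; [exact: cvg_cst|exact: (diag_continuous Q_cont)].
Qed.

Lemma kconv_ge0 (f : R -> R) t : (forall r, 0 <= f r) -> 0 <= kconv f t.
Proof. by move=> f0; apply: Rintegral_ge0 => r _; rewrite mulr_ge0. Qed.

Lemma pot_ge0 t : 0 <= t -> 0 <= pot t.
Proof.
move=> t0; rewrite /pot mulr_ge0 ?invr_ge0// addr_ge0 ?kconv_ge0//.
by rewrite mulr_ge0// subr_ge0 kmass_le.
Qed.

Lemma kshift_continuous (f : R -> R) t : continuous f -> continuous (fun r => k (t - r) * f r).
Proof.
move=> cf r; apply: cvgM; last exact: cf.
apply: (cvg_comp (fun r => t - r) k); last exact: k_cont.
by apply: cvgB; [exact: cvg_cst|exact: cvg_id].
Qed.

Lemma fixr_continuous (f : R -> R -> R) s :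
  continuous (fun p : R * R => f p.1 p.2) -> continuous (f^~ s).
Proof.
move=> cf; apply: (comp2_continuous cf id_continuous).
by move=> x; exact: cvg_cst.
Qed.

(** The identity 2 G(r,s) = G(r,r) + G(s,s) - dist2(r,s) is integrated against k(t - r);
    [Rintegral_flip] identifies the mass of r -> k(t - r) with [kmass t]. *)
Lemma kconv_polar t s : 0 <= t ->
  2 * kconv (G^~ s) t =
  kconv (fun r => G r r) t + kmass t * G s s - kconv (dist2^~ s) t.
Proof.
move=> t0; rewrite /kmass -(Rintegral_flip (rho_ge0 t) k_cont) /kconv.
have cs := kshift_continuous.
have cG := fixr_continuous (s := s) G_cont.
have cD := fixr_continuous (s := s) dist2_continuous.
have E u (f : R -> R) := @continuous_integrable_itv R f 0 u.
have ck : continuous (fun r => k (rho t - r)).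
  move=> r; apply: (cvg_comp (fun r => rho t - r) k); last exact: k_cont.
  by apply: cvgB; [exact: cvg_cst|exact: cvg_id].
rewrite -RintegralZl//; last by apply/E/cs.
rewrite -RintegralZr//; last exact/E.
rewrite -RintegralD//; last 2 first.
- by apply/E/cs; exact: (diag_continuous G_cont).
- by apply: (E _ (fun r => k (rho t - r) * G s s)) => r; apply: cvgM; [exact: ck|exact: cvg_cst].
rewrite -RintegralB//; last 2 first.
- apply: (E _ (fun r => k (t - r) * G r r + k (rho t - r) * G s s)) => r; apply: cvgD.
    exact: (cs _ _ (diag_continuous G_cont)).
  by apply: cvgM; [exact: ck|exact: cvg_cst].
- by apply/E/cs.
by apply: eq_Rintegral => r _; rewrite rho_id// /dist2; ring.
Qed.

Lemma k_nincr t h : 0 <= t -> 0 <= h -> k (t + h) <= k t.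
Proof.
move=> t0 h0; apply: (le_trans (k_decay t0 h0)).
by rewrite ler_piMl// -expR0 ler_expR oppr_le0 mulr_ge0// ltW.
Qed.

Lemma Rintegral_itv_cst a b (c : R) : a <= b -> \int[leb]_(r in `[a, b]) c = c * (b - a).
Proof.
move=> ab; rewrite Rintegral_cst //= lebesgue_measure_itv/= lte_fin.
by move: ab; rewrite le_eqVlt => /predU1P[->|->//]; rewrite ltxx subrr.
Qed.

Lemma le_Rintegral_itv (f g : R -> R) a b : continuous f -> continuous g ->
  (forall r, a <= r <= b -> f r <= g r) ->
  \int[leb]_(r in `[a, b]) f r <= \int[leb]_(r in `[a, b]) g r.
Proof.
move=> cf cg fg; by apply: le_Rintegral => //; exact: continuous_integrable_itv.
Qed.

Lemma kmass_step t h : 0 <= t -> 0 <= h -> h * k (t + h) <= kmass (t + h) - kmass t.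
Proof.
move=> t0 h0; have th0 : 0 <= t + h by rewrite addr_ge0.
rewrite /kmass !rho_id// (Rintegral_split t0 _ k_cont) ?lerDl// addrAC subrr add0r.
have -> : h * k (t + h) = \int[leb]_(r in `[t, t + h]) k (t + h).
  by rewrite Rintegral_itv_cst ?lerDl//; ring.
apply: le_Rintegral_itv => //; first by move=> x; exact: cvg_cst.
move=> r /andP[tr rt]; have -> : t + h = r + (t + h - r) by ring.
by apply: k_nincr; [exact: le_trans tr|rewrite subr_ge0].
Qed.

(** On [0, t] the kernel has shrunk by the factor e^(-eta h); the new piece has length h, with k at
    most k 0 and f at most [sigma]. In the application f is the distance to a time in the new piece,
    so [sigma] is small and the second term is o(h). *)
Lemma kconv_step (f : R -> R) t h sigma : 0 <= t -> 0 <= h -> continuous f ->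
  (forall r, 0 <= f r) -> (forall r, t <= r <= t + h -> f r <= sigma) ->
  kconv f (t + h) <= expR (- (eta * h)) * kconv f t + h * (k 0 * sigma).
Proof.
move=> t0 h0 cf f0 fs; have th0 : 0 <= t + h by rewrite addr_ge0.
rewrite /kconv !rho_id// (Rintegral_split t0 _ (kshift_continuous cf)) ?lerDl//.
apply: lerD.
  rewrite -RintegralZl//; last exact/continuous_integrable_itv/kshift_continuous.
  apply: (@le_Rintegral_itv (fun r => k (t + h - r) * f r)
    (fun r => expR (- (eta * h)) * (k (t - r) * f r))).
  - exact: kshift_continuous.
  - by move=> r; apply: cvgM; [exact: cvg_cst|exact: kshift_continuous].
  - move=> r /andP[r0 rt]; rewrite mulrA ler_wpM2r// addrAC; apply: k_decay => //.
    by rewrite subr_ge0.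
have -> : h * (k 0 * sigma) = \int[leb]_(r in `[t, t + h]) (k 0 * sigma).
  by rewrite Rintegral_itv_cst ?lerDl//; ring.
apply: (@le_Rintegral_itv (fun r => k (t + h - r) * f r)).
- exact: kshift_continuous.
- by move=> x; exact: cvg_cst.
- move=> r /andP[tr rt]; apply: ler_pM => //; last by apply: fs; rewrite tr.
  by rewrite -[X in k X]add0r k_nincr// subr_ge0.
Qed.

(** * The dissipation inequality *)

Let gam t := G t t.
(** The increment of [w] cancels the terms [kconv gam] that polarisation produces, and [w] itself
    completes the limit in [Phi_quotient] to four times the energy. *)
Let w t := kconv gam t - kmass t * gam t + kconv (dist2^~ t) t.
(** The dissipation rate at step h. At h = 0 it is 2 k(t) G(t,t) plus 2 eta times the memory part,
    which dominates 4 eta [pot t]. *)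
Let X t h := k (t + h) * (gam (t + h) + gam t) +
  eta * expR (- (eta * h)) * (kconv (dist2^~ t) t + kconv (dist2^~ (t + h)) t).

(** After polarisation and cancellation against [w], three increments from t to t + h remain: minus
    that of the mass of k times [gam (t + h) + gam t], and those of [kconv] with the distance to t,
    respectively to t + h, kept fixed. [kmass_step] and two uses of [kconv_step] bound them. *)
Lemma memory_defect_le t h sigma : 0 <= t -> 0 <= h ->
  (forall r, t <= r <= t + h -> dist2 r t <= sigma) ->
  (forall r, t <= r <= t + h -> dist2 r (t + h) <= sigma) ->
  2 * (kconv (G^~ (t + h)) t - kconv (G^~ t) (t + h)) + (w (t + h) - w t) <=
  h * (2 * (k 0 * sigma) - X t h).
Proof.
move=> t0 h0 s1 s2; have th0 : 0 <= t + h by rewrite addr_ge0.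
rewrite mulrBr (kconv_polar _ t0) (kconv_polar _ th0) /w -/gam /X.
have cD s := fixr_continuous (s := s) dist2_continuous.
have := kconv_step t0 h0 (cD t) (dist2_ge0^~ t) s1.
have := kconv_step t0 h0 (cD (t + h)) (dist2_ge0^~ (t + h)) s2.
have : h * k (t + h) * (gam (t + h) + gam t) <=
    (kmass (t + h) - kmass t) * (gam (t + h) + gam t).
  by rewrite ler_wpM2r ?kmass_step// addr_ge0// /gam.
have n1 : 0 <= kconv (dist2^~ t) t by apply: kconv_ge0.
have n2 : 0 <= kconv (dist2^~ (t + h)) t by apply: kconv_ge0.
set e := expR _.
(* This is e^x >= 1 + x divided by e^x, with x = eta h. It gives a loss linear in h whose
   coefficient eta e^(-x) is continuous down to h = 0. *)
have e1 : eta * h * e <= 1 - e.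
  rewrite lerBrDr -[X in _ + X]mul1r -mulrDl.
  rewrite -[leRHS](expRxMexpNx_1 (eta * h)) ler_wpM2r ?expR_ge0//.
  by rewrite addrC expR_ge1Dx.
have : eta * h * e * (kconv (dist2^~ t) t + kconv (dist2^~ (t + h)) t) <=
    (1 - e) * (kconv (dist2^~ t) t + kconv (dist2^~ (t + h)) t).
  by rewrite ler_wpM2r// addr_ge0.
rewrite /gam; lra.
Qed.

Lemma w_continuous : continuous w.
Proof.
move=> t; apply: cvgD; last exact: nu_continuous.
apply: cvgB; first by apply: kconv_continuous; exact: (diag_continuous G_cont).
by apply: cvgM; [exact: kmass_continuous|exact: (diag_continuous G_cont)].
Qed.

Lemma X_continuous : continuous (fun p : R * R => X p.2 p.1).
Proof.
have c1 : continuous (fun p : R * R => p.1) by move=> p; exact: cvg_fst.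
have c2 : continuous (fun p : R * R => p.2) by move=> p; exact: cvg_snd.
have c21 : continuous (fun p : R * R => p.2 + p.1).
  by move=> p; apply: cvgD; [exact: c2|exact: c1].
have cn := kconv_continuous2 dist2_continuous.
move=> p; apply: cvgD; apply: cvgM.
- by apply: (cvg_comp _ k); [exact: c21|exact: k_cont].
- apply: cvgD; first exact: (comp2_continuous G_cont c21 c21).
  exact: (comp2_continuous G_cont c2 c2).
- apply: cvgM; first exact: cvg_cst.
  apply: (cvg_comp (fun p : R * R => - (eta * p.1)) expR); last exact: continuous_expR.
  by apply: cvgN; apply: cvgM; [exact: cvg_cst|exact: c1].
- apply: cvgD; first exact: (comp2_continuous (f := fun t s => kconv (dist2^~ s) t) cn c2 c2).
  exact: (comp2_continuous (f := fun t s => kconv (dist2^~ s) t) cn c2 c21).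
Qed.

(** The coefficient k(t) of the gradient term is traded for eta (1 - kmass t) by [k_tail]; the
    memory term already carries the factor eta. *)
Lemma X0_ge t : 0 <= t -> 4 * eta * pot t <= X t 0.
Proof.
move=> t0; rewrite /X /pot !addr0 mulr0 oppr0 expR0 mulr1 -/(gam t).
have : eta * (1 - kmass t) * gam t <= k t * gam t.
  by rewrite ler_wpM2r ?k_tail// /gam.
lra.
Qed.

Section antiderivative.
Variable W : R -> R.
Hypothesis dW : forall t, 0 < t -> is_derive t (1 : R) W (w t).

(** The explicit coefficients 1 and -1 give the shape that [is_derive_lin] produces. *)
Let Phi h t := 2 * (1 * P t (t + h) + (-1) * P (t + h) t) + 1 * (1 * W (t + h) + (-1) * W t).

(** By symmetry, the contributions of G(t, t + h) and of Q(t, t + h) to the two diagonal derivatives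
    cancel, and only the memory terms survive. *)
Lemma Phi_derive t h : 0 < t -> 0 <= h ->
  is_derive t (1 : R) (Phi h)
   (2 * (kconv (G^~ (t + h)) t - kconv (G^~ t) (t + h)) + (w (t + h) - w t)).
Proof.
move=> t0 h0; have th0 : 0 < t + h by rewrite ltr_wpDr.
have := @is_derive_diag _ P Q (kconv (G^~ (t + h)) (t + 0) - G (t + 0) (t + h)) t 0 h.
rewrite addr0 => /(_ t0 th0 dP2 Q_cont (dP1 t0 th0)).
under eq_fun do rewrite addr0; move=> D1.
have := @is_derive_diag _ P Q (kconv (G^~ (t + 0)) (t + h) - G (t + h) (t + 0)) t h 0.
rewrite addr0 => /(_ th0 t0 dP2 Q_cont (dP1 th0 t0)).
under eq_fun do rewrite addr0; move=> D2.
have := is_derive_lin 2 1 (is_derive_lin 1 (-1) D1 D2)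
  (is_derive_lin 1 (-1) (is_derive_shift (dW th0)) (dW t0)).
set d := (X in is_derive _ _ _ X -> _); set d' := (X in _ -> is_derive _ _ _ X).
suff -> : d' = d by [].
rewrite /d /d' (G_sym (t + h)) (Q_sym (t + h)); ring.
Qed.

(** The h-derivative at 0 is 2 (Q(t,t) + G(t,t) - kconv (G^~ t) t) + w t. Polarisation at s = t
    turns it into 2 Q(t,t) + 4 pot t. *)
Lemma Phi_quotient t : 0 < t -> (h^-1 * Phi h t) @[h --> 0^'] --> 4 * menergy t.
Proof.
move=> t0.
have t00 : 0 < 0 + t by rewrite add0r.
have E (f : R -> R) d : is_derive t (1 : R) f d -> is_derive (0 : R) (1 : R) (fun h => f (h + t)) d.
  by move=> H; apply: is_derive_shift; rewrite add0r.
have D := is_derive_lin 2 1 (is_derive_lin 1 (-1) (E _ _ (dP2 t0 t0)) (E _ _ (dP1 t0 t0)))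
  (is_derive_lin 1 (-1) (E _ _ (dW t0)) (is_derive_cst (W t : R) (0 : R) (1 : R))).
have := is_derive_quotientP D.
rewrite [X in _ --> X -> _](_ : _ = 4 * menergy t); last first.
  rewrite /menergy /pot /w.
  have := kconv_polar t (ltW t0); rewrite -/gam /gam; lra.
apply: cvg_trans; apply: near_eq_cvg; apply: nearW => h.
by rewrite /Phi !(add0r, addr0) (addrC h t); congr (_ * _); ring.
Qed.

(** For a fixed small h > 0, Phi h + 4 eta h Pi minus a small linear term is nonincreasing on
    [S, T], by [memory_defect_le]. Dividing by h uses [Phi_quotient] only at S and T. *)
Lemma energy_dissipation_of (Pi : R -> R) S T :
  (forall t, 0 < t -> is_derive t (1 : R) Pi (pot t)) -> 0 < S -> S <= T ->
  menergy T + eta * Pi T <= menergy S + eta * Pi S.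
Proof.
move=> dPi S0 ST.
have T0 : 0 < T by exact: lt_le_trans ST.
(* Three errors of size e: the choice sigma = e costs 2 k 0 e and replacing X t h by X t 0 costs e,
   both over the length T - S; the quotients at the two ends cost e once. *)
suff H e : 0 < e -> 4 * menergy T - 4 * menergy S <=
    - (4 * eta * (Pi T - Pi S)) + e * ((2 * k 0 + 1) * (T - S) + 1).
  have C0 : 0 < (2 * k 0 + 1) * (T - S) + 1.
    by rewrite ltr_wpDl// mulr_ge0// ?subr_ge0// addr_ge0// mulr_ge0.
  have : 4 * menergy T - 4 * menergy S <= - (4 * eta * (Pi T - Pi S)).
    apply/ler_addgt0Pr => e e0.
    by have := H _ (divr_gt0 e0 C0); rewrite divfK// gt_eqF.
  lra.
move=> e0.
have e2 : 0 < e / 2 by rewrite divr_gt0.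
have uX := param_unif (phi := fun h t => X t h) S T X_continuous 0 e0.
have cN : continuous (fun p : R * R => dist2 (p.2 + p.1) p.2).
  have c2 : continuous (fun p : R * R => p.2) by move=> p; exact: cvg_snd.
  apply: (comp2_continuous dist2_continuous _ c2) => p.
  by apply: cvgD; [exact: cvg_snd|exact: cvg_fst].
(* The range extends to T + 1 because distances are also taken to t + h, which may exceed T; h < 1
   keeps it in range. *)
have /nbhs_ballP[d /= d0 uN] := param_unif (phi := fun h t => dist2 (t + h) t) S (T + 1) cN 0 e0.
have q : (h^-1 * Phi h T - h^-1 * Phi h S) @[h --> 0^'+] --> 4 * menergy T - 4 * menergy S.
  by apply: cvgB; apply: cvg_dnbhs_at_right; exact: Phi_quotient.
have /cvgrPdist_lt/(_ _ e0) q' := q.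
near (0 : R)^'+ => h.
have h0 : 0 < h by [].
have h1 : h < 1 by near: h; exact: nbhs_right_lt.
have hd : h < d by near: h; exact: nbhs_right_lt.
have hX : forall t, S <= t <= T -> `|X t 0 - X t h| < e.
  by near: h; apply: cvg_at_right_filter uX; exact: cvg_id.
have : `|(4 * menergy T - 4 * menergy S) - (h^-1 * Phi h T - h^-1 * Phi h S)| < e by near: h.
have D t : S <= t <= T -> is_derive t (1 : R)
    (fun t => 1 * Phi h t + h * (4 * eta * Pi t + (- (e * (2 * k 0 + 1))) * t))
    (1 * (2 * (kconv (G^~ (t + h)) t - kconv (G^~ t) (t + h)) + (w (t + h) - w t)) +
     h * (4 * eta * pot t + (- (e * (2 * k 0 + 1))) * 1)).
  move=> /andP[St tT]; have t0 : 0 < t by exact: lt_le_trans St.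
  apply: is_derive_lin; first by apply: Phi_derive => //; exact: ltW.
  by apply: is_derive_lin; [exact: dPi|exact: is_derive_id].
suff /(derive_le0_nincr ST D) : forall t, S <= t <= T ->
    1 * (2 * (kconv (G^~ (t + h)) t - kconv (G^~ t) (t + h)) + (w (t + h) - w t)) +
     h * (4 * eta * pot t + (- (e * (2 * k 0 + 1))) * 1) <= 0.
  move=> I.
  have : h^-1 * (Phi h T - Phi h S) <=
      - (4 * eta * (Pi T - Pi S)) + e * ((2 * k 0 + 1) * (T - S)).
    by rewrite mulrC ler_pdivrMr//; lra.
  rewrite ltr_norml => J /andP[_ ?]; lra.
move=> t /andP[St tT].
  have t0 : 0 < t by exact: lt_le_trans St.
  have dN s r : S <= s <= T + 1 -> s - h <= r <= s + h -> dist2 r s <= e.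
    move=> sST rs.
    have : ball 0 d (r - s).
      rewrite /ball/= sub0r normrN ltr_norml; apply/andP; split; lra.
    move=> /uN /(_ s sST); rewrite addr0 (_ : s + (r - s) = r) ?ltr_norml; last by ring.
    move=> /andP[+ _].
    rewrite {1}/dist2; lra.
  have s1 r : t <= r <= t + h -> dist2 r t <= e.
    by move=> ?; apply: dN; apply/andP; split; lra.
  have s2 r : t <= r <= t + h -> dist2 r (t + h) <= e.
    by move=> ?; apply: dN; apply/andP; split; lra.
  have := memory_defect_le (ltW t0) (ltW h0) s1 s2.
  have := hX t; rewrite St tT => /(_ isT); rewrite ltr_norml => /andP[_ x2].
  have x3 := X0_ge (ltW t0).
  have : h * (2 * (k 0 * e) - X t h) <= h * (2 * (k 0 * e) - (4 * eta * pot t - e)).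
    by rewrite ler_wpM2l ?(ltW h0)//; lra.
  lra.
Unshelve. all: by end_near. Qed.

End antiderivative.

Lemma energy_dissipation (Pi : R -> R) S T :
  (forall t, 0 < t -> is_derive t (1 : R) Pi (pot t)) -> 0 < S -> S <= T ->
  menergy T + eta * Pi T <= menergy S + eta * Pi S.
Proof.
move=> dPi S0 ST; have [W dW] := continuous_antiderivative 0 w_continuous.
exact: (energy_dissipation_of dW dPi S0 ST).
Qed.

Lemma pot_antiderivative :
  exists2 Pi : R -> R, (forall t, 0 < t -> is_derive t (1 : R) Pi (pot t)) &
    forall S T, 0 < S -> S <= T -> Pi S <= Pi T.
Proof.
have [Pi dPi] := continuous_antiderivative 0 pot_continuous; exists Pi => // S T S0 ST.
have D t : S <= t <= T -> is_derive t (1 : R) (fun t => (-1) * Pi t + 0 * Pi t) (-1 * pot t + 0 * pot t).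
  by move=> /andP[St tT]; have := dPi t (lt_le_trans S0 St) => dt; exact: is_derive_lin.
suff /(derive_le0_nincr ST D) : forall t, S <= t <= T -> -1 * pot t + 0 * pot t <= 0 by lra.
move=> t /andP[St _].
by rewrite mul0r addr0 mulN1r oppr_le0 pot_ge0// (le_trans (ltW S0)).
Qed.

Lemma menergy_ge0 t : 0 <= t -> 0 <= menergy t.
Proof. by move=> t0; rewrite addr_ge0 ?pot_ge0// mulr_ge0// Q_ge0. Qed.

(** The derivatives of P are available at positive times only, so the case S = 0 is reached by
    continuity of the energy. *)
Lemma menergy_nincr S T : 0 <= S -> S <= T -> menergy T <= menergy S.
Proof.
have [Pi dPi ndPi] := pot_antiderivative.
have pos s t : 0 < s -> s <= t -> menergy t <= menergy s.
  move=> s0 st; have := energy_dissipation dPi s0 st.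
  have : eta * Pi s <= eta * Pi t by rewrite ler_wpM2l ?(ltW eta_gt0)// ndPi.
  lra.
rewrite le_eqVlt => /predU1P[<-|S0 ST]; last exact: pos.
rewrite le_eqVlt => /predU1P[<-//|T0].
apply/ler_addgt0Pr => e e0.
have /cvgrPdist_lt/(_ _ e0)/nbhs_ballP[d /= d0 Hd] := menergy_continuous (x := 0).
pose s := Num.min T (d / 2).
have s0 : 0 < s by rewrite lt_min T0 divr_gt0.
have sT : s <= T by rewrite ge_min lexx.
have sd : s <= d / 2 by rewrite ge_min lexx orbT.
have := pos _ _ s0 sT.
have : `|menergy 0 - menergy s| < e.
  apply: Hd; rewrite /ball/= sub0r normrN gtr0_norm//; lra.
rewrite ltr_norml; lra.
Qed.

(** * Equipartition: the time integral of the kinetic energy *)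

Variables (c t1 km : R).
Hypothesis c_ge0 : 0 <= c.
Hypothesis t1_gt0 : 0 < t1.
Hypothesis km_gt0 : 0 < km.
Hypothesis k_low : forall r, 0 <= r <= t1 -> km <= k r.
Hypothesis P_cont : continuous (fun p : R * R => P p.1 p.2).
Hypothesis P_young : forall t s e, 0 < e ->
  2 * `|P t t - P t s| <= e * Q t t + e^-1 * (c * dist2 s t).

(** The elliptic and memory terms at time t tested against u(s), so that dP/dt = - A. *)
Let A t s := G t s - kconv (G^~ s) t.

(** Polarising both memory terms, 2 (A t t - A t s) equals dist2 s t + (1 - kmass t) (G t t - G s s)
    plus the memory integral at t minus the one at s. The contributions at s alone have the
    favourable sign, so no bound on G s s enters. *)
Lemma A_diff_le t s : 0 <= t -> A t t - A t s <= pot t + 2^-1 * dist2 s t.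
Proof.
move=> t0; rewrite /A /pot.
have := kconv_polar t t0; have := kconv_polar s t0.
have : 0 <= kconv (dist2^~ s) t by exact: kconv_ge0.
have : 0 <= (1 - kmass t) * G s s by rewrite mulr_ge0// subr_ge0 kmass_le.
have -> : dist2 s t = G t t - 2 * G t s + G s s by rewrite /dist2 (G_sym s t); ring.
lra.
Qed.

Lemma lag_continuous (f : R -> R -> R) t : continuous (fun p : R * R => f p.1 p.2) ->
  continuous (fun tau => f t (t - tau)).
Proof.
move=> cf; apply: (comp2_continuous cf) => x; first exact: cvg_cst.
by apply: cvgB; [exact: cvg_cst|exact: cvg_id].
Qed.

Lemma lag_continuousC (f : R -> R -> R) t : continuous (fun p : R * R => f p.1 p.2) ->
  continuous (fun tau => f (t - tau) t).
Proof.
move=> cf; apply: (comp2_continuous cf) => x; last exact: cvg_cst.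
by apply: cvgB; [exact: cvg_cst|exact: cvg_id].
Qed.

Let J t := \int[leb]_(tau in `[0, t1]) dist2 (t - tau) t.

(** In the lag variable tau = t - r the memory part of 2 pot t is the integral of k(tau) dist2(t -
    tau, t) over [0, t]. Restricting it to [0, t1], which requires t1 <= t, leaves a weight of at
    least [km]. *)
Lemma lag_dist_le t : t1 <= t -> J t <= 2 * km^-1 * pot t.
Proof.
move=> t1t; have t0 : 0 <= t := le_trans (ltW t1_gt0) t1t.
have cd := lag_continuousC (t := t) dist2_continuous.
have ckd : continuous (fun tau => k tau * dist2 (t - tau) t).
  by move=> x; apply: cvgM; [exact: k_cont|exact: cd].
have E : kconv (dist2^~ t) t = \int[leb]_(tau in `[0, t]) (k tau * dist2 (t - tau) t).
  rewrite -(Rintegral_flip t0 ckd) /kconv rho_id//.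
  by apply: eq_Rintegral => r _; rewrite (_ : t - (t - r) = r)//; ring.
have : km * J t <= kconv (dist2^~ t) t.
  rewrite E (Rintegral_split (ltW t1_gt0) t1t ckd) -RintegralZl//; last first.
    exact: continuous_integrable_itv.
  rewrite -[leLHS]addr0 lerD//.
    apply: le_Rintegral_itv => //.
      by move=> x; apply: cvgM; [exact: cvg_cst|exact: cd].
    by move=> r r0; rewrite ler_wpM2r// k_low.
  by apply: Rintegral_ge0 => r _; rewrite mulr_ge0.
have : 0 <= (1 - kmass t) * G t t by rewrite mulr_ge0// subr_ge0 kmass_le.
move=> H1 H2.
have : km * J t <= 2 * pot t by rewrite /pot; lra.
by rewrite -[X in _ -> _ <= X]mulrAC ler_pdivlMr// mulrC.
Qed.

Let y t tau := (t1 - tau) * P t t + (- (t1 - tau)) * P t (t - tau).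
Let dy t tau := (t1 - tau) * (Q t t - A t t) + (- (t1 - tau)) * (Q t (t - tau) - A t (t - tau)).
Let Y t := \int[leb]_(tau in `[0, t1]) y t tau.

Lemma A_continuous : continuous (fun p : R * R => A p.1 p.2).
Proof.
by move=> p; apply: cvgB; [exact: G_cont|exact: (kconv_continuous2 G_cont)].
Qed.

Lemma y_continuous : continuous (fun p : R * R => y p.1 p.2).
Proof.
have c1 : continuous (fun p : R * R => p.1) by move=> p; exact: cvg_fst.
have c2 : continuous (fun p : R * R => p.1 - p.2).
  by move=> p; apply: cvgB; [exact: cvg_fst|exact: cvg_snd].
have c3 : continuous (fun p : R * R => t1 - p.2).
  by move=> p; apply: cvgB; [exact: cvg_cst|exact: cvg_snd].
move=> p; apply: cvgD; apply: cvgM.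
- exact: c3.
- exact: (comp2_continuous P_cont c1 c1).
- by apply: cvgN; exact: c3.
- exact: (comp2_continuous P_cont c1 c2).
Qed.

Lemma dy_continuous : continuous (fun p : R * R => dy p.1 p.2).
Proof.
have c1 : continuous (fun p : R * R => p.1) by move=> p; exact: cvg_fst.
have c2 : continuous (fun p : R * R => p.1 - p.2).
  by move=> p; apply: cvgB; [exact: cvg_fst|exact: cvg_snd].
have c3 : continuous (fun p : R * R => t1 - p.2).
  by move=> p; apply: cvgB; [exact: cvg_cst|exact: cvg_snd].
move=> p; apply: cvgD; apply: cvgM.
- exact: c3.
- apply: cvgB; first exact: (comp2_continuous Q_cont c1 c1).
  exact: (comp2_continuous A_continuous c1 c1).
- by apply: cvgN; exact: c3.
- apply: cvgB; first exact: (comp2_continuous Q_cont c1 c2).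
  exact: (comp2_continuous A_continuous c1 c2).
Qed.

Lemma Y_derive t : t1 < t -> is_derive t (1 : R) Y (\int[leb]_(tau in `[0, t1]) dy t tau).
Proof.
move=> t1t; apply: param_derive; first exact: ltW.
- exact: dy_continuous.
- by move=> x; exact: (continuous_fst_fix (phi := y) y_continuous).
(* Within this radius x stays above t1, so every lagged time x - tau is positive and [dP2]
   applies. *)
apply/nbhs_ballP; exists (t - t1) => /=; first by rewrite subr_gt0.
move=> x; rewrite /ball/= ltr_norml => /andP[_ tx] tau /andP[tau0 tau1].
have t1x : t1 < x by lra.
have x0 : 0 < x by exact: lt_trans t1x.
have D b : 0 < x + b -> is_derive x (1 : R) (fun x => P x (x + b)) (Q x (x + b) - A x (x + b)).
  move=> xb.
  have := @is_derive_diag _ P Q (kconv (G^~ (x + b)) (x + 0) - G (x + 0) (x + b)) x 0 b.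
  rewrite addr0 => /(_ x0 xb dP2 Q_cont (dP1 x0 xb)).
  under eq_fun do rewrite addr0.
  by rewrite /A opprB addrC.
have := D 0; rewrite addr0 => /(_ x0); under eq_fun do rewrite addr0.
move=> D0; have x1 : 0 < x - tau by rewrite subr_gt0 (le_lt_trans tau1).
exact: (is_derive_lin (t1 - tau) (- (t1 - tau)) D0 (D _ x1)).
Qed.

(** The tau-derivative of P(t, t - tau) is - Q(t, t - tau), and H vanishes at tau = 0 and tau = t1.
    So the integral of (t1 - tau) Q(t, t - tau) equals that of P(t,t) - P(t, t - tau), which
    [P_young] bounds by a small multiple of Q(t,t) and lagged distances; [A_diff_le] and
    [lag_dist_le] do the rest. *)
Lemma dY_ge t : t1 < t ->
  4^-1 * t1 ^+ 2 * Q t t - (t1 ^+ 2 + (t1 + 2 * c / t1) * km^-1) * pot t <=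
  \int[leb]_(tau in `[0, t1]) dy t tau.
Proof.
move=> t1t; have t0 : 0 < t by exact: lt_trans t1t.
pose H tau := (t1 - tau) * (P t t - P t (t - tau)).
pose dH tau := (t1 - tau) * Q t (t - tau) - (P t t - P t (t - tau)).
have dHP tau : 0 <= tau <= t1 -> is_derive tau (1 : R) H (dH tau).
  move=> /andP[? ?].
  have d1 : is_derive tau (1 : R) (fun tau => P t (t - tau)) (- Q t (t - tau)).
    by apply: is_derive_flip; apply: dP2; rewrite ?subr_gt0//; lra.
  have d2 : is_derive tau (1 : R) (fun tau => t1 - tau) (- 1).
    exact: (is_derive_flip (f := id)).
  have d3 := is_derive_lin 1 (-1) (is_derive_cst (P t t : R) tau (1 : R)) d1.
  have := is_derive_mul d2 d3.
  rewrite (_ : (fun x => _) = H); last by apply/funext => x; rewrite /H /cst; ring.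
  set a := (X in is_derive _ _ _ X -> _); suff -> : a = dH tau by [].
  rewrite /a /dH /cst; ring.
(* The weight t1 - tau yields (t1^2 / 2) Q(t,t). With this parameter Young's inequality costs e t1 /
   2 = t1^2 / 4 of it, leaving the coefficient 1/4. *)
pose e := t1 / 2.
have e0 : 0 < e by rewrite divr_gt0.
pose C := 2^-1 * t1 + 2^-1 * (e^-1 * c).
(* The lower bound for [dy t tau] is z minus C times the lagged distance. The part z has the
   explicit antiderivative Z, in which H contributes nothing at either end. *)
pose z tau := (t1 * Q t t - t1 * pot t - 2^-1 * (e * Q t t)) * 1 +
   1 * ((- Q t t) * tau + (-1) * dH tau).
pose Z tau := (t1 * Q t t - t1 * pot t - 2^-1 * (e * Q t t)) * tau +
   1 * ((- Q t t) * (2^-1 * (tau * tau) + 0 * tau) + (-1) * H tau).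
have dZ tau : 0 <= tau <= t1 -> is_derive tau (1 : R) Z (z tau).
  move=> tau01.
  have d1 := is_derive_id tau (1 : R).
  suff dsq : is_derive tau (1 : R) (fun x => 2^-1 * (x * x) + 0 * x) tau.
    exact: (is_derive_lin _ 1 d1 (is_derive_lin (- Q t t) (-1) dsq (dHP tau tau01))).
  have := is_derive_lin 2^-1 0 (is_derive_mul (is_derive_id tau (1 : R)) (is_derive_id tau (1 : R)))
    (is_derive_id tau (1 : R)).
  set a := (X in is_derive _ _ _ X -> _); suff -> : a = tau by [].
  rewrite /a; lra.
have cQ := lag_continuous (t := t) Q_cont.
have cP := lag_continuous (t := t) P_cont.
have cD := lag_continuousC (t := t) dist2_continuous.
have cz : continuous z.
  move=> x; apply: cvgD; first exact: cvg_cst.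
  apply: cvgM; first exact: cvg_cst.
  apply: cvgD; first by apply: cvgM; [exact: cvg_cst|exact: cvg_id].
  apply: cvgM; first exact: cvg_cst.
  apply: cvgB; last by apply: cvgB; [exact: cvg_cst|exact: cP].
  apply: cvgM; last exact: cQ.
  by apply: cvgB; [exact: cvg_cst|exact: cvg_id].
have cCD : continuous (fun tau => C * dist2 (t - tau) t).
  by move=> x; apply: cvgM; [exact: cvg_cst|exact: cD].
have : \int[leb]_(tau in `[0, t1]) (z tau - C * dist2 (t - tau) t) <=
    \int[leb]_(tau in `[0, t1]) dy t tau.
  apply: le_Rintegral_itv.
  - by move=> x; apply: cvgB; [exact: cz|exact: cCD].
  - exact: (continuous_fst_fix (phi := dy) dy_continuous).
  - move=> tau /andP[tau0 tau1].
    have a1 := A_diff_le (t - tau) (ltW t0).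
    have a2 : (t1 - tau) * (A t t - A t (t - tau)) <= t1 * (pot t + 2^-1 * dist2 (t - tau) t).
      apply: (@le_trans _ _ ((t1 - tau) * (pot t + 2^-1 * dist2 (t - tau) t))).
        by rewrite ler_wpM2l// subr_ge0.
      by rewrite ler_wpM2r ?gerBl// addr_ge0 ?pot_ge0 ?(ltW t0)// mulr_ge0.
    have := P_young t (t - tau) e0; have := ler_norm (P t t - P t (t - tau)).
    rewrite /z /C /dH /dy; lra.
rewrite RintegralB//; [|exact: continuous_integrable_itv..].
rewrite (Rintegral_derive (ltW t1_gt0) cz dZ) RintegralZl//; last exact: continuous_integrable_itv.
apply: le_trans.
have C0 : 0 <= C by rewrite /C addr_ge0 ?mulr_ge0// ?invr_ge0 ?ltW.
have : C * J t <= C * (2 * km^-1 * pot t) by rewrite ler_wpM2l// lag_dist_le// ltW.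
rewrite -/(J t) /Z /H !(subrr, mul0r, mulr0, subr0, addr0, add0r).
have -> : C = 2^-1 * t1 + c / t1 by rewrite /C /e; field; rewrite gt_eqF.
have -> : e = t1 / 2 by [].
lra.
Qed.

(** [P_young] with parameter 1 and then [lag_dist_le]; both Q(t,t) / 2 and [pot t] are at most the
    energy. *)
Lemma Y_le t : t1 <= t -> `|Y t| <= (t1 ^+ 2 + t1 * c * km^-1) * menergy t.
Proof.
move=> t1t; have t0 : 0 <= t := le_trans (ltW t1_gt0) t1t.
have cD := lag_continuousC (t := t) dist2_continuous.
have cy := continuous_fst_fix (phi := y) (x := t) y_continuous.
apply: (le_trans (le_normr_Rintegral _ _)) => //; first exact: continuous_integrable_itv.
have cCD : continuous (fun tau => (2^-1 * t1 * c) * dist2 (t - tau) t).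
  by move=> x; apply: cvgM; [exact: cvg_cst|exact: cD].
have cc : continuous (fun _ : R => 2^-1 * t1 * Q t t) by move=> x; exact: cvg_cst.
apply: (@le_trans _ _ (\int[leb]_(tau in `[0, t1])
    (2^-1 * t1 * Q t t + (2^-1 * t1 * c) * dist2 (t - tau) t))).
  apply: le_Rintegral_itv.
  - by move=> x; apply: cvg_norm; exact: cy.
  - by move=> x; apply: cvgD; [exact: cc|exact: cCD].
  - move=> tau /andP[tau0 tau1].
    have -> : y t tau = (t1 - tau) * (P t t - P t (t - tau)) by rewrite /y; ring.
    rewrite normrM ger0_norm ?subr_ge0//.
    have := P_young t (t - tau) ltr01; rewrite invr1.
    have : (t1 - tau) * `|P t t - P t (t - tau)| <= t1 * `|P t t - P t (t - tau)|.
      by rewrite ler_wpM2r// gerBl.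
    move=> h1 h2; apply: (le_trans h1).
    have := ler_wpM2l (ltW t1_gt0) h2; lra.
rewrite RintegralD//; [|exact: continuous_integrable_itv..].
rewrite [X in _ + X <= _]RintegralZl//; last exact: continuous_integrable_itv.
rewrite Rintegral_itv_cst ?(ltW t1_gt0)// -/(J t).
have : (2^-1 * t1 * c) * J t <= (2^-1 * t1 * c) * (2 * km^-1 * pot t).
  by rewrite ler_wpM2l ?lag_dist_le// !mulr_ge0 ?invr_ge0 ?(ltW t1_gt0).
have : 0 <= t1 * c * km^-1 * Q t t by rewrite !mulr_ge0 ?invr_ge0 ?(ltW t1_gt0) ?(ltW km_gt0).
have : 0 <= t1 ^+ 2 * pot t by rewrite mulr_ge0 ?sqr_ge0 ?pot_ge0.
rewrite /menergy; lra.
Qed.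

(** The integral of Q costs 4 / t1^2 times the bound from integrating Y', halved because the kinetic
    energy is Q / 2. In that bound, the factor 2 counts the two ends of Y, and 1 / eta bounds the
    integral of [pot], which gives the last summand as well. *)
Definition decay_const := 2 / t1 ^+ 2 * (2 * (t1 ^+ 2 + t1 * c * km^-1) +
  (t1 ^+ 2 + (t1 + 2 * c / t1) * km^-1) / eta) + eta^-1.

(** As E is nonincreasing, T E(s + T) is at most the integral of E over [s, s + T]. Dissipation
    bounds the integral of [pot]; integrating [dY_ge] with [Y_le] at both ends bounds that of Q. The
    antiderivatives [Pi] and [Th] stand for these integrals. *)
Lemma menergy_observability s T : t1 < s -> 0 <= T ->
  T * menergy (s + T) <= decay_const * menergy s.
Proof.
move=> t1s T0; have s0 : 0 < s by exact: lt_trans t1s.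
have sT : s <= s + T by rewrite lerDl.
have [Pi dPi ndPi] := pot_antiderivative.
have [Th dTh] := continuous_antiderivative 0 (diag_continuous Q_cont).
have Es0 := menergy_ge0 (ltW s0).
have EsT0 := menergy_ge0 (addr_ge0 (ltW s0) T0).
have ED := energy_dissipation dPi s0 sT.
have H1 : Pi (s + T) - Pi s <= menergy s / eta.
  by rewrite ler_pdivlMr// mulrC; lra.
set C3 := t1 ^+ 2 + t1 * c * km^-1.
set C2 := t1 ^+ 2 + (t1 + 2 * c / t1) * km^-1.
have C20 : 0 <= C2.
  rewrite /C2 addr_ge0 ?sqr_ge0// mulr_ge0 ?invr_ge0 ?(ltW km_gt0)//.
  by rewrite addr_ge0 ?(ltW t1_gt0)// divr_ge0 ?(ltW t1_gt0)// mulr_ge0.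
have C30 : 0 <= C3.
  by rewrite /C3 addr_ge0 ?sqr_ge0// !mulr_ge0 ?invr_ge0 ?(ltW t1_gt0) ?(ltW km_gt0).
have H2 : 4^-1 * t1 ^+ 2 * (Th (s + T) - Th s) <= 2 * C3 * menergy s + C2 * (menergy s / eta).
  have D t : s <= t <= s + T -> is_derive t (1 : R)
      (fun t => 1 * ((4^-1 * t1 ^+ 2) * Th t + (- C2) * Pi t) + (-1) * Y t)
      (1 * ((4^-1 * t1 ^+ 2) * Q t t + (- C2) * pot t) +
      (-1) * \int[leb]_(tau in `[0, t1]) dy t tau).
    move=> /andP[st _]; have t0 := lt_le_trans s0 st.
    exact: (is_derive_lin 1 (-1) (is_derive_lin _ _ (dTh _ t0) (dPi _ t0))
      (Y_derive (lt_le_trans t1s st))).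
  have := derive_le0_nincr sT D.
  have N t : s <= t <= s + T -> 1 * ((4^-1 * t1 ^+ 2) * Q t t + (- C2) * pot t) +
      (-1) * \int[leb]_(tau in `[0, t1]) dy t tau <= 0.
    by move=> /andP[st _]; have := dY_ge (lt_le_trans t1s st); rewrite -/C2; lra.
  move=> /(_ N).
  have := Y_le (ltW t1s); have := Y_le (le_trans (ltW t1s) sT); rewrite -/C3.
  have : C3 * menergy (s + T) <= C3 * menergy s by rewrite ler_wpM2l// menergy_nincr// ltW.
  have : C2 * (Pi (s + T) - Pi s) <= C2 * (menergy s / eta) by rewrite ler_wpM2l.
  rewrite !ler_norml; lra.
have H3 : T * menergy (s + T) <= 2^-1 * (Th (s + T) - Th s) + (Pi (s + T) - Pi s).
  have D t : s <= t <= s + T -> is_derive t (1 : R)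
      (fun t => 1 * ((-2^-1) * Th t + (-1) * Pi t) + menergy (s + T) * t)
      (1 * ((-2^-1) * Q t t + (-1) * pot t) + menergy (s + T) * 1).
    move=> /andP[st _]; have t0 := lt_le_trans s0 st.
    exact: (is_derive_lin 1 _ (is_derive_lin _ (-1) (dTh _ t0) (dPi _ t0)) (is_derive_id t (1 : R))).
  have := derive_le0_nincr sT D.
  have N t : s <= t <= s + T -> 1 * ((-2^-1) * Q t t + (-1) * pot t) + menergy (s + T) * 1 <= 0.
    move=> /andP[st tsT].
    by have := menergy_nincr (ltW (lt_le_trans s0 st)) tsT; rewrite {2}/menergy; lra.
  move=> /(_ N); lra.
apply: (le_trans H3); rewrite /decay_const -/C3 -/C2.
have t12 : 0 < 4^-1 * t1 ^+ 2 by rewrite mulr_gt0 ?invr_gt0// exprn_gt0.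
have : Th (s + T) - Th s <= (2 * C3 * menergy s + C2 * (menergy s / eta)) / (4^-1 * t1 ^+ 2).
  by rewrite ler_pdivlMr// mulrC.
have -> : (2 * C3 * menergy s + C2 * (menergy s / eta)) / (4^-1 * t1 ^+ 2) =
  2 * (2 / t1 ^+ 2 * (2 * C3 + C2 / eta) * menergy s).
  by field; rewrite !gt_eqF.
lra.
Qed.

End memory_kernel.

(** The hypothesis started at s + 2 t1 with T = C e gives E(s + tau) <= E(s) / e for tau = 2 t1 + C
    e. The starting time must exceed t1 strictly while s may be 0, whence 2 t1. The summand 1 in the
    exponent pays for the incomplete last step. *)
Lemma exp_decay_of_averages {R : realType} (E : R -> R) (C t1 : R) :
  0 < C -> 0 < t1 ->
  (forall t, 0 <= t -> 0 <= E t) ->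
  (forall s t, 0 <= s -> s <= t -> E t <= E s) ->
  (forall s T, t1 < s -> 0 <= T -> T * E (s + T) <= C * E s) ->
  forall t, 0 <= t -> E t <= E 0 * expR (1 - (2 * t1 + C * expR 1)^-1 * t).
Proof.
move=> C0 t10 E0 ndE HE t t0.
set tau := 2 * t1 + C * expR 1.
have e1 : (0 : R) < expR 1 by exact: expR_gt0.
have tau0 : 0 < tau by rewrite addr_gt0// mulr_gt0.
have step s : 0 <= s -> E (s + tau) <= expR (-1) * E s.
  move=> s0; rewrite expRN ler_pdivlMl//.
  have : C * expR 1 * E (s + 2 * t1 + C * expR 1) <= C * E (s + 2 * t1).
    by apply: HE; [lra|rewrite mulr_ge0 ?ltW].
  rewrite -mulrA ler_pM2l// -addrA -/tau => /le_trans; apply; apply: ndE => //; lra.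
have iter n : E (n%:R * tau) <= expR (- n%:R) * E 0.
  elim: n => [|n IH]; first by rewrite mul0r oppr0 expR0 mul1r.
  rewrite -natr1 mulrDl mul1r opprD expRD (mulrC (expR (- n%:R))) -mulrA.
  apply: (le_trans (step _ _)); first by rewrite mulr_ge0// ltW.
  by rewrite ler_wpM2l ?expR_ge0.
set n := Num.truncn (t / tau).
have tn : n%:R <= t / tau < n.+1%:R by apply: truncn_itv; rewrite divr_ge0// ltW.
move: tn => /andP[n1 n2].
apply: (@le_trans _ _ (E (n%:R * tau))).
  by apply: ndE; [rewrite mulr_ge0// ltW|rewrite -ler_pdivlMr].
apply: (le_trans (iter n)); rewrite mulrC ler_wpM2l ?E0// ler_expR.
by move: n2; rewrite -natr1 (mulrC _ t); lra.
Qed.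

(** * The memory kernel *)

Section absolutely_continuous.
Context {R : realType}.
Local Notation leb := (@lebesgue_measure R).
Implicit Types (f k : R -> R) (a b e t x y : R).

(** Outer regularity of Lebesgue measure, applied to a measurable null set containing Z. *)
Lemma null_set_cover (Z : set R) e : 0 < e -> leb.-negligible Z ->
  exists U : set R, [/\ open U, Z `<=` U & (leb U < e%:E)%E].
Proof.
move=> e0 [A [mA A0 ZA]].
have Aoo : (leb A < +oo)%E by rewrite A0.
have [U [oU AU UA]] := lebesgue_regularity_outer mA Aoo e0.
exists U; split => //; first exact: subset_trans AU.
have mU : measurable U by exact: open_measurable.
rewrite -(setDUK AU) measureU//; last 2 first.
- exact: measurableD.
- by rewrite setDIK.
by rewrite [X in (X + _ < _)%E]A0 add0e.
Qed.

Lemma disjoint_itv_length (n : nat) (al be : nat -> R) (U : set R) (d : R) : open U ->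
  (forall i, (i < n)%N -> al i <= be i /\ `]al i, be i[ `<=` U) ->
  trivIset `I_n (fun i => `]al i, be i[%classic) ->
  (leb U < d%:E)%E -> \sum_(i < n) (be i - al i) < d.
Proof.
move=> oU H tI Ud; rewrite -lte_fin; apply: le_lt_trans Ud.
rewrite -sumEFin (eq_bigr (fun i : 'I_n => leb `]al i, be i[)).
  rewrite -(@measure_semi_additive_ord_I _ _ _ leb (fun i => `]al i, be i[%classic))//.
    apply: le_measure; rewrite ?inE.
    - exact: bigsetU_measurable.
    - exact: open_measurable.
    - by rewrite -(bigcup_mkord n (fun i => `]al i, be i[%classic)) => x [i /= /H[_]]; exact.
  exact: bigsetU_measurable.
move=> i _; rewrite lebesgue_measure_itv/= lte_fin.
have [+ _] := H _ (ltn_ord i).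
by rewrite le_eqVlt => /predU1P[->|->]; rewrite ?ltxx ?subrr// EFinB.
Qed.

(* A creeping argument from a to b: near a point where the derivative exists and is
   nonpositive the increments of f are controlled by e, and near a point of the exceptional
   null set they are charged to disjoint intervals of an open set of small measure. *)
Lemma abs_continuous_nincr f : locally_abs_continuous f ->
  {ae leb, forall t, 0 <= t -> derivable f t 1 /\ derive1 f t <= 0} ->
  forall a b, 0 <= a -> a <= b -> f b <= f a.
Proof.
move=> acf aef a b a0 ab.
have [b0|b0] := eqVneq b 0; first by have -> : a = b by lra.
apply/ler_addgt0Pr => e0 e0_gt0.
pose e := e0 / (b - a + 1).
have ba1 : 0 < b - a + 1 by lra.
have e_gt0 : 0 < e by rewrite divr_gt0.
have b_gt0 : 0 < b by rewrite lt_neqAle eq_sym b0 (le_trans a0).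
have [d d0 acd] := acf b b_gt0 e e_gt0.
have [U [oU ZU Ud]] := null_set_cover d0 aef.
(* The increment of f up to x is split into a part of slope e and a part carried by finitely many
   disjoint intervals inside U. At x = b, absolute continuity makes the second part less than e, as
   U has measure less than d. *)
pose ok x := exists n (al be : nat -> R),
  [/\ forall i, (i < n)%N -> [/\ a <= al i, al i <= be i, be i <= x & `]al i, be i[ `<=` U],
      trivIset `I_n (fun i => `]al i, be i[%classic) &
      f x - f a <= e * (x - a) + \sum_(i < n) `|f (be i) - f (al i)|].
suff [n [al [be [H tI fb]]]] : ok b.
  have : \sum_(i < n) `|f (be i) - f (al i)| < e.
    apply: acd => //.
      by move=> i /H[? ? ? _]; split; [exact: le_trans a0 _|].
    apply: (@disjoint_itv_length _ _ _ U) => //.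
    by move=> i /H[].
  have : e0 = e * (b - a) + e by rewrite /e; field; rewrite gt_eqF.
  lra.
have creep x y : a <= x -> x <= y -> ok x ->
    f y - f x <= e * (y - x) \/ `]x, y[ `<=` U -> ok y.
  move=> ax xy [n [al [be [H tI fx]]]] [fxy|xyU].
    exists n, al, be; split => //; last by lra.
    by move=> i /H[? ? ? ?]; split => //; exact: le_trans xy.
  exists n.+1, (fun i => if (i < n)%N then al i else x),
    (fun i => if (i < n)%N then be i else y); split.
  - by move=> i _; case: ifPn => [/H[? ? ? ?]|_]; split => //; exact: le_trans xy.
  - apply/trivIsetP => i j /= ilt jlt ij.
    have dis l : (l < n)%N -> `]al l, be l[ `&` `]x, y[ = set0 :> set R.
      move=> /H[_ _ bx _]; apply/seteqP; split => // z [] /=.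
      by rewrite !in_itv/= => /andP[_ ?] /andP[? _]; lra.
    case: ifPn => [iln|inn]; case: ifPn => [jln|jnn].
    + by move/trivIsetP : tI; apply.
    + exact: dis.
    + by rewrite setIC; exact: dis.
    + move: inn jnn ilt jlt ij; rewrite -!leqNgt !ltnS => ni nj i_n j_n.
      have -> : i = n by apply/eqP; rewrite eqn_leq i_n.
      by have -> : j = n by [apply/eqP; rewrite eqn_leq j_n]; rewrite eqxx.
  - rewrite big_ord_recr/= ltnn; under eq_bigr => i _ do rewrite ltn_ord.
    have := ler_norm (f y - f x); have : 0 <= e * (y - x) by rewrite mulr_ge0 ?subr_ge0// ltW.
    lra.
(* The derivative at c compares f x and f y only when x <= c <= y. The step at the supremum below
   therefore starts from a point at or before c and jumps across it. *)
have local c : a <= c -> exists2 r, 0 < r & forall x y, c - r < x -> x <= c -> c <= y -> y < c + r ->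
    f y - f x <= e * (y - x) \/ `]x, y[ `<=` U.
  move=> ac; have [Uc|Uc] := pselect (U c).
    have /nbhs_ballP[r /= r0 Hr] : nbhs c U by apply: open_nbhs_nbhs.
    exists r => // x y cx xc cy yc; right => z /=; rewrite in_itv/= => /andP[xz zy].
    apply: Hr; rewrite /ball/= ltr_norml; apply/andP; split; lra.
  have [df df0] : derivable f c 1 /\ derive1 f c <= 0.
    apply: contrapT => N; apply: Uc; apply: ZU => /= H; apply: N; apply: H.
    exact: le_trans ac.
  have Dc : is_derive c (1 : R) f (derive1 f c) by apply: DeriveDef => //; rewrite derive1E.
  have /cvgrPdist_lt/(_ _ e_gt0) := is_derive_quotientP Dc.
  rewrite /dnbhs near_withinE => /nbhs_ballP[r /= r0 Hr].
  exists r => // x y cx xc cy yc; left.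
  have q h : h != 0 -> `|h| < r -> h^-1 * (f (h + c) - f c) <= e.
    move=> h0 hr; have := Hr h; rewrite /ball/= sub0r normrN => /(_ hr h0).
    rewrite ltr_norml; lra.
  have fy : f y - f c <= e * (y - c).
    move: cy; rewrite le_eqVlt => /predU1P[->|cy]; first by rewrite !subrr mulr0.
    have yc0 : 0 < y - c by lra.
    have := q (y - c); rewrite subrK gt_eqF// => /(_ isT).
    rewrite gtr0_norm// ler_pdivrMl// mulrC; apply; lra.
  have fx : f c - f x <= e * (c - x).
    move: xc; rewrite le_eqVlt => /predU1P[->|xc]; first by rewrite !subrr mulr0.
    have xc0 : x - c < 0 by lra.
    have := q (x - c); rewrite subrK lt_eqF// => /(_ isT).
    rewrite ltr0_norm// ler_ndivrMl// mulrC => H.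
    by have := H ltac:(lra); lra.
  lra.
have oka : ok a.
  exists 0%N, (fun=> 0), (fun=> 0); split => //; last by rewrite !subrr mulr0 big_ord0 addr0.
pose S := [set x | a <= x <= b /\ ok x].
have Sa : S a by split => //; rewrite lexx.
have supS : has_sup S.
  by split; [exists a|exists b => x [/andP[]]].
pose c := sup S.
have ac : a <= c by apply: sup_upper_bound.
have cb : c <= b by apply: ge_sup; [exists a|move=> x [/andP[]]].
have [r r0 Hr] := local c ac.
have [x [/andP[ax xb] okx] cx] := sup_adherent r0 supS.
have xc : x <= c by apply: sup_upper_bound => //; split => //; exact/andP.
(* Unless y is already b, it lies strictly beyond the supremum c, which is impossible for a point of
   S. *)
pose y := Num.min b (c + r / 2).
have cy : c <= y by rewrite le_min cb lerDl divr_ge0 ?ltW.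
have yb : y <= b by rewrite ge_min lexx.
have yr : y <= c + r / 2 by rewrite ge_min lexx orbT.
have xy := le_trans xc cy.
have oky : ok y by apply: creep okx _ => //; apply: Hr => //; lra.
have : y <= c.
  by apply: sup_upper_bound => //; split => //; rewrite yb (le_trans ax).
rewrite ge_min => /orP[bc|]; last by lra.
have -> // : b = y by apply/eqP; rewrite eq_le yb (le_trans bc cy).
Qed.

Lemma abs_continuous_cvg f : locally_abs_continuous f -> continuous (f \o rho).
Proof.
move=> acf t; apply/cvgrPdist_lt => e e0.
have T0 : 0 < rho t + 1 by rewrite ltr_wpDl ?rho_ge0.
have [d d0 H] := acf _ T0 _ e0.
have step x y : 0 <= x -> x <= y -> y <= rho t + 1 -> y - x < d -> `|f y - f x| < e.
  move=> x0 xy yT xyd; have := H 1%N (fun=> x) (fun=> y).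
  rewrite !big_ord1; apply => //.
  by apply/trivIsetP => i j /=; rewrite !ltnS !leqn0 => /eqP -> /eqP ->; rewrite eqxx.
have /cvgrPdist_lt/(_ _ d0) H1 := @rho_continuous R t.
have /cvgrPdist_lt/(_ _ ltr01) H2 := @rho_continuous R t.
near=> s.
have s1 : `|rho t - rho s| < d by near: s.
have s2 : `|rho t - rho s| < 1 by near: s.
have := rho_ge0 s; have := rho_ge0 t; move: s1 s2; rewrite /= !ltr_norml.
move=> /andP[? ?] /andP[? ?] t0 s0.
have [st|/ltW st] := leP (rho s) (rho t).
  by rewrite -ltr_norml; apply: step => //; lra.
by rewrite -ltr_norml distrC; apply: step => //; lra.
Unshelve. all: by end_near. Qed.

(** On [0, T] the exponential is bounded by B and Lipschitz with constant B eta, and k is bounded by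
    some M. The product rule for increments then splits e into two halves. *)
Lemma abs_continuous_expM (eta : R) k : 0 < eta -> locally_abs_continuous k ->
  (forall t, 0 <= t -> 0 <= k t) -> locally_abs_continuous (fun t => expR (eta * t) * k t).
Proof.
move=> eta0 ack k0 T T0 e e0.
have [M M0 kM] : exists2 M, 0 < M & forall t, 0 <= t <= T -> k t <= M.
  have ck : {within `[0, T], continuous (k \o rho)}.
    by apply: continuous_subspaceT; exact: abs_continuous_cvg.
  have [c _ Hc] := EVT_max (ltW T0) ck.
  exists (k (rho c) + 1); first by rewrite ltr_wpDl// k0// rho_ge0.
  move=> t /andP[t0 tT]; have := Hc t; rewrite in_itv/= t0 tT /= rho_id// => /(_ isT); lra.
pose B := expR (eta * T).
have B0 : 0 < B by exact: expR_gt0.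
have expB s : s <= T -> expR (eta * s) <= B by move=> sT; rewrite ler_expR ler_pM2l.
have explip a b : a <= b -> b <= T -> expR (eta * b) - expR (eta * a) <= B * eta * (b - a).
  move=> ab bT.
  have : 1 - expR (- (eta * (b - a))) <= eta * (b - a).
    have := expR_ge1Dx (- (eta * (b - a))); lra.
  have -> : expR (eta * a) = expR (eta * b) * expR (- (eta * (b - a))).
    by rewrite -expRD; congr expR; ring.
  move=> H; rewrite -[X in X - _]mulr1 -mulrBr.
  apply: (le_trans (ler_wpM2l (expR_ge0 _) H)); rewrite -[leRHS]mulrA ler_wpM2r ?expB//.
  by rewrite mulr_ge0 ?subr_ge0// ltW.
have e2 : 0 < e / (2 * B) by rewrite divr_gt0// mulr_gt0.
have [d d0 Hd] := ack T T0 _ e2.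
pose L := M * (B * eta).
have L0 : 0 < L by rewrite !mulr_gt0.
exists (Num.min d (e / (2 * L))); first by rewrite lt_min d0 divr_gt0// mulr_gt0.
move=> n a b H tI; rewrite lt_min => /andP[sd sL].
have S1 := Hd n a b H tI sd.
apply: (@le_lt_trans _ _ (B * (\sum_(i < n) `|k (b i) - k (a i)|) + L * \sum_(i < n) (b i - a i))).
  rewrite !mulr_sumr -big_split/=; apply: ler_sum => i _.
  have [a0 [ab bT]] := H i (ltn_ord i).
  have b0 := le_trans a0 ab; have aT := le_trans ab bT.
  have -> : expR (eta * b i) * k (b i) - expR (eta * a i) * k (a i) =
    expR (eta * a i) * (k (b i) - k (a i)) + k (b i) * (expR (eta * b i) - expR (eta * a i)) by ring.
  apply: (le_trans (ler_normD _ _)); rewrite !normrM lerD//.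
    by rewrite ger0_norm ?expR_ge0// ler_wpM2r// expB.
  rewrite (ger0_norm (k0 _ b0)) ger0_norm ?subr_ge0 ?ler_expR ?ler_wpM2l ?(ltW eta0)//.
  rewrite /L -mulrA ler_pM ?k0 ?subr_ge0 ?ler_expR ?ler_wpM2l ?(ltW eta0)// ?explip//.
  by rewrite kM// b0.
have : B * (\sum_(i < n) `|k (b i) - k (a i)|) < e / 2.
  by move: S1; rewrite invfM mulrA ltr_pdivlMr// mulrC.
have : L * \sum_(i < n) (b i - a i) < e / 2.
  by move: sL; rewrite invfM mulrA ltr_pdivlMr// mulrC.
lra.
Qed.

(** Integrating factor: e^(eta t) k(t) is absolutely continuous with nonpositive derivative almost
    everywhere, hence nonincreasing by [abs_continuous_nincr]. *)
Lemma abs_continuous_exp_decay (eta : R) k : 0 < eta -> locally_abs_continuous k ->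
  (forall t, 0 <= t -> 0 <= k t) ->
  {ae leb, forall t, 0 <= t -> derivable k t 1 /\ derive1 k t <= - eta * k t} ->
  forall t h, 0 <= t -> 0 <= h -> k (t + h) <= expR (- (eta * h)) * k t.
Proof.
move=> eta0 ack k0 aek t h t0 h0.
have := abs_continuous_nincr (abs_continuous_expM eta0 ack k0).
have H : {ae leb, forall t, 0 <= t -> derivable (fun t => expR (eta * t) * k t) t 1 /\
    derive1 (fun t => expR (eta * t) * k t) t <= 0}.
  apply: (@filterS _ _ (ae_filter_ringOfSetsType leb) _ _ _ aek) => x H x0; have [dk kx] := H x0.
  have D1 : is_derive x (1 : R) k (derive1 k x) by apply: DeriveDef => //; rewrite derive1E.
  have D2 : is_derive x (1 : R) (fun t => expR (eta * t)) (expR (eta * x) * eta).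
    have De : is_derive x (1 : R) (fun t => eta * t) eta.
      by have := is_derive_lin eta 0 (is_derive_id x (1 : R)) (is_derive_id x (1 : R));
        rewrite mulr1 mul0r addr0; under eq_fun do rewrite mul0r addr0.
    exact: (@is_derive1_comp _ expR (fun t => eta * t)).
  have D := is_derive_mul D2 D1.
  split; first exact: ex_derive.
  rewrite derive1E derive_val.
  have : expR (eta * x) * derive1 k x <= expR (eta * x) * (- eta * k x).
    by rewrite ler_wpM2l ?expR_ge0.
  lra.
move=> /(_ H t (t + h) t0); rewrite lerDl => /(_ h0) H1.
have -> : k (t + h) = expR (- (eta * (t + h))) * (expR (eta * (t + h)) * k (t + h)).
  by rewrite mulrA -expRD addNr expR0 mul1r.
apply: (le_trans (ler_wpM2l (expR_ge0 _) H1)).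
rewrite mulrA -expRD ler_wpM2r ?k0// ler_expR; lra.
Qed.

(** Beyond t the kernel is below k(t) e^(-eta (s - t)), whose integral is at most k(t) / eta.
    Comparison with the total mass 1 gives the second bound. *)
Lemma exp_decay_tail (eta : R) k : 0 < eta -> continuous k -> (forall t, 0 <= k t) ->
  (forall t h, 0 <= t -> 0 <= h -> k (t + h) <= expR (- (eta * h)) * k t) ->
  (\int[leb]_(t in `[0%R, +oo[) (k t)%:E = 1)%E ->
  forall t, 0 <= t -> kmass k t <= 1 /\ eta * (1 - kmass k t) <= k t.
Proof.
move=> eta0 ck k0 kd k1 t t0.
have kint T : (\int[leb]_(s in `[0%R, T]) (k s)%:E)%E = (\int[leb]_(s in `[0%R, T]) k s)%:E.
  rewrite /Rintegral fineK//; apply: integrable_fin_num => //.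
  exact: continuous_integrable_itv.
have mk : measurable_fun setT k by apply: continuous_measurable_fun.
have le1 T : \int[leb]_(s in `[0%R, T]) k s <= 1.
  rewrite -lee_fin -kint -k1; apply: ge0_subset_integral => //.
  - by apply/measurable_EFinP; apply: measurable_funS mk.
  - by move=> x _; rewrite lee_fin.
  - by apply: subset_itvl; rewrite bnd_simp.
have tail T : 0 <= T -> \int[leb]_(s in `[0%R, T]) k s <= kmass k t + k t / eta.
  move=> T0; have [Tt|tT] := leP T t.
    rewrite /kmass rho_id// (Rintegral_split T0 Tt ck) -addrA lerDl addr_ge0//.
      by apply: Rintegral_ge0 => s _.
    by rewrite divr_ge0// ltW.
  rewrite (Rintegral_split t0 (ltW tT) ck) /kmass rho_id// lerD2l.
  pose F s := - (k t / eta) * expR (eta * (t - s)).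
  pose f s := k t * expR (eta * (t - s)).
  have dF s : t <= s <= T -> is_derive s (1 : R) F (f s).
    move=> _.
    have De : is_derive s (1 : R) (fun s => eta * (t - s)) (- eta).
      have := is_derive_lin eta 0 (is_derive_flip (f := id) (is_derive_id (t - s) (1 : R)))
        (is_derive_id s (1 : R)).
      by rewrite mulrN1 mul0r addr0; under eq_fun do rewrite mul0r addr0.
    have De2 := @is_derive1_comp _ expR _ s _ _ (is_derive_expR _) De.
    have := is_derive_lin (- (k t / eta)) 0 De2 (is_derive_id s (1 : R)).
    rewrite mul0r addr0; under eq_fun do rewrite mul0r addr0.
    set x := (X in is_derive _ _ _ X -> _); suff -> : x = f s by [].
    by rewrite /x /f; field; rewrite gt_eqF.
  have cf : continuous f.
    move=> s; apply: cvgM; first exact: cvg_cst.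
    apply: (cvg_comp (fun s => eta * (t - s)) expR); last exact: continuous_expR.
    by apply: cvgM; [exact: cvg_cst|apply: cvgB; [exact: cvg_cst|exact: cvg_id]].
  apply: (@le_trans _ _ (\int[leb]_(s in `[t, T]) f s)).
    apply: le_Rintegral_itv => // s /andP[ts sT]; rewrite /f.
    have := kd t (s - t) t0; rewrite subr_ge0 => /(_ ts); rewrite addrC subrK mulrC.
    by move/le_trans; apply; rewrite ler_wpM2l// ler_expR; lra.
  rewrite (Rintegral_derive (ltW tT) cf dF) /F subrr mulr0 expR0.
  have : 0 <= k t / eta * expR (eta * (t - T)).
    by rewrite mulr_ge0 ?expR_ge0// divr_ge0// ltW.
  lra.
split; first by rewrite /kmass.
suff : 1 <= kmass k t + k t / eta.
  move=> H; rewrite mulrC -ler_pdivlMr//; lra.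
(* The half-line is exhausted by the intervals [0, n], on each of which [tail] applies. *)
rewrite -lee_fin -k1 itv_bndy_bigcup_BRight.
have H : (\int[leb]_(x in `[0%R, (0 + n%:R)%R]) (k x)%:E @[n --> \oo] -->
    \int[leb]_(x in \bigcup_i `[0%R, (0 + i%:R)%R]%classic) (k x)%:E)%E.
  apply: ge0_nondecreasing_set_cvg_integral => //.
  - apply/nondecreasing_seqP => n; rewrite subsetEset; apply: subset_itvl.
    by rewrite bnd_simp lerD2l ler_nat.
  - by move=> n; apply/measurable_EFinP; apply: measurable_funS mk.
  - by move=> n x _; rewrite lee_fin.
rewrite -(cvg_lim _ H)//; apply: lime_le; first by apply/cvg_ex; eexists; exact: H.
by apply: nearW => n; rewrite kint lee_fin tail// add0r.
Qed.

End absolutely_continuous.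

(** * Lebesgue measure on row vectors and the Poincare inequality *)

Section rV_measurability.
Context {R : realType} {n : nat}.
Implicit Types (U : set 'rV[R]_n) (f : 'rV[R]_n -> R).

Lemma measurable_ball_rV (x : 'rV[R]_n) (e : R) : measurable (ball x e).
Proof.
have [e0|e0] := ltP 0 e; last first.
  rewrite (_ : ball x e = set0) ?measurable0//.
  by apply/seteqP; split => // y []; rewrite ltNge e0.
rewrite [X in measurable X](_ : _ = \bigcap_(i in [set: 'I_n])
    (coord_rV i @^-1` ball (x 0 i) e)).
  apply: fin_bigcap_measurable => // i _; rewrite -[X in measurable X]setTI.
  by apply: measurable_coord_rV => //; apply: open_measurable; exact: ball_open.
apply/seteqP; split => y.
  by move=> [_ Hy] i _; exact: Hy.
by move=> Hy; split => // i j; rewrite (ord1 i); exact: Hy.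
Qed.

(** The sigma-algebra is generated by coordinates, so the link to the topology is a countable base:
    balls with rational centre and radius 1/(m+1), which are finite intersections of coordinate
    conditions. *)
Lemma open_measurable_rV U : open U -> measurable U.
Proof.
move=> oU.
pose B (p : 'rV[rat]_n * nat) := ball (map_mx ratr p.1 : 'rV[R]_n) (p.2.+1%:R^-1 : R).
(* The union over all pairs is indexed by naturals through [unpickle]; codes that name no ball
   inside U contribute the empty set. *)
pose F (m : nat) := if unpickle m is Some p then
   (if pselect (B p `<=` U) then B p else set0) else set0.
have -> : U = \bigcup_m F m.
  apply/seteqP; split => [x Ux|x [m _]]; last first.
    by rewrite /F; case: unpickle => [p|//]; case: pselect => // BU; exact: BU.
  have /nbhs_ballP[e /= e0 xU] : nbhs x U by apply: open_nbhs_nbhs.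
  have [m me] : exists m : nat, (m.+1%:R^-1 : R) < e / 2.
    have e2 : 0 < e / 2 by rewrite divr_gt0.
    exists (Num.truncn (e / 2)^-1); rewrite invf_plt ?posrE//.
    by rewrite truncnS_gt.
  have m0 : 0 < (m.+1%:R^-1 : R) by rewrite invr_gt0.
  have /choice[q Hq] : forall i : 'I_n, exists q : rat,
      ratr q \in `](x 0 i - m.+1%:R^-1), (x 0 i + m.+1%:R^-1)[.
    by move=> i; apply: rat_in_itvoo; rewrite ltrD2l (lt_trans _ m0)// oppr_lt0.
  pose p : 'rV[rat]_n * nat := (\row_i q i, m).
  have xB : B p x.
    split => // i j; rewrite (ord1 i) !mxE /ball/=.
    have := Hq j; rewrite in_itv/= ltr_norml; move: (m.+1%:R^-1) => w /andP[? ?].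
    by apply/andP; split; lra.
  have BU : B p `<=` U.
    move=> y Hy; apply: xU; apply: (@le_ball _ _ _ (m.+1%:R^-1 + m.+1%:R^-1)).
      by move: me; move: (m.+1%:R^-1) => w; lra.
    by apply: ball_triangle Hy; apply: ball_sym.
  by exists (pickle p) => //; rewrite /F pickleK; case: pselect.
apply: bigcup_measurable => m _; rewrite /F.
case: unpickle => [p|]; last exact: measurable0.
by case: pselect => ? /=; [exact: measurable_ball_rV|exact: measurable0].
Qed.

Lemma continuous_measurable_rV f : continuous f -> measurable_fun setT f.
Proof.
move=> /continuousP cf.
apply: (@measurability _ _ _ (measurableTypeR R) _ f _ (RGenOInfty.measurableE R)).
move=> _ [_ [a ->] <-]; rewrite setTI; apply: open_measurable_rV.
by apply: cf; exact: rray_open.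
Qed.

End rV_measurability.

(** * The Poincare inequality on slices in the first coordinate *)

Section poincare.
Context {R : realType}.
Local Notation leb := (@lebesgue_measure R).

(** The integral of (s g^2)' = g^2 + 2 s g g' vanishes, and (2 s g' + g)^2 >= 0 gives 2 s g g' >= -
    g^2 / 2 - 2 s^2 g'^2, with s^2 <= M^2. *)
Lemma poincare1 (g dg : R -> R) (M : R) : 0 < M -> continuous dg ->
  (forall s, is_derive s (1 : R) g (dg s)) -> g M = 0 -> g (- M) = 0 ->
  \int[leb]_(s in `[(- M), M]) (g s ^+ 2) <=
    4 * M ^+ 2 * \int[leb]_(s in `[(- M), M]) (dg s ^+ 2).
Proof.
move=> M0 cdg dgP gM gNM.
have MM : - M <= M by lra.
have cg : continuous g.
  move=> s; apply/differentiable_continuous/derivable1_diffP.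
  exact: (@ex_derive _ _ _ _ _ _ _ (dgP s)).
have csq (h : R -> R) : continuous h -> continuous (fun s => h s ^+ 2).
  by move=> ch s; rewrite /continuous_at; under eq_fun do rewrite expr2; apply: cvgM; exact: ch.
pose F s := s * (g s * g s).
pose f s := s * (g s * dg s + g s * dg s) + g s * g s * 1.
have dF s : - M <= s <= M -> is_derive s (1 : R) F (f s).
  by move=> _; have := is_derive_mul (is_derive_id s (1 : R)) (is_derive_mul (dgP s) (dgP s)).
have cf : continuous f.
  move=> s; apply: cvgD.
    apply: cvgM; first exact: cvg_id.
    by apply: cvgD; apply: cvgM; by [exact: cg|exact: cdg].
  by apply: cvgM; [apply: cvgM; exact: cg|exact: cvg_cst].
have := Rintegral_derive MM cf dF.
rewrite /F gM gNM !mulr0 subrr => I0.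
have c1 := csq _ cg; have c2 := csq _ cdg.
have cb : continuous (fun s => 2^-1 * g s ^+ 2 - 2 * M ^+ 2 * dg s ^+ 2).
  by move=> s; apply: cvgB; apply: cvgM; by [exact: cvg_cst|exact: c1|exact: c2].
have : \int[leb]_(s in `[(- M), M]) (2^-1 * g s ^+ 2 - 2 * M ^+ 2 * dg s ^+ 2) <=
    \int[leb]_(s in `[(- M), M]) f s.
  apply: le_Rintegral_itv => // s /andP[s1 s2]; rewrite /f.
  have : 0 <= (M ^+ 2 - s ^+ 2) * dg s ^+ 2.
    rewrite mulr_ge0 ?sqr_ge0// subr_sqr mulr_ge0//; lra.
  have : 0 <= (2 * s * dg s + g s) ^+ 2 by exact: sqr_ge0.
  rewrite !expr2; lra.
rewrite I0 RintegralB//; last 2 first.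
- apply: (@continuous_integrable_itv _ (fun s => 2^-1 * g s ^+ 2)).
  by move=> s; apply: cvgM; [exact: cvg_cst|exact: c1].
- apply: (@continuous_integrable_itv _ (fun s => 2 * M ^+ 2 * dg s ^+ 2)).
  by move=> s; apply: cvgM; [exact: cvg_cst|exact: c2].
rewrite !RintegralZl//; [lra|exact: continuous_integrable_itv..].
Qed.

Lemma cons_rV_shift (n : nat) (y : 'rV[R]_n) (h s : R) :
  cons_rV (h + s, y) = h *: delta_mx 0 0 + cons_rV (s, y).
Proof.
apply/rowP => j; rewrite [RHS]mxE [X in _ = X + _]mxE [X in _ = _ * X + _]mxE.
case: (unliftP ord0 j) => [i ->|->].
  by rewrite !cons_rVS eq_sym (negPf (neq_lift _ _)) andbF mulr0 add0r.
by rewrite !cons_rV0 !eqxx mulr1.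
Qed.

(** [lebesgue_rV] in dimension n + 1 is a pushforward of a product, so Tonelli reduces the claim to
    [poincare1] on each line parallel to the first axis, outside of whose segment [-M, M] the slice
    vanishes. *)
Lemma poincare_rV (n : nat) (f : 'rV[R]_n.+1 -> R) (M : R) : 0 < M ->
  continuous f -> continuous (partial 0 f) ->
  (forall x, derivable f x (delta_mx 0 0)) ->
  (forall x : 'rV[R]_n.+1, M <= `|x 0 0| -> f x = 0) ->
  (\int[lebesgue_rV R n.+1]_x (f x ^+ 2)%:E <=
   (4 * M ^+ 2)%:E * \int[lebesgue_rV R n.+1]_x (partial 0 f x ^+ 2)%:E)%E.
Proof.
move=> M0 cf cpf df f0.
have msq (g : 'rV[R]_n.+1 -> R) : continuous g ->
    measurable_fun setT (fun x => (g x ^+ 2)%:E).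
  move=> cg; apply/measurable_EFinP.
  apply: (@measurable_funX _ _ _ setT g 2); exact: continuous_measurable_rV.
have mcsq (g : 'rV[R]_n.+1 -> R) : continuous g ->
    measurable_fun setT (fun p : measurableTypeR R * 'rV[R]_n => (g (cons_rV p) ^+ 2)%:E).
  by move=> cg; apply: (measurableT_comp (msq g cg)); exact: measurable_cons_rV.
have sq0 (g : 'rV[R]_n.+1 -> R) p : (0 <= (g (cons_rV p) ^+ 2)%:E)%E.
  by rewrite lee_fin sqr_ge0.
have E (g : 'rV[R]_n.+1 -> R) : continuous g ->
  (\int[lebesgue_rV R n.+1]_x (g x ^+ 2)%:E =
    \int[lebesgue_rV R n]_y \int[leb]_s (g (cons_rV (s, y)) ^+ 2)%:E)%E.
  move=> cg /=.
  rewrite [LHS](ge0_integral_pushforward (@measurable_cons_rV R n) _ _ (msq g cg))//=; last first.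
    by move=> x _; rewrite lee_fin sqr_ge0.
  rewrite preimage_setT fubini_tonelli1//.
    apply: (fubini_tonelli (fun p : measurableTypeR R * 'rV[R]_n => (g (cons_rV p) ^+ 2)%:E)) => //.
    exact: mcsq.
  exact: mcsq.
rewrite !E//.
have mG (g : 'rV[R]_n.+1 -> R) : continuous g ->
    measurable_fun setT (fun y => (\int[leb]_s (g (cons_rV (s, y)) ^+ 2)%:E)%E).
  move=> cg.
  exact: (@measurable_fun_fubini_tonelli_G _ _ _ _ _ leb _ (mcsq g cg)).
rewrite -ge0_integralZl//; last 3 first.
- exact: mG.
- by move=> y _; apply: integral_ge0.
- by rewrite lee_fin mulr_ge0 ?sqr_ge0.
apply: ge0_le_integral => //.
- by move=> y _; apply: integral_ge0.
- exact: mG.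
- by apply: measurable_funeM; exact: mG.
move=> y _.
pose g s := f (cons_rV (s, y)); pose dg s := partial 0 f (cons_rV (s, y)).
have ccons : continuous (fun s : R => cons_rV (s, y)).
  move=> s; rewrite /continuous_at [X in X @ _ --> _](_ : _ =
    (fun t : R => (t - s) *: delta_mx 0 0 + cons_rV (s, y))); last first.
    by apply/funext => t; rewrite -cons_rV_shift subrK.
  rewrite [X in _ --> X](_ : _ = (s - s) *: delta_mx 0 0 + cons_rV (s, y)); last first.
    by rewrite subrr scale0r add0r.
  apply: cvgD; last exact: cvg_cst.
  by apply: cvgZr_tmp; apply: cvgB; [exact: cvg_id|exact: cvg_cst].
have dgP s : is_derive s (1 : R) g (dg s).
  apply: is_derive_quotient.
  have := df (cons_rV (s, y)).
  rewrite /dg /partial /derivable /derive.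
  set q := fun h => _; have -> : (fun h => h^-1 * (g (h + s) - g s)) = q.
    by apply/funext => h; rewrite /g cons_rV_shift.
  by move=> /cvg_ex[l Hl]; rewrite (cvg_lim _ Hl).
have cdg : continuous dg.
  by move=> s; apply: (cvg_comp (fun s : R => cons_rV (s, y)) (partial 0 f)); [exact: ccons|exact: cpf].
have g0 s : M <= `|s| -> g s = 0 by move=> Ms; apply: f0; rewrite cons_rV0.
have gM : g M = 0 by apply: g0; rewrite gtr0_norm.
have gNM : g (- M) = 0 by apply: g0; rewrite normrN gtr0_norm.
have P := poincare1 M0 cdg dgP gM gNM.
have cg : continuous g.
  by move=> s; apply: (cvg_comp (fun s : R => cons_rV (s, y)) f); [exact: ccons|exact: cf].
have csq (h : R -> R) : continuous h -> continuous (fun s => h s ^+ 2).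
  by move=> ch s; rewrite /continuous_at; under eq_fun do rewrite expr2; apply: cvgM; exact: ch.
have kint (h : R -> R) : continuous h ->
    ((\int[leb]_(s in `[(- M)%R, M]) h s)%:E = \int[leb]_(s in `[(- M)%R, M]) (h s)%:E)%E.
  move=> ch; rewrite /Rintegral fineK//; apply: integrable_fin_num => //.
  exact: continuous_integrable_itv.
apply: (@le_trans _ _ (\int[leb]_(s in `[(- M)%R, M]) (g s ^+ 2)%:E)%E).
  rewrite [leRHS]integral_mkcond; apply: ge0_le_integral => //.
  - by apply/measurable_EFinP; apply: continuous_measurable_fun; exact: csq.
  - apply/(measurable_restrictT _ _).1 => //.
    by apply/measurable_EFinP; apply: measurable_funTS; apply: continuous_measurable_fun; exact: csq.
  - move=> s _; rewrite patchE; case: ifPn => // /negP sM; rewrite -/(g s) g0 ?expr0n//.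
    rewrite leNgt; apply/negP => sM'; apply: sM; rewrite inE/= in_itv/=.
    by move: sM'; rewrite ltr_norml => /andP[/ltW -> /ltW ->].
rewrite -kint; last exact: csq.
apply: (@le_trans _ _ ((4 * M ^+ 2)%:E * (\int[leb]_(s in `[(- M)%R, M]) (dg s ^+ 2))%:E)%E).
  by rewrite -EFinM lee_fin.
apply: lee_wpmul2l; first by rewrite lee_fin mulr_ge0 ?sqr_ge0.
rewrite kint; last exact: csq.
apply: ge0_subset_integral => //.
- by apply/measurable_EFinP; apply: continuous_measurable_fun; exact: csq.
- by move=> s _; rewrite lee_fin sqr_ge0.
Qed.

End poincare.

(** * The real inner product on L^2 and its convergence properties *)

Section L2_inner_product.
Context {R : realType} {N : nat}.
Variable Omega : set 'rV[R]_N.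
Hypothesis mO : measurable Omega.
Local Notation mu := (lebesgue_rV R N).
Implicit Types (f g h : 'rV[R]_N -> R) (e a : R).

Definition ip f g : R := \int[mu]_(x in Omega) (f x * g x).

(** Replaces membership of the extension by zero in [Lfun] by two conditions on Omega that can be
    checked directly. *)
Lemma L2P f : L2 Omega f <->
  measurable_fun Omega f /\ (\int[mu]_(x in Omega) (f x ^+ 2)%:E < +oo)%E.
Proof.
have E : (\int[mu]_x (`|(f \_ Omega) x| ^+ 2)%:E = \int[mu]_(x in Omega) (f x ^+ 2)%:E)%E.
  rewrite [RHS]integral_mkcond; apply: eq_integral => x _; rewrite !patchE.
  by case: ifPn => _; [rewrite real_normK ?num_real|rewrite (_ : point = 0 :> R)// normr0 expr0n].
split.
  move=> Lf; split.
    by move: Lf => /andP[]; rewrite !inE/= => mf _; apply/(measurable_restrictT _ mO).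
  have /integrableP[_] := Lfun2_integrable_sqr Lf; rewrite -E; apply: le_lt_trans.
  rewrite le_eqVlt; apply/orP; left; apply/eqP; apply: eq_integral => x _ /=.
  by rewrite normrX.
move=> [mf foo]; apply/andP; rewrite !inE/=; split; first by apply/(measurable_restrictT _ mO).
rewrite /finite_norm unlock; apply: poweR_lty.
under eq_integral do rewrite /= powR_mulrn//.
by rewrite E.
Qed.

Lemma L2_measurable f : L2 Omega f -> measurable_fun Omega f.
Proof. by move=> /L2P[]. Qed.

Lemma L2_integrableM f g : L2 Omega f -> L2 Omega g ->
  mu.-integrable Omega (EFin \o (fun x => f x * g x)).
Proof.
move=> Lf Lg; have := Lfun2_mul_Lfun1 Lf Lg => /Lfun1_integrable H.
apply/(integrable_mkcond _ mO); move: H; congr (_.-integrable _ _).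
by apply/funext => x /=; rewrite !patchE; case: ifPn; rewrite // mulr0.
Qed.

Lemma L2_lin f g a e : L2 Omega f -> L2 Omega g -> L2 Omega (fun x => a * f x + e * g x).
Proof.
move=> Lf Lg; apply/L2P; split.
  by apply: measurable_funD; apply: measurable_funM => //; exact: L2_measurable.
have := integrableD mO
  (integrableD mO (integrableZl mO (a ^+ 2) (L2_integrableM Lf Lf))
     (integrableZl mO (e ^+ 2) (L2_integrableM Lg Lg)))
  (integrableZl mO (2 * a * e) (L2_integrableM Lf Lg)).
move=> /integrableP[_]; apply: le_lt_trans.
rewrite le_eqVlt; apply/orP; left; apply/eqP; apply: eq_integral => x _ /=.
congr (_%:E).
rewrite [X in `|X|](_ : _ = (a * f x + e * g x) ^+ 2); last by ring.
by rewrite ger0_norm ?sqr_ge0.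
Qed.

Lemma L2B f g : L2 Omega f -> L2 Omega g -> L2 Omega (fun x => f x - g x).
Proof.
move=> Lf Lg; have := L2_lin 1 (-1) Lf Lg; congr (L2 _ _).
by apply/funext => x; rewrite mul1r mulN1r.
Qed.

Lemma ipC f g : ip f g = ip g f.
Proof. by apply: eq_Rintegral => x _; rewrite mulrC. Qed.

Lemma ip_ge0 f : 0 <= ip f f.
Proof. by apply: Rintegral_ge0 => x _; rewrite -expr2 sqr_ge0. Qed.

Lemma ip_linl f g h a e : L2 Omega f -> L2 Omega g -> L2 Omega h ->
  ip (fun x => a * f x + e * g x) h = a * ip f h + e * ip g h.
Proof.
move=> Lf Lg Lh.
rewrite /ip -!RintegralZl//; [|exact: L2_integrableM..].
rewrite -RintegralD//; last 2 first.
- by have := integrableZl mO a (L2_integrableM Lf Lh).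
- by have := integrableZl mO e (L2_integrableM Lg Lh).
by apply: eq_Rintegral => x _; ring.
Qed.

Lemma ip_linr f g h a e : L2 Omega f -> L2 Omega g -> L2 Omega h ->
  ip h (fun x => a * f x + e * g x) = a * ip h f + e * ip h g.
Proof. by move=> Lf Lg Lh; rewrite ipC ip_linl// !(ipC _ h). Qed.

Lemma ipBl f g h : L2 Omega f -> L2 Omega g -> L2 Omega h ->
  ip (fun x => f x - g x) h = ip f h - ip g h.
Proof.
move=> Lf Lg Lh; have := ip_linl 1 (-1) Lf Lg Lh; rewrite mul1r mulN1r => <-.
by apply: eq_Rintegral => x _; ring.
Qed.

Lemma ipBr f g h : L2 Omega f -> L2 Omega g -> L2 Omega h ->
  ip h (fun x => f x - g x) = ip h f - ip h g.
Proof. by move=> Lf Lg Lh; rewrite ipC ipBl// !(ipC _ h). Qed.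

(** Expand the square of e f - s g for s = 1 and s = -1 and divide by e. This form serves below in
    place of Cauchy-Schwarz. *)
Lemma ip_young f g e : 0 < e -> L2 Omega f -> L2 Omega g ->
  2 * `|ip f g| <= e * ip f f + e^-1 * ip g g.
Proof.
move=> e0 Lf Lg.
have H s : s ^+ 2 = 1 -> 2 * (s * ip f g) <= e * ip f f + e^-1 * ip g g.
  move=> s1; have L := L2_lin e (- s) Lf Lg.
  have := ip_ge0 (fun x => e * f x + (- s) * g x).
  rewrite ip_linl// !ip_linr// (ipC g f) => H.
  have : 2 * (s * ip f g) * e <= (e * ip f f + e^-1 * ip g g) * e.
    have -> : (e * ip f f + e^-1 * ip g g) * e = e * e * ip f f + ip g g by field; rewrite gt_eqF.
    have : s * s = 1 by rewrite -expr2.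
    by move: H; move: (ip f f) (ip f g) (ip g g) => A B C H ss;
      have : s * s * C = C by [rewrite ss mul1r]; lra.
  by rewrite ler_pM2r.
have m1 : (-1) ^+ 2 = 1 :> R by rewrite sqrrN expr1n.
have := H 1 (expr1n _ _); have := H (-1) m1.
by case: (ler0P (ip f g)) => _; lra.
Qed.

Lemma L2normE f : L2norm Omega f = ((\int[mu]_(x in Omega) (f x ^+ 2)%:E) `^ 2^-1)%E.
Proof.
rewrite /L2norm unlock; congr poweR; rewrite [RHS]integral_mkcond; apply: eq_integral => x _.
rewrite /= !patchE; case: ifPn => _; rewrite /= powR_mulrn//.
  by rewrite real_normK ?num_real.
by rewrite normr0 expr0n.
Qed.

(** The norms take extended real values; finiteness near the limit has to be extracted before real
    convergence makes sense. *)
Lemma cvg_sqrt0 (T : Type) (F : set_system T) {FF : Filter F} (X : T -> \bar R) :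
  (forall s, (0 <= X s)%E) -> ((X s `^ 2^-1)%E @[s --> F] --> 0%E) ->
  (\forall s \near F, X s \is a fin_num) /\ fine (X s) @[s --> F] --> (0 : R).
Proof.
move=> X0 /fine_cvgP[fX cX].
have fin : \forall s \near F, X s \is a fin_num.
  apply: filterS fX => s; rewrite !ge0_fin_numE ?poweR_ge0//.
  by apply: lty_poweRy; rewrite invr_eq0.
split=> //; apply/cvgrPdist_lt => e e0.
have se : 0 < Num.sqrt e by rewrite sqrtr_gt0.
have /cvgrPdist_lt/(_ _ se) H := cX.
near=> s.
have Xf : X s \is a fin_num by near: s.
have : `|0 - fine (X s `^ 2^-1)%E| < Num.sqrt e by near: s.
rewrite !sub0r !normrN fine_poweR powR12_sqrt ?fine_ge0//.
rewrite ger0_norm ?sqrtr_ge0// (ger0_norm (fine_ge0 (X0 s))).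
by rewrite ltr_sqrt.
Unshelve. all: by end_near. Qed.

Lemma cvg_L2norm0 (T : Type) (F : set_system T) {FF : Filter F} (f : T -> 'rV[R]_N -> R) :
  L2norm Omega (f s) @[s --> F] --> 0%E -> ip (f s) (f s) @[s --> F] --> (0 : R).
Proof.
under eq_fun do rewrite L2normE.
move=> /cvg_sqrt0[|_].
  by move=> s; apply: integral_ge0 => x _; rewrite lee_fin sqr_ge0.
by under eq_fun => s do under eq_integral => x _ do rewrite expr2.
Qed.

Lemma ip_cvg (T : Type) (F : set_system T) {FF : Filter F} (f g : T -> 'rV[R]_N -> R) f0 g0 :
  (\forall s \near F, L2 Omega (f s)) -> (\forall s \near F, L2 Omega (g s)) ->
  L2 Omega f0 -> L2 Omega g0 ->
  ip (fun x => f s x - f0 x) (fun x => f s x - f0 x) @[s --> F] --> (0 : R) ->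
  ip (fun x => g s x - g0 x) (fun x => g s x - g0 x) @[s --> F] --> (0 : R) ->
  ip (f s) (g s) @[s --> F] --> ip f0 g0.
Proof.
move=> Lf Lg Lf0 Lg0 cf cg; apply/cvgrPdist_lt => r r0.
pose M := ip f0 f0 + ip g0 g0 + 1.
have M0 : 0 < M by rewrite ltr_wpDl// addr_ge0 ?ip_ge0.
pose e := r / M.
have e0 : 0 < e by rewrite divr_gt0.
have ei0 : 0 < e^-1 by rewrite invr_gt0.
pose d := r / (2 * (1 + e^-1)).
have d0 : 0 < d by rewrite divr_gt0// mulr_gt0// addr_gt0.
have /cvgrPdist_lt/(_ _ d0) cf' := cf; have /cvgrPdist_lt/(_ _ d0) cg' := cg.
near=> s.
have Lfs : L2 Omega (f s) by near: s.
have Lgs : L2 Omega (g s) by near: s.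
have : `|0 - ip (fun x => f s x - f0 x) (fun x => f s x - f0 x)| < d by near: s.
have : `|0 - ip (fun x => g s x - g0 x) (fun x => g s x - g0 x)| < d by near: s.
rewrite !sub0r !normrN !(ger0_norm (ip_ge0 _)).
have La := L2B Lfs Lf0; have Lb := L2B Lgs Lg0.
have -> : ip f0 g0 - ip (f s) (g s) =
  - (ip (fun x => f s x - f0 x) (fun x => g s x - g0 x) +
     ip (fun x => f s x - f0 x) g0 + ip (fun x => g s x - g0 x) f0).
  rewrite (ipBl Lfs Lf0 Lb) !(ipBr Lgs Lg0)// (ipBl Lfs Lf0)// (ipBl Lgs Lg0)//.
  by rewrite (ipC (g s) f0) (ipC g0 f0); ring.
have := ip_young ltr01 La Lb; have := ip_young ei0 La Lg0; have := ip_young ei0 Lb Lf0.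
rewrite invrK invr1 normrN.
set a := ip (fun x => f s x - f0 x) (fun x => f s x - f0 x).
set b := ip (fun x => g s x - g0 x) (fun x => g s x - g0 x).
set x := ip (fun x => g s x - g0 x) f0; set y := ip (fun x => f s x - f0 x) g0.
set z := ip (fun x => f s x - f0 x) (fun x => g s x - g0 x) => H1 H2 H3 ad bd.
have : (1 + e^-1) * (a + b) <= (1 + e^-1) * (2 * d) by rewrite ler_pM2l ?addr_gt0//; lra.
have -> : (1 + e^-1) * (2 * d) = r.
  have <- : d * (2 * (1 + e^-1)) = r by rewrite divfK// gt_eqF// mulr_gt0// addr_gt0.
  ring.
have : e * M = r by rewrite /e divfK// gt_eqF.
have := ler_normD (z + y) x; have := ler_normD z y.
rewrite /M; lra.
Unshelve. all: by end_near. Qed.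

Lemma L2_of_sum f (Df : 'rV[R]_N -> 'rV[R]_N) :
  measurable_fun Omega f -> (forall i, measurable_fun Omega (fun x => Df x 0 i)) ->
  (\int[mu]_(x in Omega) (f x ^+ 2 + dotv (Df x) (Df x))%:E < +oo)%E ->
  L2 Omega f /\ forall i, L2 Omega (fun x => Df x 0 i).
Proof.
move=> mf mD foo.
have d0 x : 0 <= dotv (Df x) (Df x) by apply: sumr_ge0 => i _; rewrite -expr2 sqr_ge0.
have msq h : measurable_fun Omega h -> measurable_fun Omega (fun x => (h x ^+ 2)%:E).
  by move=> mh; apply/measurable_EFinP; exact: measurable_funX.
have ms : measurable_fun Omega (fun x => (f x ^+ 2 + dotv (Df x) (Df x))%:E).
  apply/measurable_EFinP; apply: measurable_funD; first exact: measurable_funX.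
  by apply: measurable_sum => i; exact: measurable_funM.
split=> [|i]; apply/L2P; split => //; apply: le_lt_trans foo; apply: ge0_le_integral => //.
- by move=> x _; rewrite lee_fin sqr_ge0.
- exact: msq.
- by move=> x _; rewrite lee_fin lerDl.
- by move=> x _; rewrite lee_fin sqr_ge0.
- exact: msq.
- move=> x _; rewrite lee_fin /dotv (bigD1 i)//= expr2 addrCA lerDl addr_ge0 ?sqr_ge0//.
  by apply: sumr_ge0 => j _; rewrite -expr2 sqr_ge0.
Qed.

Definition gip (Df Dg : 'rV[R]_N -> 'rV[R]_N) : R :=
  \sum_i ip (fun x => Df x 0 i) (fun x => Dg x 0 i).

Lemma integrable_dotv (Df Dg : 'rV[R]_N -> 'rV[R]_N) :
  (forall i, L2 Omega (fun x => Df x 0 i)) -> (forall i, L2 Omega (fun x => Dg x 0 i)) ->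
  mu.-integrable Omega (fun x => (dotv (Df x) (Dg x))%:E).
Proof.
move=> Lf Lg.
have := @integrable_sum _ _ _ mu Omega mO _ (index_enum 'I_N) predT
  (fun i x => (Df x 0 i * Dg x 0 i)%:E).
have H i : predT i ->
    mu.-integrable Omega (fun x => (Df x 0 i * Dg x 0 i)%:E).
  by move=> _; exact: L2_integrableM.
move=> /(_ H); congr (_.-integrable _ _).
by apply/funext => x; rewrite sumEFin.
Qed.

Lemma dotv_gip (Df Dg : 'rV[R]_N -> 'rV[R]_N) :
  (forall i, L2 Omega (fun x => Df x 0 i)) -> (forall i, L2 Omega (fun x => Dg x 0 i)) ->
  \int[mu]_(x in Omega) dotv (Df x) (Dg x) = gip Df Dg.
Proof.
move=> Lf Lg; rewrite /gip /Rintegral /ip.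
under eq_integral do rewrite /dotv -sumEFin.
rewrite integral_sum//; last by move=> i; exact: L2_integrableM.
rewrite sum_fine// => i _; apply: integrable_fin_num => //; exact: L2_integrableM.
Qed.

(** Measurability is assumed because a finite norm does not supply it; membership in L^2 then
    follows from the eventual finiteness in [cvg_sqrt0]. *)
Lemma H1norm_cvg0 (T : Type) (F : set_system T) {FF : Filter F}
    (v : T -> 'rV[R]_N -> R) (Dv : T -> 'rV[R]_N -> 'rV[R]_N) :
  (\forall s \near F, measurable_fun Omega (v s)) ->
  (\forall s \near F, forall i, measurable_fun Omega (fun x => Dv s x 0 i)) ->
  H1norm Omega (v s) (Dv s) @[s --> F] --> 0%E ->
  [/\ \forall s \near F, L2 Omega (v s),
      \forall s \near F, forall i, L2 Omega (fun x => Dv s x 0 i),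
      ip (v s) (v s) @[s --> F] --> (0 : R) &
      forall i, ip (fun x => Dv s x 0 i) (fun x => Dv s x 0 i) @[s --> F] --> (0 : R)].
Proof.
move=> mv mD /cvg_sqrt0[|fX cX].
  move=> s; apply: integral_ge0 => x _; rewrite lee_fin addr_ge0 ?sqr_ge0//.
  by apply: sumr_ge0 => i _; rewrite -expr2 sqr_ge0.
have L : \forall s \near F, L2 Omega (v s) /\ forall i, L2 Omega (fun x => Dv s x 0 i).
  near=> s; apply: L2_of_sum.
  - by near: s.
  - by near: s.
  - rewrite -ge0_fin_numE; first by near: s.
    apply: integral_ge0 => x _; rewrite lee_fin addr_ge0 ?sqr_ge0//.
    by apply: sumr_ge0 => i _; rewrite -expr2 sqr_ge0.
have E : \forall s \near F, fine (\int[mu]_(x in Omega) (v s x ^+ 2 + dotv (Dv s x) (Dv s x))%:E) =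
    ip (v s) (v s) + gip (Dv s) (Dv s).
  apply: filterS L => s [Lv LD].
  rewrite -(dotv_gip LD LD) /ip.
  rewrite -(RintegralD mO (L2_integrableM Lv Lv) (integrable_dotv LD LD)).
  by congr fine; apply: eq_integral => x _; rewrite expr2.
have g0 s : 0 <= gip (Dv s) (Dv s) by apply: sumr_ge0 => i _; exact: ip_ge0.
split.
- by apply: filterS L => s [].
- by apply: filterS L => s [].
- apply/cvgrPdist_lt => e e0; have /cvgrPdist_lt/(_ _ e0) := cX.
  apply: filterS2 E => s ->; rewrite !sub0r !normrN !ger0_norm ?ip_ge0 ?addr_ge0 ?ip_ge0//.
  by apply: le_lt_trans; rewrite lerDl.
- move=> i; apply/cvgrPdist_lt => e e0; have /cvgrPdist_lt/(_ _ e0) := cX.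
  apply: filterS2 E => s ->; rewrite !sub0r !normrN !ger0_norm ?ip_ge0 ?addr_ge0 ?ip_ge0//.
  apply: le_lt_trans; rewrite /gip (bigD1 i)//= addrCA lerDl addr_ge0 ?ip_ge0//.
  by apply: sumr_ge0 => j _; exact: ip_ge0.
Unshelve. all: by end_near. Qed.

End L2_inner_product.

(** * The Poincare inequality on H^1_0 *)

Section poincare_H10.
Context {R : realType} {n : nat}.
Variable Omega : set 'rV[R]_n.+1.
Hypothesis mO : measurable Omega.
Local Notation mu := (lebesgue_rV R n.+1).
Variable M : R.
Hypothesis M_gt0 : 0 < M.
Hypothesis OM : forall x : 'rV[R]_n.+1, Omega x -> `|x 0 0| < M.
Implicit Types (phi psi : 'rV[R]_n.+1 -> R).

(** Off the closed support phi vanishes on a whole neighbourhood, which kills its difference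
    quotients too. *)
Lemma test_function_out phi (x : 'rV[R]_n.+1) i : test_function Omega phi -> ~ Omega x ->
  phi x = 0 /\ partial i phi x = 0.
Proof.
move=> [_ _ sO] nOx.
have cx : ~ closure [set x | phi x != 0] x by move=> /sO.
have near0 : \forall y \near x, phi y = 0.
  have oC : open (~` closure [set x | phi x != 0]).
    by apply: closed_openC; exact: closed_closure.
  have := open_nbhs_nbhs (conj oC cx : open_nbhs x (~` closure [set x | phi x != 0])).
  apply: filterS => y /= ny; apply: contrapT => /eqP py; apply: ny.
  exact: subset_closure.
have px := nbhs_singleton near0; split => //.
rewrite /partial /derive; apply: cvg_lim => //.
apply: (@cvg_trans _ (cst 0 @ (0 : R)^')); last exact: cvg_cst.
apply: near_eq_cvg.
have cv : (fun h : R => h *: delta_mx 0 i + x) @ 0^' --> x.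
  have -> : x = 0 *: delta_mx 0 i + x by rewrite scale0r add0r.
  apply: cvg_within_filter; apply: cvgD; last first.
    by rewrite scale0r add0r; exact: cvg_cst.
  by apply: cvgZr_tmp; exact: cvg_id.
have := cv _ near0; rewrite /nbhs /= => H.
near=> h.
have -> : phi (h *: delta_mx 0 i + x) = 0 by near: h.
by rewrite px subrr scaler0.
Unshelve. all: by end_near. Qed.

Lemma partialB phi psi i : Ck 1 phi -> Ck 1 psi ->
  partial i (fun x => phi x - psi x) = (fun x => partial i phi x - partial i psi x).
Proof.
move=> [_ /(_ i)[dphi _]] [_ /(_ i)[dpsi _]]; apply/funext => x.
exact: (deriveB (dphi x) (dpsi x)).
Qed.

(** Stated for a difference, so that closure of test functions under subtraction need not be
    established. *)
Lemma poincare_test phi psi : test_function Omega phi -> test_function Omega psi ->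
  (\int[mu]_(x in Omega) ((phi x - psi x) ^+ 2)%:E <=
   (4 * M ^+ 2)%:E * \int[mu]_(x in Omega)
      (dotv (grad phi x - grad psi x) (grad phi x - grad psi x))%:E)%E.
Proof.
move=> tphi tpsi.
have [kphi _ _] := tphi; have [kpsi _ _] := tpsi.
have [cphi dphi] := kphi 1%N; have [cpsi dpsi] := kpsi 1%N.
pose f x := phi x - psi x.
have cf : continuous f by move=> x; exact: (cvgB (cphi x) (cpsi x)).
have pf i : partial i f = (fun x => partial i phi x - partial i psi x).
  by apply: partialB; [exact: kphi 1%N|exact: kpsi 1%N].
have cpf i : continuous (partial i f).
  by rewrite pf => x; exact: (cvgB ((dphi i).2 x) ((dpsi i).2 x)).
have out x i : ~ Omega x -> f x = 0 /\ partial i f x = 0.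
  move=> nO; have [a b] := test_function_out i tphi nO.
  have [c d] := test_function_out i tpsi nO.
  by rewrite pf /f a b c d subrr.
have msq (g : 'rV[R]_n.+1 -> R) : continuous g ->
    measurable_fun setT (fun x => (g x ^+ 2)%:E).
  move=> cg; apply/measurable_EFinP.
  apply: (@measurable_funX _ _ _ setT g 2); exact: continuous_measurable_rV.
apply: (@le_trans _ _ (\int[mu]_x (f x ^+ 2)%:E)%E).
  apply: ge0_subset_integral => //; first exact: msq.
  by move=> x _; rewrite lee_fin sqr_ge0.
have P := @poincare_rV R n f M M_gt0 cf (cpf 0).
apply: (le_trans (P _ _)).
- by move=> x; apply: derivableB; [exact: (dphi 0).1|exact: (dpsi 0).1].
- move=> x Mx; apply: (out x 0 _).1 => /OM; rewrite ltNge; exact/negP/negPn.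
apply: lee_wpmul2l; first by rewrite lee_fin mulr_ge0 ?sqr_ge0.
have -> : (\int[mu]_x (partial 0 f x ^+ 2)%:E = \int[mu]_(x in Omega) (partial 0 f x ^+ 2)%:E)%E.
  rewrite [RHS]integral_mkcond; apply: eq_integral => x _; rewrite patchE.
  case: ifPn => // /negP; rewrite inE => /(out x 0)[_ ->].
  by rewrite expr0n.
have gE x : dotv (grad phi x - grad psi x) (grad phi x - grad psi x) = \sum_i partial i f x ^+ 2.
  by apply: eq_bigr => i _; rewrite !mxE pf expr2.
apply: ge0_le_integral => //.
- by move=> x _; rewrite lee_fin sqr_ge0.
- by apply: measurable_funTS; exact: msq.
- apply/measurable_EFinP; apply: measurable_funTS.
  rewrite (_ : (fun x => _) = (fun x => \sum_i partial i f x ^+ 2)); last exact/funext.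
  apply: measurable_sum => i; apply/measurable_EFinP; exact: msq.
- move=> x _; rewrite lee_fin gE (bigD1 0)//= lerDl.
  by apply: sumr_ge0 => i _; exact: sqr_ge0.
Qed.

Lemma H10_L2 v Dv : H10 Omega v Dv -> L2 Omega v /\ forall i, L2 Omega (fun x => Dv x 0 i).
Proof. by move=> [[Lv LD _] _]. Qed.

Lemma H10_approx v Dv : H10 Omega v Dv -> exists phi : nat -> 'rV[R]_n.+1 -> R,
  [/\ forall m, test_function Omega (phi m),
      \forall m \near \oo, L2 Omega (phi m),
      \forall m \near \oo, forall i, L2 Omega (partial i (phi m)),
      ip Omega (fun x => phi m x - v x) (fun x => phi m x - v x) @[m --> \oo] --> (0 : R) &
      forall i, ip Omega (fun x => partial i (phi m) x - Dv x 0 i)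
        (fun x => partial i (phi m) x - Dv x 0 i) @[m --> \oo] --> (0 : R)].
Proof.
move=> Hv; have [Lv LD] := H10_L2 Hv; have [_ [phi [tphi cphi]]] := Hv.
exists phi.
have mphi m : measurable_fun Omega (phi m).
  by apply: measurable_funTS; apply: continuous_measurable_rV; have [k _ _] := tphi m; exact: (k 0%N).
have mpphi m i : measurable_fun Omega (partial i (phi m)).
  apply: measurable_funTS; apply: continuous_measurable_rV; have [k _ _] := tphi m.
  by have [_ /(_ i)[]] := k 1%N.
have gE m i : (fun x => (grad (phi m) x - Dv x) 0 i) = (fun x => partial i (phi m) x - Dv x 0 i).
  by apply/funext => x; rewrite !mxE.
have [||L1 L2 c1 c2] := H1norm_cvg0 mO _ _ cphi.
- apply: nearW => m; apply: measurable_funB; [exact: mphi|exact: L2_measurable].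
- apply: nearW => m i; rewrite gE; apply: measurable_funB; [exact: mpphi|].
  exact: (L2_measurable mO (LD i)).
split => //.
- apply: filterS L1 => m Lm; have := L2_lin mO 1 1 Lm Lv; congr (Defs.L2 _ _).
  by apply/funext => x; rewrite /=; ring.
- apply: filterS L2 => m Lm i; have := Lm i; rewrite gE => {}Lm.
  have := L2_lin mO 1 1 Lm (LD i); congr (Defs.L2 _ _).
  by apply/funext => x; rewrite /=; ring.
- by move=> i; have := c2 i; under eq_fun do rewrite gE.
Qed.

(** Both sides are expanded into inner products, which converge along approximating test functions
    by [ip_cvg]. The right side stays expanded to match [dist2]. *)
Lemma poincare_H10 u Du v Dv : H10 Omega u Du -> H10 Omega v Dv ->
  ip Omega (fun x => u x - v x) (fun x => u x - v x) <=
  4 * M ^+ 2 * (gip Omega Du Du - 2 * gip Omega Du Dv + gip Omega Dv Dv).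
Proof.
move=> Hu Hv.
have [Lu LDu] := H10_L2 Hu; have [Lv LDv] := H10_L2 Hv.
have [phi [tphi Lphi Lpphi cphi cpphi]] := H10_approx Hu.
have [psi [tpsi Lpsi Lppsi cpsi cppsi]] := H10_approx Hv.
have sqB f g : L2 Omega f -> L2 Omega g ->
    ip Omega (fun x => f x - g x) (fun x => f x - g x) =
    ip Omega f f - 2 * ip Omega f g + ip Omega g g.
  move=> Lf Lg; have Lfg := L2B mO Lf Lg.
  by rewrite (ipBl mO Lf Lg Lfg) !(ipBr mO Lf Lg)// (ipC _ g f); ring.
pose A m := ip Omega (phi m) (phi m) - 2 * ip Omega (phi m) (psi m) + ip Omega (psi m) (psi m).
pose B m := \sum_i (ip Omega (partial i (phi m)) (partial i (phi m))
   - 2 * ip Omega (partial i (phi m)) (partial i (psi m))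
   + ip Omega (partial i (psi m)) (partial i (psi m))).
have cA : A m @[m --> \oo] --> ip Omega u u - 2 * ip Omega u v + ip Omega v v.
  apply: cvgD; last exact: ip_cvg.
  apply: cvgB; first exact: ip_cvg.
  by apply: cvgM; [exact: cvg_cst|exact: ip_cvg].
have Lpi i : \forall m \near \oo, L2 Omega (partial i (phi m)).
  by apply: filterS Lpphi.
have Lqi i : \forall m \near \oo, L2 Omega (partial i (psi m)).
  by apply: filterS Lppsi.
have cB : B m @[m --> \oo] --> gip Omega Du Du - 2 * gip Omega Du Dv + gip Omega Dv Dv.
  rewrite /gip mulr_sumr -sumrB -big_split/=.
  apply: cvg_big => [|i _]; first exact: add_continuous.
  apply: cvgD; last exact: ip_cvg.
  apply: cvgB; first exact: ip_cvg.
  by apply: cvgM; [exact: cvg_cst|exact: ip_cvg].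
rewrite sqB//.
have cMB : 4 * M ^+ 2 * B m @[m --> \oo] -->
    4 * M ^+ 2 * (gip Omega Du Du - 2 * gip Omega Du Dv + gip Omega Dv Dv).
  by apply: cvgM; [exact: cvg_cst|exact: cB].
apply: (ler_cvg_to cA cMB); near=> m.
have L1 : L2 Omega (phi m) by near: m.
have L3 : L2 Omega (psi m) by near: m.
have L2' : forall i, L2 Omega (partial i (phi m)) by near: m.
have L4 : forall i, L2 Omega (partial i (psi m)) by near: m.
have -> : A m = ip Omega (fun x => phi m x - psi m x) (fun x => phi m x - psi m x).
  by rewrite sqB.
pose D x := grad (phi m) x - grad (psi m) x.
have DE i : (fun x => D x 0 i) = (fun x => partial i (phi m) x - partial i (psi m) x).
  by apply/funext => x; rewrite !mxE.
have LD i : L2 Omega (fun x => D x 0 i) by rewrite DE; exact: L2B.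
have -> : B m = \int[mu]_(x in Omega) dotv (D x) (D x).
  by rewrite (dotv_gip mO LD LD); apply: eq_bigr => i _; rewrite DE sqB.
have LL := L2B mO L1 L3.
have i1 := integrable_fin_num mO (L2_integrableM mO LL LL).
have i2 := integrable_fin_num mO (integrable_dotv mO LD LD).
have := poincare_test (tphi m) (tpsi m).
under eq_integral do rewrite expr2.
by rewrite -[in X in (X <= _)%E -> _](fineK i1) -[X in (_ <= _ * X)%E -> _](fineK i2) -EFinM lee_fin.
Unshelve. all: by end_near. Qed.

End poincare_H10.

(** * Exchanging the memory integral with the integral over Omega *)

Section memory_integrals.
Context {R : realType} {N : nat}.
Variable Omega : set 'rV[R]_N.
Hypothesis mO : measurable Omega.
Local Notation mu := (lebesgue_rV R N).
Local Notation leb := (@lebesgue_measure R).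
Variables (k : R -> R) (B t : R).
Hypothesis k_cont : continuous k.
Hypothesis k_ge0 : forall s, 0 <= k s.
Hypothesis k_le : forall s, k s <= B.
Local Notation I := (`[0, t]%classic : set (measurableTypeR R)).

Let mkt : measurable_fun setT (fun s : measurableTypeR R => k (t - s)).
Proof.
apply: continuous_measurable_fun => s; apply: (cvg_comp (fun s => t - s) k); last exact: k_cont.
by apply: cvgB; [exact: cvg_cst|exact: cvg_id].
Qed.

Let mI : measurable I. Proof. exact: measurable_itv. Qed.

Lemma memory_tonelli (W : R -> 'rV[R]_N -> R) :
  measurable_fun (I `*` Omega) (fun p : measurableTypeR R * 'rV[R]_N => W p.1 p.2) ->
  (forall s x, 0 <= W s x) ->
  (forall s, 0 <= s <= t -> mu.-integrable Omega (EFin \o W s)) ->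
  (\int[mu]_(x in Omega) \int[leb]_(s in `[0%R, t]) (k (t - s) * W s x)%:E =
   \int[leb]_(s in `[0%R, t]) (k (t - s) * \int[mu]_(x in Omega) W s x)%:E)%E.
Proof.
move=> mW W0 iW.
pose h (p : measurableTypeR R * 'rV[R]_N) := ((fun p : measurableTypeR R * 'rV[R]_N =>
  k (t - p.1) * W p.1 p.2) \_ (I `*` Omega)) p.
have mIO : measurable (I `*` Omega) by exact: measurableX.
have mh : measurable_fun setT (EFin \o h).
  apply/measurable_EFinP; apply/(measurable_restrictT _ mIO); apply: measurable_funM => //.
  by apply: measurable_funTS; apply: (measurableT_comp mkt); exact: measurable_fst.
have h0 p : (0 <= (EFin \o h) p)%E.
  by rewrite lee_fin /h patchE; case: ifPn => // _; rewrite mulr_ge0.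
have := fubini_tonelli (m1 := leb) (m2 := mu) (EFin \o h) mh h0.
have -> : (\int[leb]_s \int[mu]_x (EFin \o h) (s, x) =
    \int[leb]_(s in `[0%R, t]) (k (t - s) * \int[mu]_(x in Omega) W s x)%:E)%E.
  rewrite [RHS]integral_mkcond; apply: eq_integral => s _; rewrite patchE; case: ifPn => sI.
    have s01 : 0 <= s <= t by move: sI; rewrite inE/= in_itv.
    transitivity (\int[mu]_(x in Omega) (k (t - s) * W s x)%:E)%E.
      rewrite [RHS]integral_mkcond; apply: eq_integral => x _.
      by rewrite /h /= !patchE in_setX/= sI /=; case: ifPn.
    under eq_integral do rewrite EFinM.
    rewrite integralZl//; last exact: iW.
    by rewrite EFinM fineK//; apply: integrable_fin_num => //; exact: iW.
  apply: integral0_eq => x _; rewrite /h /= patchE in_setX/= (negPf sI).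
  by [].
move=> ->; rewrite [LHS]integral_mkcond; apply: eq_integral => x _; rewrite patchE; case: ifPn => xO.
  rewrite [LHS]integral_mkcond; apply: eq_integral => s _.
  by rewrite /h /= !patchE in_setX/= xO andbT; case: ifPn.
apply/esym; apply: integral0_eq => s _.
by rewrite /h /= patchE in_setX/= (negPf xO) andbF.
Qed.

(** Pointwise in x the memory integral is under control only for almost every x. Joint integrability
    of k D e follows from the bound by B (D^2 + e^2) / 2, and the product is then identified almost
    everywhere with the inner Fubini integral. *)
Lemma memory_fubini (D : R -> 'rV[R]_N -> R) (e : 'rV[R]_N -> R) (C : R) :
  measurable_fun (I `*` Omega) (fun p : measurableTypeR R * 'rV[R]_N => D p.1 p.2) ->
  (forall s, 0 <= s <= t -> L2 Omega (D s)) -> L2 Omega e ->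
  (forall s, 0 <= s <= t -> ip Omega (D s) (D s) <= C) ->
  mu.-integrable Omega
     (fun x => ((\int[leb]_(s in `[0, t]) (k (t - s) * D s x)) * e x)%:E) /\
  \int[mu]_(x in Omega) ((\int[leb]_(s in `[0, t]) (k (t - s) * D s x)) * e x) =
  \int[leb]_(s in `[0, t]) (k (t - s) * ip Omega (D s) e).
Proof.
move=> mD LD Le DC.
have me := L2_measurable mO Le.
have mIO : measurable (I `*` Omega) by exact: measurableX.
have mkD : measurable_fun (I `*` Omega) (fun p : measurableTypeR R * 'rV[R]_N => k (t - p.1) * D p.1 p.2).
  apply: measurable_funM => //.
  by apply: measurable_funTS; apply: (measurableT_comp mkt); exact: measurable_fst.
pose g (p : measurableTypeR R * 'rV[R]_N) := ((fun p : measurableTypeR R * 'rV[R]_N =>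
  k (t - p.1) * D p.1 p.2) \_ (I `*` Omega)) p.
have mg : measurable_fun setT (EFin \o g).
  by apply/measurable_EFinP; apply/(measurable_restrictT _ mIO).
pose eO := e \_ Omega.
have meO : measurable_fun setT eO by apply/(measurable_restrictT _ mO).
pose h (p : measurableTypeR R * 'rV[R]_N) := g p * eO p.2.
have mh : measurable_fun setT (EFin \o h).
  apply/measurable_EFinP; apply: measurable_funM; first exact/measurable_EFinP.
  by apply: (measurableT_comp meO); exact: measurable_snd.
have mah : measurable_fun setT (abse \o (EFin \o h)) by exact: measurableT_comp.
have ah0 p : (0 <= (abse \o (EFin \o h)) p)%E by exact: abse_ge0.
have hE s x : h (s, x) = if (s \in I) && (x \in Omega) then k (t - s) * D s x * e x else 0.
  rewrite /h /g /eO !patchE in_setX/=.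
  by case: (s \in I); case: (x \in Omega); rewrite /= ?(mul0r, mulr0)// (_ : point = 0 :> R)// mul0r.
have B0 : 0 <= B := le_trans (k_ge0 0) (k_le 0).
have ih : (leb \x mu)%E.-integrable setT (EFin \o h).
  apply/(@integrable12ltyP _ _ _ _ _ leb mu (EFin \o h) mh).
  pose c := B * (2^-1 * (C + ip Omega e e)).
  apply: (@le_lt_trans _ _ (\int[leb]_(s in `[0%R, t]) c%:E)%E); last first.
    rewrite integral_cst//= lebesgue_measure_itv/= lte_fin.
    by case: ifPn => _; rewrite ?mule0 ?ltry// -EFinM ltry.
  rewrite [leRHS]integral_mkcond; apply: ge0_le_integral => //.
  - by move=> s _; apply: integral_ge0.
  - exact: (@measurable_fun_fubini_tonelli_F _ _ _ _ _ mu _ mah ah0).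
  - by apply/(measurable_restrictT _ mI); exact: measurable_cst.
  move=> s _; rewrite patchE; case: ifPn => sI; last first.
    by rewrite integral0_eq// => x _; rewrite /= hE (negPf sI) normr0.
  have s01 : 0 <= s <= t by move: sI; rewrite inE/= in_itv.
  apply: (@le_trans _ _ (\int[mu]_(x in Omega)
     ((B / 2)%:E * (D s x * D s x)%:E + (B / 2)%:E * (e x * e x)%:E))%E).
    rewrite [leRHS]integral_mkcond; apply: ge0_le_integral => //.
    - by apply: (measurableT_comp mah); exact: measurable_pair1.
    - apply/(measurable_restrictT _ mO); apply/measurable_EFinP.
      have mDs := L2_measurable mO (LD s s01).
      by apply: measurable_funD; apply: measurable_funM => //; apply: measurable_funM.
    move=> x _; rewrite patchE /= hE sI /=; case: ifPn => xO; last by rewrite normr0.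
    rewrite -!EFinM -EFinD lee_fin !normrM (ger0_norm (k_ge0 _)).
    have : k (t - s) * (`|D s x| * `|e x|) <= B * (`|D s x| * `|e x|).
      by rewrite ler_wpM2r// mulr_ge0.
    have : 0 <= B * (`|D s x| - `|e x|) ^+ 2 by rewrite mulr_ge0 ?sqr_ge0.
    rewrite sqrrB !real_normK ?num_real// !expr2; lra.
  have j1 := L2_integrableM mO (LD s s01) (LD s s01).
  have j2 := L2_integrableM mO Le Le.
  have i1 := integrableZl mO (B / 2) j1.
  have i2 := integrableZl mO (B / 2) j2.
  rewrite (integralD mO i1 i2) (integralZl mO j1) (integralZl mO j2).
  rewrite -(fineK (integrable_fin_num mO j1)) -(fineK (integrable_fin_num mO j2)).
  rewrite -!EFinM -EFinD lee_fin.
  have : B * ip Omega (D s) (D s) <= B * C by rewrite ler_wpM2l ?DC.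
  rewrite /c /ip /Rintegral; lra.
have F1 := Fubini ih.
have FE : (\int[leb]_s \int[mu]_x (EFin \o h) (s, x) =
    \int[leb]_(s in `[0%R, t]) (k (t - s) * ip Omega (D s) e)%:E)%E.
  rewrite [RHS]integral_mkcond; apply: eq_integral => s _; rewrite patchE; case: ifPn => sI; last first.
    by apply: integral0_eq => x _; rewrite /= hE (negPf sI).
  have s01 : 0 <= s <= t by move: sI; rewrite inE/= in_itv.
  transitivity (\int[mu]_(x in Omega) (k (t - s) * (D s x * e x))%:E)%E.
    rewrite [RHS]integral_mkcond; apply: eq_integral => x _; rewrite patchE /= hE sI /=.
    by case: ifPn => // _; rewrite mulrA.
  have i1 := L2_integrableM mO (LD s s01) Le.
  under eq_integral do rewrite EFinM.
  by rewrite integralZl// EFinM fineK//; exact: integrable_fin_num.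
pose m x := \int[leb]_(s in `[0, t]) (k (t - s) * D s x).
pose q x := m x * e x.
have mG : measurable_fun setT (fun x => (\int[leb]_s (EFin \o g) (s, x))%E).
  rewrite (_ : (fun x => _) = (fun x => (\int[leb]_s ((EFin \o g)^\+ (s, x)) -
     \int[leb]_s ((EFin \o g)^\- (s, x)))%E)); last first.
    apply/funext => x; rewrite integralE.
    by under eq_integral do rewrite funepos_comp/=;
       under [X in (_ - X = _)%E]eq_integral do rewrite funeneg_comp/=.
  apply: emeasurable_funB.
  - apply: (@measurable_fun_fubini_tonelli_G _ _ _ _ _ leb) => //; exact: measurable_funepos.
  - apply: (@measurable_fun_fubini_tonelli_G _ _ _ _ _ leb) => //; exact: measurable_funeneg.
have mE x : Omega x -> m x = fine (\int[leb]_s (EFin \o g) (s, x))%E.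
  move=> Ox; rewrite /m /Rintegral integral_mkcond; congr fine; apply: eq_integral => s _.
  by rewrite /= /g !patchE in_setX/= (mem_set Ox) andbT; case: ifPn.
have mq : measurable_fun Omega (EFin \o q).
  apply/measurable_EFinP; apply: measurable_funM => //.
  apply: (eq_measurable_fun (fun x => fine (\int[leb]_s (EFin \o g) (s, x))%E)).
    by move=> x; rewrite inE => /mE.
  by apply: measurable_funTS; apply: (measurableT_comp _ mG).
have Gq : ae_eq mu setT (fubini_G leb (EFin \o h)) ((EFin \o q) \_ Omega).
  have := ae_integrable2 ih; apply: (@filterS _ _ (ae_filter_ringOfSetsType mu)) => x ihx _.
  rewrite /fubini_G patchE; case: ifPn => xO; last first.
    by apply: integral0_eq => s _; rewrite /= hE (negPf xO) andbF.
  have E1 : (fun s : measurableTypeR R => (EFin \o h) (s, x)) =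
      (EFin \o (fun s => k (t - s) * D s x * e x)) \_ I.
    by apply/funext => s; rewrite patchE /= hE xO andbT; case: ifPn.
  move: ihx; rewrite E1 => /(integrable_mkcond _ mI) ihx.
  rewrite -integral_mkcond.
  (* Where e vanishes, s -> D s x may fail to be integrable, but both sides are 0. Elsewhere
     integrability passes from D e to D by division. *)
  have [e0|e0] := eqVneq (e x) 0.
    rewrite integral0_eq /= ?/q ?e0 ?mulr0// => s _.
    by rewrite mulr0.
  have ikD : leb.-integrable `[0, t] (EFin \o (fun s => k (t - s) * D s x)).
    have := integrableZr mI (e x)^-1 ihx; congr (_.-integrable _ _).
    by apply/funext => s /=; rewrite -EFinM mulfK.
  under eq_integral do rewrite /= EFinM.
  rewrite integralZr//; rewrite /q /m /Rintegral /= EFinM fineK//.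
  exact: integrable_fin_num.
have mqO : measurable_fun setT ((EFin \o q) \_ Omega) by apply/(measurable_restrictT _ mO).
have mGh : measurable_fun setT (fubini_G leb (EFin \o h)) by exact: measurable_fubini_G ih.
have Goo := (integrable21ltyP leb mu mh).1 ih.
have iq : mu.-integrable setT ((EFin \o q) \_ Omega).
  apply/integrableP; split => //.
  apply: (@le_lt_trans _ _ (\int[mu]_x `|fubini_G leb (EFin \o h) x|)%E); last first.
    apply: le_lt_trans Goo; apply: ge0_le_integral => //.
    - exact: measurableT_comp.
    - exact: (@measurable_fun_fubini_tonelli_G _ _ _ _ _ leb _ mah ah0).
    - move=> x _; apply: le_abse_integral => //.
      by apply: (measurableT_comp mh); exact: measurable_pair2.
  rewrite le_eqVlt; apply/orP; left; apply/eqP; apply: ae_eq_integral => //.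
  - exact: measurableT_comp.
  - exact: measurableT_comp.
  - by apply: (@filterS _ _ (ae_filter_ringOfSetsType mu) _ _ _ Gq) => x /= H /H ->.
split; first by apply/(integrable_mkcond _ mO).
have E2 : (\int[mu]_x fubini_G leb (EFin \o h) x = \int[mu]_(x in Omega) (q x)%:E)%E.
  by rewrite [RHS]integral_mkcond; exact: ae_eq_integral.
by rewrite [LHS]/Rintegral [RHS]/Rintegral -FE F1 -E2.
Qed.

End memory_integrals.

(** * Weak solutions *)

Lemma Rintegral_sum d (T : measurableType d) (R : realType) (mu : {measure set T -> \bar R})
    (D : set T) (I : finType) (f : I -> T -> R) : measurable D ->
  (forall i, mu.-integrable D (EFin \o f i)) ->
  \int[mu]_(x in D) (\sum_i f i x) = \sum_i \int[mu]_(x in D) f i x.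
Proof.
move=> mD fi; rewrite /Rintegral; under eq_integral do rewrite -sumEFin.
rewrite integral_sum//.
by rewrite sum_fine// => i _; exact: (integrable_fin_num mD (fi i)).
Qed.

(** * From limits within the half-line to limits on the real line *)

Section halfline.
Context {R : realType}.
Local Notation halfline := (`[0, +oo[%classic : set R).
Implicit Types (t : R).

Lemma rho_within t : rho s @[s --> t] --> within halfline (nbhs (rho t)).
Proof.
move=> A HA.
have H : \forall s \near t, halfline (rho s) -> A (rho s).
  exact: (@rho_continuous R t [set s | halfline s -> A s] HA).
change (\forall s \near t, A (rho s)); apply: filterS H => s; apply.
by rewrite /= in_itv/= rho_ge0.
Qed.

Lemma near_halfline t : 0 <= t -> \forall s \near within halfline (nbhs t), 0 <= s.
Proof.
by move=> t0; rewrite near_withinE; apply: nearW => s; rewrite /= in_itv/= andbT.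
Qed.

(** For t > 0 and |h| < t the point t + h lies in the half-line, so the restricted quotient is the
    ordinary one. *)
Lemma halfline_derive (f : R -> R) t (l : R) : 0 < t ->
  (s - t)^-1 * (f s - f t) @[s --> within halfline t^'] --> l ->
  is_derive t (1 : R) (f \o rho) l.
Proof.
move=> t0 H; apply: is_derive_quotient.
have E : \forall h \near (0 : R)^',
    (h + t - t)^-1 * (f (h + t) - f t) = h^-1 * ((f \o rho) (h + t) - (f \o rho) t).
  have : \forall h \near (0 : R)^', `|h| < t by exact: dnbhs0_lt.
  apply: filterS => h; rewrite ltr_norml => /andP[ht _].
  rewrite /= addrK !rho_id//; [exact: ltW|lra].
apply: (cvg_trans (near_eq_cvg E)).
apply: (cvg_comp (fun h => h + t) (fun s => (s - t)^-1 * (f s - f t)) _ H).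
move=> A; rewrite /within/= /dnbhs /within/= => /nbhs_ballP[r /= r0 Hr].
apply/nbhs_ballP; exists (Num.min r t) => /=; first by rewrite lt_min r0.
move=> h; rewrite /ball/= sub0r normrN lt_min => /andP[hr ht] h0.
apply: Hr; rewrite /ball/= ?in_itv/=.
- by rewrite opprD addrCA subrr addr0 normrN.
- by rewrite -subr_eq0 addrK.
- by rewrite andbT; move: ht; rewrite ltr_norml => /andP[? _]; lra.
Qed.

End halfline.

(** * The kernels G, Q, P of a weak solution *)

Section weak_solutions.
Context {R : realType} {n : nat}.
Local Notation N := n.+1.
Local Notation mu := (lebesgue_rV R N).
Local Notation leb := (@lebesgue_measure R).
Local Notation halfline := (`[0, +oo[%classic : set R).
Variables (Omega : set 'rV[R]_N) (M eta : R) (k : R -> R).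
Implicit Types (t s : R).
Hypothesis mO : measurable Omega.
Hypothesis M_gt0 : 0 < M.
Hypothesis OM : forall x : 'rV[R]_N, Omega x -> `|x 0 0| < M.
Hypothesis eta_gt0 : 0 < eta.
Hypothesis k_ge0 : forall t : R, 0 <= t -> 0 <= k t.
Hypothesis k0_gt0 : 0 < k 0.
Let kt := k \o rho.
Hypothesis kt_cont : continuous kt.
Hypothesis kt_decay : forall t h, 0 <= t -> 0 <= h -> kt (t + h) <= expR (- (eta * h)) * kt t.
Variables (u ut : R -> 'rV[R]_N -> R) (Du : R -> 'rV[R]_N -> 'rV[R]_N).
Hypothesis ws : weak_solution Omega k u ut Du.

Let G t s := gip Omega (Du (rho t)) (Du (rho s)).
Let Q t s := ip Omega (ut (rho t)) (ut (rho s)).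
Let P t s := ip Omega (ut (rho t)) (u (rho s)).

Let kt_ge0 t : 0 <= kt t. Proof. by rewrite /kt /= k_ge0// rho_ge0. Qed.

Let kt_le t : kt t <= kt 0.
Proof.
have := kt_decay (lexx 0) (rho_ge0 t); rewrite add0r {1}/kt/= rho_id ?rho_ge0//.
rewrite -/(kt t) => /le_trans; apply; rewrite ler_piMl// -expR0 ler_expR oppr_le0.
by rewrite mulr_ge0 ?rho_ge0// ltW.
Qed.

Let H10u t : 0 <= t -> H10 Omega (u t) (Du t).
Proof. by move=> t0; have [/(_ t t0)[]] := ws. Qed.

Let Lu t : 0 <= t -> L2 Omega (u t).
Proof. by move=> /H10u/H10_L2[]. Qed.

Let LDu t i : 0 <= t -> L2 Omega (fun x => Du t x 0 i).
Proof. by move=> /H10u/H10_L2[_]; exact. Qed.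

Let Lut t : 0 <= t -> L2 Omega (ut t).
Proof. by move=> t0; have [_ /(_ t t0)[]] := ws. Qed.

Let cvg_u_Du t : 0 <= t ->
  ip Omega (fun x => u s x - u t x) (fun x => u s x - u t x)
    @[s --> within halfline (nbhs t)] --> (0 : R) /\
  forall i, ip Omega (fun x => Du s x 0 i - Du t x 0 i) (fun x => Du s x 0 i - Du t x 0 i)
    @[s --> within halfline (nbhs t)] --> (0 : R).
Proof.
move=> t0; have [/(_ t t0)[_ c] _ _ _] := ws.
have DE s i : (fun x => (Du s x - Du t x) 0 i) = (fun x => Du s x 0 i - Du t x 0 i).
  by apply/funext => x; rewrite !mxE.
have [||_ _ c1 c2] := H1norm_cvg0 mO _ _ c.
- apply: filterS (near_halfline t0) => s s0.
  exact: (L2_measurable mO (L2B mO (Lu s0) (Lu t0))).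
- apply: filterS (near_halfline t0) => s s0 i; rewrite DE.
  exact: (L2_measurable mO (L2B mO (LDu i s0) (LDu i t0))).
split=> [|i]; first exact: c1.
by have := c2 i; under eq_fun do rewrite DE.
Qed.

Let cvg_ut t : 0 <= t -> ip Omega (fun x => ut s x - ut t x) (fun x => ut s x - ut t x)
  @[s --> within halfline (nbhs t)] --> (0 : R).
Proof. by move=> t0; have [_ /(_ t t0)[_ _ c _] _ _] := ws; exact: cvg_L2norm0 c. Qed.

Let ip_continuous (f g : R -> 'rV[R]_N -> R) :
  (forall t, 0 <= t -> L2 Omega (f t)) -> (forall t, 0 <= t -> L2 Omega (g t)) ->
  (forall t, 0 <= t -> ip Omega (fun x => f s x - f t x) (fun x => f s x - f t x)
    @[s --> within halfline (nbhs t)] --> (0 : R)) ->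
  (forall t, 0 <= t -> ip Omega (fun x => g s x - g t x) (fun x => g s x - g t x)
    @[s --> within halfline (nbhs t)] --> (0 : R)) ->
  continuous (fun p : R * R => ip Omega (f (rho p.1)) (g (rho p.2))).
Proof.
move=> Lf Lg cf cg p.
apply: (ip_cvg mO (f := fun p : R * R => f (rho p.1)) (g := fun p : R * R => g (rho p.2))).
- by apply: nearW => q; apply: Lf; exact: rho_ge0.
- by apply: nearW => q; apply: Lg; exact: rho_ge0.
- exact: Lf (rho_ge0 _).
- exact: Lg (rho_ge0 _).
- apply: (cvg_comp (fun p : R * R => rho p.1) _ _ (cf _ (rho_ge0 _))).
  by apply: (cvg_comp fst rho); [exact: cvg_fst|exact: rho_within].
- apply: (cvg_comp (fun p : R * R => rho p.2) _ _ (cg _ (rho_ge0 _))).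
  by apply: (cvg_comp snd rho); [exact: cvg_snd|exact: rho_within].
Qed.

Let ipD_continuous i j : continuous (fun p : R * R =>
  ip Omega (fun x => Du (rho p.1) x 0 i) (fun x => Du (rho p.2) x 0 j)).
Proof.
apply: (@ip_continuous (fun t x => Du t x 0 i) (fun t x => Du t x 0 j)).
- by move=> t; exact: LDu.
- by move=> t; exact: LDu.
- by move=> t /cvg_u_Du[_]; exact.
- by move=> t /cvg_u_Du[_]; exact.
Qed.

Lemma G_continuous : continuous (fun p : R * R => G p.1 p.2).
Proof.
move=> p; apply: cvg_big => [|i _]; first exact: add_continuous.
exact: ipD_continuous.
Qed.

Lemma Q_continuous : continuous (fun p : R * R => Q p.1 p.2).
Proof. by apply: ip_continuous; [exact: Lut|exact: Lut|exact: cvg_ut|exact: cvg_ut]. Qed.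

Lemma P_continuous : continuous (fun p : R * R => P p.1 p.2).
Proof.
apply: ip_continuous; [exact: Lut|exact: Lu|exact: cvg_ut|].
by move=> t /cvg_u_Du[].
Qed.

Lemma G_symmetric t s : G t s = G s t.
Proof. by apply: eq_bigr => i _; rewrite ipC. Qed.

Lemma dist2_gip t s : dist2 G t s =
  gip Omega (fun x => Du (rho t) x - Du (rho s) x) (fun x => Du (rho t) x - Du (rho s) x).
Proof.
rewrite /dist2 /G /gip mulr_sumr -sumrB -big_split/=; apply: eq_bigr => i _.
have Lt := LDu i (rho_ge0 t); have Ls := LDu i (rho_ge0 s).
rewrite (_ : (fun x => (Du (rho t) x - Du (rho s) x) 0 i) =
  (fun x => Du (rho t) x 0 i - Du (rho s) x 0 i)); last by apply/funext => x; rewrite !mxE.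
rewrite (ipBl mO Lt Ls (L2B mO Lt Ls)) !(ipBr mO Lt Ls)//.
by rewrite (ipC _ (fun x => Du (rho s) x 0 i)); ring.
Qed.

Lemma gip_ge0 (Df : 'rV[R]_N -> 'rV[R]_N) : 0 <= gip Omega Df Df.
Proof. by apply: sumr_ge0 => i _; exact: ip_ge0. Qed.

Lemma P_derive2 t s : 0 < t -> 0 < s -> is_derive s (1 : R) (P t) (Q t s).
Proof.
move=> t0 s0.
suff : is_derive s (1 : R) ((fun s => ip Omega (ut (rho t)) (u s)) \o rho) (Q t s) by [].
apply: halfline_derive => //.
have [_ /(_ s (ltW s0))[_ _ _ c] _ _] := ws.
have Lt := Lut (rho_ge0 t); have Ls := Lu (ltW s0).
have nF : \forall s' \near within halfline s^', 0 <= s'.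
  by rewrite near_withinE; apply: nearW => s'; rewrite /= in_itv/= andbT.
pose q s' x := (s' - s)^-1 * u s' x + (- (s' - s)^-1) * u s x.
have Lq : \forall s' \near within halfline s^', L2 Omega (q s').
  by apply: filterS nF => s' s'0; apply: L2_lin => //; exact: Lu.
have qE : \forall s' \near within halfline s^',
    ip Omega (ut (rho t)) (q s') =
    (s' - s)^-1 * (ip Omega (ut (rho t)) (u s') - ip Omega (ut (rho t)) (u s)).
  apply: filterS nF => s' s'0.
  by rewrite (ip_linr mO _ _ (Lu s'0) Ls Lt); ring.
apply: (cvg_trans (near_eq_cvg qE)).
rewrite /Q (rho_id (ltW s0)).
apply: (ip_cvg mO (f := fun _ : R => ut (rho t))).
- exact: nearW.
- exact: Lq.
- exact: Lt.
- exact: Lut (ltW s0).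
- have -> : (fun _ : R => ip Omega (fun x => ut (rho t) x - ut (rho t) x)
    (fun x => ut (rho t) x - ut (rho t) x)) = cst 0; last exact: cvg_cst.
  apply/funext => s'; rewrite /ip (eq_Rintegral _ (g := cst 0)) ?Rintegral_cst ?mul0r//.
  by move=> x _; rewrite subrr mul0r.
- have -> : (fun s' => ip Omega (fun x => q s' x - ut s x) (fun x => q s' x - ut s x)) =
    (fun s' => ip Omega (fun x => (s' - s)^-1 * (u s' x - u s x) - ut s x)
     (fun x => (s' - s)^-1 * (u s' x - u s x) - ut s x)); last exact: cvg_L2norm0 c.
  by apply/funext => s'; apply: eq_Rintegral => x _; rewrite /q; ring.
Qed.

(** [memory_fubini] is applied to each component of the gradient; its uniform bound on the norms is
    the maximum of a continuous function over [0, t]. *)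
Lemma memory_gip t s : 0 <= t -> 0 <= s ->
  \int[mu]_(x in Omega) dotv (\row_i \int[leb]_(r in `[0, t]) (k (t - r) * Du r x 0 i)) (Du s x) =
  kconv kt (G^~ s) t.
Proof.
move=> t0 s0.
have kE x i : \int[leb]_(r in `[0, t]) (k (t - r) * Du r x 0 i) =
    \int[leb]_(r in `[0, t]) (kt (t - r) * Du r x 0 i).
  apply: eq_Rintegral => q; rewrite inE/= in_itv/= => /andP[_ qt].
  by rewrite /kt/= rho_id// subr_ge0.
have C i : exists C, forall r, 0 <= r <= t -> ip Omega (fun x => Du r x 0 i) (fun x => Du r x 0 i) <= C.
  have c : {within `[0, t], continuous (fun r =>
      ip Omega (fun x => Du (rho r) x 0 i) (fun x => Du (rho r) x 0 i))}.
    pose f (a b : R) := ip Omega (fun x => Du (rho a) x 0 i) (fun x => Du (rho b) x 0 i).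
    have cf : continuous (fun p : R * R => f p.1 p.2)  by exact: ipD_continuous.
    have cd := diag_continuous (f := f) cf.
    by apply: continuous_subspaceT => r; exact: cd.
  have [c0 _ Hc] := EVT_max t0 c.
  exists (ip Omega (fun x => Du (rho c0) x 0 i) (fun x => Du (rho c0) x 0 i)) => r r01.
  by have := Hc r; rewrite in_itv/= => /(_ r01); rewrite rho_id//; case/andP: r01.
have mD i : measurable_fun ((`[0, t]%classic : set (measurableTypeR R)) `*` Omega)
    (fun p : measurableTypeR R * 'rV[R]_N => Du p.1 p.2 0 i).
  have [_ _ /(_ i) m _] := ws; apply: measurable_funS m.
  - by apply: measurableX => //; exact: measurable_itv.
  - by move=> [r x] /= [+ Ox]; rewrite !in_itv/= andbT => /andP[].
have F i := memory_fubini mO kt_cont kt_ge0 kt_le (mD i)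
  (fun r (r01 : 0 <= r <= t) => LDu i (proj1 (andP r01))) (LDu i s0) (svalP (cid (C i))).
have -> : \int[mu]_(x in Omega) dotv (\row_i \int[leb]_(r in `[0, t]) (k (t - r) * Du r x 0 i))
      (Du s x) =
    \int[mu]_(x in Omega) \sum_i ((\int[leb]_(r in `[0, t]) (kt (t - r) * Du r x 0 i)) * Du s x 0 i).
  by apply: eq_Rintegral => x _; apply: eq_bigr => i _; rewrite mxE kE.
rewrite Rintegral_sum//; last by move=> i; exact: (F i).1.
rewrite /kconv rho_id// /G /gip.
have -> : \int[leb]_(r in `[0, t]) (kt (t - r) *
     \sum_i ip Omega (fun x => Du (rho r) x 0 i) (fun x => Du (rho s) x 0 i)) =
   \int[leb]_(r in `[0, t]) \sum_i (kt (t - r) *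
     ip Omega (fun x => Du (rho r) x 0 i) (fun x => Du (rho s) x 0 i)).
  by apply: eq_Rintegral => r _; rewrite mulr_sumr.
rewrite Rintegral_sum//; last first.
  move=> i; apply: continuous_integrable_itv; apply: kshift_continuous => //.
  pose f (a b : R) := ip Omega (fun x => Du (rho a) x 0 i) (fun x => Du (rho b) x 0 i).
  have cf : continuous (fun p : R * R => f p.1 p.2) by exact: ipD_continuous.
  exact: (fixr_continuous (f := f) cf).
apply: eq_bigr => i _; rewrite (F i).2; apply: eq_Rintegral => r.
by rewrite inE/= in_itv/= => /andP[r0 _]; rewrite !rho_id.
Qed.

Lemma P_derive1 t s : 0 < t -> 0 < s ->
  is_derive t (1 : R) (P^~ s) (kconv kt (G^~ s) t - G t s).
Proof.
move=> t0 s0.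
suff : is_derive t (1 : R) ((fun t => ip Omega (ut t) (u s)) \o rho) (kconv kt (G^~ s) t - G t s).
  by rewrite /P (rho_id (ltW s0)).
have [_ _ _ /(_ _ _ (H10u (ltW s0)))[F' [_ /(_ t (ltW t0)) dF] /(_ t (ltW t0)) E]] := ws.
have -> : kconv kt (G^~ s) t - G t s = F' t; last exact: halfline_derive.
move: E; rewrite memory_gip ?ltW// dotv_gip//; last 2 first.
- by move=> i; exact: LDu (ltW t0).
- by move=> i; exact: LDu (ltW s0).
by rewrite /G (rho_id (ltW t0)) (rho_id (ltW s0)); lra.
Qed.

(** Here the Poincare inequality enters, turning the L^2 distance of u(t) and u(s) into the distance
    of their gradients. *)
Lemma P_difference_young t s (e : R) : 0 < e ->
  2 * `|P t t - P t s| <= e * Q t t + e^-1 * (4 * M ^+ 2 * dist2 G s t).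
Proof.
move=> e0; have Lt := Lut (rho_ge0 t).
rewrite /P -(ipBr mO (Lu (rho_ge0 t)) (Lu (rho_ge0 s)) Lt).
apply: (le_trans (ip_young mO e0 Lt (L2B mO (Lu (rho_ge0 t)) (Lu (rho_ge0 s))))).
rewrite lerD2l ler_wpM2l ?invr_ge0 ?(ltW e0)//.
have := poincare_H10 mO M_gt0 OM (H10u (rho_ge0 t)) (H10u (rho_ge0 s)).
rewrite -/(G t t) -/(G t s) -/(G s s) /dist2 (G_symmetric s t).
move/le_trans; apply; rewrite le_eqVlt; apply/orP; left; apply/eqP; ring.
Qed.

(** All three extended-real terms are finite, and [memory_tonelli] moves the space integral of the
    memory term inside. *)
Lemma energyE t : 0 <= t -> energy Omega k ut Du t = (menergy kt G Q t)%:E.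
Proof.
move=> t0.
have kE r : 0 <= r <= t -> k (t - r) = kt (t - r).
  by move=> /andP[_ rt]; rewrite /kt/= rho_id// subr_ge0.
rewrite /energy.
have -> : (\int[mu]_(x in Omega) (ut t x ^+ 2)%:E = (Q t t)%:E)%E.
  under eq_integral do rewrite expr2.
  rewrite /Q /ip (rho_id t0) /Rintegral fineK//.
  exact: (integrable_fin_num mO (L2_integrableM mO (Lut t0) (Lut t0))).
have LD s i : 0 <= s -> L2 Omega (fun x => Du s x 0 i) by exact: LDu.
have -> : (\int[mu]_(x in Omega) (dotv (Du t x) (Du t x))%:E = (G t t)%:E)%E.
  rewrite /G (rho_id t0) -(dotv_gip mO (fun i => LDu i t0) (fun i => LDu i t0)) /Rintegral fineK//.
  exact: (integrable_fin_num mO (integrable_dotv mO (fun i => LDu i t0) (fun i => LDu i t0))).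
have LDB s i : 0 <= s -> L2 Omega (fun x => (Du s x - Du t x) 0 i).
  move=> s0; rewrite (_ : (fun x => _) = (fun x => Du s x 0 i - Du t x 0 i)).
    by apply: L2B => //; exact: LDu.
  by apply/funext => x; rewrite !mxE.
have mD i : measurable_fun ((`[0, t]%classic : set (measurableTypeR R)) `*` Omega)
    (fun p : measurableTypeR R * 'rV[R]_N => Du p.1 p.2 0 i).
  have [_ _ /(_ i) m _] := ws; apply: measurable_funS m.
  - by apply: measurableX => //; exact: measurable_itv.
  - by move=> [r x] /= [+ Ox]; rewrite !in_itv/= andbT => /andP[].
have mDt i : measurable_fun ((`[0, t]%classic : set (measurableTypeR R)) `*` Omega)
    (fun p : measurableTypeR R * 'rV[R]_N => Du t p.2 0 i).
  pose f := (fun x => Du t x 0 i) \_ Omega.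
  apply: (eq_measurable_fun (f \o snd)).
    by move=> [r x]; rewrite inE /= => -[_ Ox]; rewrite /f patchE mem_set.
  apply: measurable_funTS; apply: (measurableT_comp _ measurable_snd).
  by apply/(measurable_restrictT _ mO); exact: L2_measurable (LDu i t0).
have -> : (\int[mu]_(x in Omega) \int[leb]_(s in `[0%R, t])
      (k (t - s)%R * dotv (Du s x - Du t x)%R (Du s x - Du t x)%R)%:E =
    (kconv kt (dist2 G ^~ t) t)%:E)%E.
  transitivity (\int[mu]_(x in Omega) \int[leb]_(s in `[0%R, t])
      (kt (t - s)%R * dotv (Du s x - Du t x)%R (Du s x - Du t x)%R)%:E)%E.
    apply: eq_integral => x _; apply: eq_integral => s; rewrite inE/= in_itv/= => s01.
    by rewrite kE.
  rewrite (memory_tonelli mO kt_cont kt_ge0 (W := fun s x => dotv (Du s x - Du t x) (Du s x - Du t x))).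
  - transitivity (\int[leb]_(s in `[0%R, t]) (kt (t - s) * dist2 G s t)%:E)%E.
      apply: eq_integral => s; rewrite inE/= in_itv/= => /andP[s0 _].
      rewrite (dotv_gip mO (fun i => LDB s i s0) (fun i => LDB s i s0)).
      by rewrite dist2_gip !rho_id.
    rewrite /kconv (rho_id t0) /Rintegral fineK//; apply: integrable_fin_num => //.
    apply: continuous_integrable_itv; apply: kshift_continuous => //.
    exact: (fixr_continuous (dist2_continuous G_continuous)).
  - apply: measurable_sum => i.
    rewrite (_ : (fun p : _ => _) = (fun p : measurableTypeR R * 'rV[R]_N =>
      (Du p.1 p.2 0 i - Du t p.2 0 i) * (Du p.1 p.2 0 i - Du t p.2 0 i))).
      2: by apply/funext => p; rewrite !mxE.
    by apply: measurable_funM; apply: measurable_funB.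
  - by move=> s x; apply: sumr_ge0 => i _; rewrite -expr2 sqr_ge0.
  - move=> s /andP[s0 _].
    exact: (integrable_dotv mO (fun i => LDB s i s0) (fun i => LDB s i s0)).
have -> : \int[leb]_(s in `[0, t]) k s = kmass kt t.
  rewrite /kmass (rho_id t0); apply: eq_Rintegral => s; rewrite inE/= in_itv/= => /andP[s0 _].
  by rewrite /kt/= rho_id.
by rewrite -!EFinM -!EFinD /menergy /pot; congr (_%:E); ring.
Qed.

End weak_solutions.

Lemma bounded_set_coord0 (R : realType) (n : nat) (Omega : set 'rV[R]_n.+1) :
  bounded_set Omega -> exists2 M : R, 0 < M & forall x, Omega x -> `|x 0 0| < M.
Proof.
move=> /ex_strict_bound_gt0[M M0 OM]; exists M => // x Ox.
have [_ H] : ball (0 : 'rV[R]_n.+1) M x.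
  by rewrite mx_norm_ball /ball_/= sub0r normrN; exact: (OM x Ox).
by have := H 0 0; rewrite mxE /ball/= sub0r normrN.
Qed.

Lemma decay_const_gt0 (R : realType) (eta c t1 km : R) :
  0 < eta -> 0 <= c -> 0 < t1 -> 0 < km -> 0 < decay_const eta c t1 km.
Proof.
move=> eta0 c0 t10 km0; rewrite /decay_const ltr_wpDl ?invr_gt0//.
have := (ltW eta0, ltW t10, ltW km0) => -[[e0 t0] m0].
have sq0 : 0 <= t1 ^+ 2 by rewrite exprn_ge0.
by rewrite !(mulr_ge0, addr_ge0, invr_ge0).
Qed.

Unset Implicit Arguments.

Theorem theorem1p1 (R : realType) (N : nat) (Omega : set 'rV[R]_N)
    (k : R -> R) (eta : R)
    (N_gt0 : (0 < N)%N)
    (Omega_open : open Omega) (Omega_bounded : bounded_set Omega)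
    (Omega_connected : connected Omega) (Omega_C2 : C2_boundary Omega)
    (k_ge0 : forall t : R, 0 <= t -> 0 <= k t)
    (k_ac : locally_abs_continuous k)
    (k0_gt0 : 0 < k 0)
    (k_int : (\int[@lebesgue_measure R]_(t in `[0%R, +oo[) (k t)%:E = 1)%E)
    (eta_gt0 : 0 < eta)
    (k_deriv : {ae @lebesgue_measure R, forall t : R, 0 <= t ->
       derivable k t 1 /\ derive1 k t <= - eta * k t}) :
  exists2 alpha : R, 0 < alpha &
    forall (u ut : R -> 'rV[R]_N -> R) (Du : R -> 'rV[R]_N -> 'rV[R]_N),
      weak_solution Omega k u ut Du ->
      forall t : R, 0 <= t ->
        (energy Omega k ut Du t <=
         energy Omega k ut Du 0 * (expR (1 - alpha * t))%:E)%E.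
Proof.
case: N N_gt0 Omega Omega_open Omega_bounded Omega_connected Omega_C2 => [//|n] _.
move=> Omega Omega_open Omega_bounded _ _.
have mO := open_measurable_rV Omega_open.
have [M M0 OM] := bounded_set_coord0 Omega_bounded.
pose kt := k \o rho.
have kt_cont : continuous kt by exact: abs_continuous_cvg.
have kt_ge0 t : 0 <= kt t by rewrite /kt/= k_ge0// rho_ge0.
have kt_decay t h : 0 <= t -> 0 <= h -> kt (t + h) <= expR (- (eta * h)) * kt t.
  move=> t0 h0; rewrite /kt/= !rho_id ?addr_ge0//.
  exact: (abs_continuous_exp_decay eta_gt0 k_ac k_ge0 k_deriv).
have kt_int : (\int[@lebesgue_measure R]_(t in `[0%R, +oo[) (kt t)%:E = 1)%E.
  rewrite -k_int; apply: eq_integral => t; rewrite inE/= in_itv/= andbT => t0.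
  by rewrite /kt/= rho_id.
have kt_tail := exp_decay_tail eta_gt0 kt_cont kt_ge0 kt_decay kt_int.
(* The window and the bound km = k 0 / 2 come from continuity at 0 and k 0 > 0. *)
have [t1 t10 kt_low] : exists2 t1, 0 < t1 & forall r, 0 <= r <= t1 -> k 0 / 2 <= kt r.
  have : \forall r \near (0 : R), k 0 / 2 < kt r.
    have /cvgrPdist_lt/(_ (k 0 / 2)) := kt_cont 0.
    rewrite divr_gt0// => /(_ isT); apply: filterS => r.
    rewrite {1}/kt/= rho_id// ltr_norml => /andP[_]; lra.
  move=> /nbhs_ballP[d /= d0 Hd]; exists (d / 2); first by rewrite divr_gt0.
  move=> r /andP[r0 rd]; apply/ltW/Hd; rewrite /ball/= sub0r normrN ger0_norm//; lra.
have k20 : 0 < k 0 / 2 by rewrite divr_gt0.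
have c0 : 0 <= 4 * M ^+ 2 by rewrite mulr_ge0// sqr_ge0.
have C0 := decay_const_gt0 eta_gt0 c0 t10 k20.
set C := decay_const _ _ _ _ in C0.
(* The rate is fixed before the solution is introduced: it depends on k, eta and the width M of
   Omega only. *)
exists (2 * t1 + C * expR 1)^-1.
  by rewrite invr_gt0 addr_gt0 ?mulr_gt0 ?expR_gt0.
move=> u ut Du ws t t0.
have kt_mass s s0 := (kt_tail s s0).1.
have kt_tail2 s s0 := (kt_tail s s0).2.
pose G s r := gip Omega (Du (rho s)) (Du (rho r)).
pose Q s r := ip Omega (ut (rho s)) (ut (rho r)).
pose P s r := ip Omega (ut (rho s)) (u (rho r)).
have G_cont : continuous (fun p : R * R => G p.1 p.2) by exact: (G_continuous mO ws).
have Q_cont : continuous (fun p : R * R => Q p.1 p.2) by exact: (Q_continuous mO ws).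
have P_cont : continuous (fun p : R * R => P p.1 p.2) by exact: (P_continuous mO ws).
have G_sym s r : G s r = G r s by exact: G_symmetric.
have Q_sym s r : Q s r = Q r s by exact: ipC.
have G0 s : 0 <= G s s by exact: gip_ge0.
have Q0 s : 0 <= Q s s by exact: ip_ge0.
have dist0 s r : 0 <= dist2 G s r by rewrite /G (dist2_gip mO ws) gip_ge0.
have dP1 (s r : R) : 0 < s -> 0 < r -> is_derive s (1 : R) (P^~ r) (kconv kt (G^~ r) s - G s r).
  exact: (P_derive1 mO eta_gt0 k_ge0 kt_cont kt_decay ws).
have dP2 (s r : R) : 0 < s -> 0 < r -> is_derive r (1 : R) (P s) (Q s r).
  exact: (P_derive2 mO ws).
have PY s r e := @P_difference_young _ _ _ _ _ mO M0 OM _ _ _ ws s r e.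
rewrite !(energyE mO k_ge0 kt_cont ws)// -EFinM lee_fin.
apply: (exp_decay_of_averages C0 t10 _ _ _ t0) => [s|s r|s T].
- exact: menergy_ge0.
- exact: (menergy_nincr kt_cont kt_ge0 eta_gt0 kt_decay kt_mass kt_tail2 G_cont Q_cont
    G_sym Q_sym G0 dist0 dP1 dP2).
- exact: (menergy_observability kt_cont kt_ge0 eta_gt0 kt_decay kt_mass kt_tail2 G_cont Q_cont
    G_sym Q_sym Q0 G0 dist0 dP1 dP2 c0 t10 k20 kt_low P_cont PY).
Qed.
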